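(* Let $d\ge2$ and let $U=\mathbb S^{d-1}\cap H_1^+\cap\cdots\cap H_r^+$ be a polyhedral domain of the unit sphere $\mathbb S^{d-1}\subset\mathbb R^d$. Then $U$ is nodal if and only if there exists a finite set $\Lambda$ of linear hyperplanes of $\mathbb R^d$ such that - $U$ is a connected component of $\mathbb S^{d-1}\setminus\bigl(\bigcup_{H\in\Lambda}H\bigr)$; - the Coxeter group $W:=\langle s_H\mid H\in\Lambda\rangle\subset O(d)$ is finite and acts on $\Lambda$ (i.e. $g(H)\in\Lambda$ for all $g\in W$, $H\in\Lambda$). Moreover, if $U$ satisfies the conditions above, let $k:=\sharp\Lambda$. Then the first eigenvalue of $U$ for the Dirichlet problem is $$\lambda_1(U)=k(d-2+k).$$
   Context: $\mathbb S^{d-1}=\{x\in\mathbb R^d: x_1^2+\dots+x_d^2=1\}$ carries the Riemannian metric $\sigma_{d-1}$ induced by the Euclidean metric; $\Delta_{\sigma_{d-1}}$ is its Laplace–Beltrami operator. A nonempty open set $U\subset\mathbb S^{d-1}$ is a polyhedral domain if $U=\mathbb S^{d-1}\cap H_1^+\cap\dots\cap H_r^+$, where each $H_i^+$ is an (open) half-space of $\mathbb R^d$ whose boundary is a linear hyperplane $H_i$; $r$ is assumed to be minimal in such a representation and is called the number of sides of $U$. A polyhedral domain $U$ is nodal if there exists $\phi\in\mathcal C^\infty(\mathbb S^{d-1})$ which is an eigenfunction of $-\Delta_{\sigma_{d-1}}$ on $\mathbb S^{d-1}$ with $\phi>0$ on $U$ and $\phi=0$ on $\partial U=\bigcup_{i=1}^r(H_i\cap\overline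 U)$. $\lambda_1(U)$ is the smallest eigenvalue of the Dirichlet problem $-\Delta_{\sigma_{d-1}}m=\lambda m$ in $U$, $m=0$ on $\partial U$. For a linear hyperplane $H$ of $\mathbb R^d$, $s_H$ denotes the orthogonal reflection with respect to $H$. *)

(* Defs.v *)
From HB Require Import structures.
From mathcomp Require Import all_boot all_order all_algebra.
From mathcomp Require Import finmap.
From mathcomp Require Import all_classical all_reals all_analysis.

Set Implicit Arguments.
Unset Strict Implicit.
Unset Printing Implicit Defensive.

Import Order.TTheory GRing.Theory Num.Theory.
Import numFieldNormedType.Exports.

Local Open Scope classical_set_scope.
Local Open Scope ring_scope.

(* Vectors of R^d are row vectors.  The library norm on 'rV[R]_d is the sup
   norm, hence the Euclidean structure is introduced here; the topology is the
   same. *)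
Section Euclidean.
Variables (R : realType) (d : nat).
Implicit Types (u v x a : 'rV[R]_d).

Definition dotp u v : R := \sum_i u 0 i * v 0 i.

Definition enorm x : R := Num.sqrt (dotp x x).

Definition sphere : set 'rV[R]_d := [set x | dotp x x = 1].

Definition e_ (j : 'I_d) : 'rV[R]_d := delta_mx 0 j.

End Euclidean.

(* Calculus on (open subsets of) the unit sphere.  A scalar or vector function
   on a subset of the sphere is given by a total function on R^d of which only
   the values on that subset matter: it is differentiated through its extension [ext]
   that is constant along rays. *)
Section SphereCalculus.
Variables (R : realType) (d : nat).
Implicit Types (x y v : 'rV[R]_d) (U A B : set 'rV[R]_d) (f : 'rV[R]_d -> R).

Definition radial x : 'rV[R]_d := (enorm x)^-1 *: x.

Definition ext (T : Type) (f : 'rV[R]_d -> T) : 'rV[R]_d -> T := f \o radial.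

(* The open cone over U.  It does not contain 0 when U lies on the sphere, since
   radial 0 = 0. *)
Definition cone U : set 'rV[R]_d := radial @^-1` U.

(* Functions of class C^k on an open set A of R^d: all the iterated partial
   derivatives of order at most k exist and are continuous at the points of A. *)
Fixpoint Ck (k : nat) A f : Prop :=
  (forall x, A x -> {for x, continuous f}) /\
  (if k is k'.+1 then
     forall j : 'I_d, (forall x, A x -> derivable f x (e_ R j)) /\
                      Ck k' A ('D_(e_ R j) f)
   else True).

(* C^k(U), for U open in the sphere: radial is a smooth retraction of the
   (open) cone onto U. *)
Definition sphere_Ck (k : nat) U f : Prop := Ck k (cone U) (ext f).

Definition sphere_smooth f : Prop := forall k, sphere_Ck k (@sphere R d) f.

(* Orthogonal projection onto the tangent space x^\perp, for x on the sphere. *)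
Definition tproj x v : 'rV[R]_d := v - dotp v x *: x.

(* For v tangent to the sphere at x. *)
Definition sdiff f x v : R := 'D_v (ext f) x.

(* Levi-Civita connection of the induced metric, for v tangent at x: tangential
   part of the Euclidean derivative of the vector field X in the direction v. *)
Definition nabla (X : 'rV[R]_d -> 'rV[R]_d) x v : 'rV[R]_d :=
  tproj x ('D_v (ext X) x).

(* Riemannian gradient: the tangent vector at x that represents the
   differential, dotp (sgrad f x) v = sdiff f x v for v tangent at x. *)
Definition sgrad f x : 'rV[R]_d := \row_j sdiff f x (tproj x (e_ R j)).

(* Riemannian divergence: the trace of v |-> nabla X x v on the tangent space,
   computed on R^d after composition with tproj x, which kills the normal. *)
Definition sdiv (X : 'rV[R]_d -> 'rV[R]_d) x : R :=
  \sum_j nabla X x (tproj x (e_ R j)) 0 j.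

Definition laplace_beltrami f x : R := sdiv (sgrad f) x.

Definition sphere_eigenfunction (mu : R) f : Prop :=
  [/\ sphere_smooth f,
      exists2 x, @sphere R d x & f x != 0
    & forall x, @sphere R d x -> - laplace_beltrami f x = mu * f x].

(* Dirichlet problem in U (open in the sphere) with boundary B, in the
   classical sense: eigenfunctions lie in C^2(U) and C^0(closure U). *)
Definition dirichlet_eigenvalue U B (lam : R) : Prop :=
  exists m : 'rV[R]_d -> R,
    [/\ sphere_Ck 2 U m,
        {within closure U, continuous m},
        exists2 x, U x & m x != 0,
        forall x, U x -> - laplace_beltrami m x = lam * m x
      & forall x, B x -> m x = 0].

Definition is_lambda1 U B (lam : R) : Prop :=
  dirichlet_eigenvalue U B lam /\
  forall mu, dirichlet_eigenvalue U B mu -> lam <= mu.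

End SphereCalculus.

Section Polyhedral.
Variables (R : realType) (d : nat).
Implicit Types (a x : 'rV[R]_d) (H U : set 'rV[R]_d).

Definition hyperplane a : set 'rV[R]_d := [set x | dotp a x = 0].

Definition half_space a : set 'rV[R]_d := [set x | 0 < dotp a x].

Definition is_hyperplane H : Prop := exists2 a, a != 0 & H = hyperplane a.

Definition cell r (a : 'I_r -> 'rV[R]_d) : set 'rV[R]_d :=
  @sphere R d `&` \bigcap_i half_space (a i).

Definition boundary r (a : 'I_r -> 'rV[R]_d) : set 'rV[R]_d :=
  \bigcup_i (hyperplane (a i) `&` closure (cell a)).

(* cell a is a polyhedral domain with r sides, i.e. r is minimal. *)
Definition polyhedral r (a : 'I_r -> 'rV[R]_d) : Prop :=
  [/\ cell a !=set0,
      forall i, a i != 0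
    & forall s (b : 'I_s -> 'rV[R]_d),
        (forall i, b i != 0) -> cell b = cell a -> (r <= s)%N].

Definition nodal r (a : 'I_r -> 'rV[R]_d) : Prop :=
  exists mu : R, exists phi : 'rV[R]_d -> R,
    [/\ sphere_eigenfunction mu phi,
        forall x, cell a x -> 0 < phi x
      & forall x, boundary a x -> phi x = 0].

(* Linear maps of R^d are matrices acting on row vectors on the right. *)
Definition orthogonal_group : set 'M[R]_d := [set g | g *m g^T = 1%:M].

Definition orthogonal_subgroup (G : set 'M[R]_d) : Prop :=
  [/\ G `<=` orthogonal_group,
      G 1%:M,
      forall g h, G g -> G h -> G (g *m h)
    & forall g, G g -> G (invmx g)].

(* A normal vector of H, chosen arbitrarily. *)
Definition normal H : 'rV[R]_d :=
  xget 0 [set a | a != 0 /\ H = hyperplane a].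

(* s_H, i.e. x |-> x - 2 <a, x> / <a, a> a, which does not depend on the
   normal vector a of H. *)
Definition reflection H : 'M[R]_d :=
  let a := normal H in 1%:M - (2 / dotp a a) *: (a^T *m a).

(* The subgroup of O(d) generated by the s_H, H in L. *)
Definition coxeter_group (L : set (set 'rV[R]_d)) : set 'M[R]_d :=
  smallest orthogonal_subgroup [set reflection H | H in L].

Definition acts_on (W : set 'M[R]_d) (L : set (set 'rV[R]_d)) : Prop :=
  forall g H, W g -> L H -> L [set x *m g | x in H].

Definition is_component U A : Prop :=
  exists2 x, A x & U = connected_component A x.

Definition coxeter_arrangement U (L : set (set 'rV[R]_d)) : Prop :=
  [/\ finite_set L,
      forall H, L H -> is_hyperplane H,
      is_component U (@sphere R d `\` \bigcup_(H in L) H),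
      finite_set (coxeter_group L)
    & acts_on (coxeter_group L) L].

End Polyhedral.

(* Main.v *)
(* Functions on the sphere are studied through their 0-homogeneous extensions F, for
   which the spherical Laplacian is the Euclidean one on the sphere.

   Suppose that U is nodal.  The eigenfunction vanishes near some point of each side
   H, so F + F o s_H vanishes to second order there, hence to infinite order by the
   eigenvalue equation.  Bernstein's inequality bounds the iterated rotational
   derivatives of F geometrically, which gives unique continuation: F o s_H = - F.
   Take for Lambda all the hyperplanes with this property.  Its Coxeter group W
   preserves F up to sign, so it acts on Lambda; U avoids Lambda, because F vanishes
   on it.  Two distinct nearby members of Lambda would generate a rotation by a small
   angle, one of whose images of a hyperplane would meet a ball around a point of the
   cone over U; so Lambda is finite by compactness, and W, which is determined by its
   action on the unit normals, is finite too.

   Conversely let P be the product of the k linear forms <b_i, x> given by the unit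
   normals positive on U.  The sum of <b_i, b_j> / (<b_i, x> <b_j, x>) over i <> j
   vanishes, because reflections permute the normals up to sign and so remove the
   poles.  Hence P is harmonic, homogeneous of degree k, and therefore an
   eigenfunction on the sphere with eigenvalue k (d - 2 + k).

   Finally, if mu < k (d - 2 + k), adding to P a small barrier yields a strict
   supersolution for mu which is positive up to the boundary of U; comparing it with
   a Dirichlet eigenfunction by the maximum principle shows that mu is no eigenvalue. *)

Require Import Defs.
From HB Require Import structures.
From mathcomp Require Import all_boot all_order all_algebra.
From mathcomp Require Import finmap.
From mathcomp Require Import all_classical all_reals all_analysis.
From mathcomp Require Import ring lra zify.

Set Implicit Arguments.
Unset Strict Implicit.
Unset Printing Implicit Defensive.

Import Order.TTheory GRing.Theory Num.Theory.
Import numFieldNormedType.Exports.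

Local Open Scope classical_set_scope.
Local Open Scope ring_scope.

(** * Calculus on row vectors *)

(** Positivity and vanishing of the eigenfunction are known only on U and its boundary, while a
    reflection acts on the whole sphere; unique continuation is what carries information across a
    wall. In place of analyticity it rests on a commutation: infinitesimal rotations preserve the
    eigenvalue equation, so every iterated rotational derivative is an eigenfunction for the same
    mu, and each step costs the same factor 2 (|mu| + 1). Taking all sign-reversing hyperplanes,
    rather than the images of the sides, makes stability under the group immediate; the price is
    that finiteness has to be proved, and positivity inside U serves a second time there. In the
    bound for the first eigenvalue, the gap k (d - 2 + k) - mu pays for the error of the barrier
    where P is bounded below; near the walls, where P is small, a large exponent in the barrier pays
    for it. *)

Section Calculus.
Variables (R : realType) (d : nat).
Local Notation V := 'rV[R]_d.
Implicit Types (F G : V -> R) (A B : set V) (x y v w : V).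

Lemma nearP x (P : V -> Prop) :
  (\near x, P x) <-> exists2 r : R, 0 < r & forall h, `|h| < r -> P (x + h).
Proof.
rewrite nbhs_normP; split=> [[r /= r0 rP]|[r r0 rP]]; exists r => //.
  by move=> h hr; apply: rP; rewrite /= opprD addrA subrr sub0r normrN.
by move=> y /= yr; rewrite -[y](subrK x) addrC; apply: rP; rewrite distrC.
Qed.

(** Collects the points at which the mean value theorem is applied in the difference quotients
    below; [s] and [t] are quantified after [h], since the intermediate points depend on [h]. *)
Lemma near_parallelogram x v w (P : V -> Prop) : (\near x, P x) ->
  \forall h \near (0 : R), forall s t : R, 0 <= s <= 1 -> 0 <= t <= 1 ->
    P (x + (s * h) *: v + (t * h) *: w).
Proof.
move=> /nearP[r r0 rP]; pose M := `|v| + `|w| + 1.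
have M0 : 0 < M by rewrite ltr_wpDl// addr_ge0.
near=> h => s t /andP[s0 s1] /andP[t0 t1]; rewrite -addrA; apply: rP.
have hr : `|h| * M < r.
  rewrite -ltr_pdivlMr//; near: h; apply/nbhs_normP.
  by exists (r / M); rewrite /= ?divr_gt0// => z /=; rewrite sub0r normrN.
apply: le_lt_trans hr; apply: le_trans (ler_normD _ _) _.
rewrite -!scalerA !normrZ (ger0_norm s0) (ger0_norm t0) [s * _]mulrCA [t * _]mulrCA.
rewrite -mulrDr ler_wpM2l// /M -[leLHS]addr0 !lerD//.
  by rewrite -[leRHS]mul1r ler_wpM2r.
by rewrite -[leRHS]mul1r ler_wpM2r.
Unshelve. all: by end_near. Qed.

(** Turns a directional derivative into a one-variable one, through which the mean value theorem and
    the chain rule enter. *)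
Lemma is_derive_lineP F x v (t a : R) :
  is_derive t 1 (fun s => F (x + s *: v)) a <-> is_derive (x + t *: v) v F a.
Proof.
have E : (fun h : R => h^-1 *: (((fun s => F (x + s *: v)) \o shift t) (h *: 1) -
    F (x + t *: v))) =
   (fun h => h^-1 *: ((F \o shift (x + t *: v)) (h *: v) - F (x + t *: v))).
  by apply/funext => h /=; rewrite scalerDl [h *: 1]mulr1 addrCA addrA.
by split=> -[]; rewrite /derivable /derive => c e; split;
  rewrite /derivable /derive; move: c e; rewrite E.
Qed.

Lemma is_derive_line F x v (t : R) : derivable F (x + t *: v) v ->
  is_derive t 1 (fun s => F (x + s *: v)) ('D_v F (x + t *: v)).
Proof. by move=> dF; apply/is_derive_lineP. Qed.

Lemma MVT_line F x v : (forall t : R, 0 <= t <= 1 -> derivable F (x + t *: v) v) ->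
  exists2 t : R, 0 <= t <= 1 & F (x + v) - F x = 'D_v F (x + t *: v).
Proof.
move=> dF.
have dg (t : R) : t \in `]0, 1[ -> is_derive t 1 (fun s => F (x + s *: v)) ('D_v F (x + t *: v)).
  by rewrite in_itv /= => /andP[t0 t1]; apply/is_derive_line/dF; rewrite !ltW.
have [|c] := MVT_segment ler01 dg.
  apply: derivable_within_continuous => t; rewrite in_itv /= => tI.
  by have [] := is_derive_line (dF t tI).
rewrite in_itv /= scale0r addr0 scale1r subr0 mulr1 => cI E.
by exists c.
Qed.

Lemma is_deriveZv F x v (c : R) : derivable F x v ->
  is_derive x (c *: v) F (c * 'D_v F x).
Proof.
move=> dF; have E0 w : x = x + 0 *: w by rewrite scale0r addr0.
rewrite [x in is_derive x](E0 (c *: v)); apply/is_derive_lineP.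
have -> : (fun s : R => F (x + s *: (c *: v))) = (fun s => F (x + s *: v)) \o (fun s => s * c).
  by apply/funext => s /=; rewrite scalerA.
rewrite mulrC; apply: is_derive1_comp.
  by apply/is_derive_lineP; rewrite mul0r -E0.
by apply: is_derive_eq; rewrite ?scaler0 ?add0r /= [LHS]mulr1.
Qed.

(** The increment along [v + w] is split into a step along [v], then one along [w]; the mean value
    theorem turns the second into ['D_w F] at a nearby point, where continuity applies. *)
Lemma is_deriveDv F x v w (a : R) : is_derive x v F a ->
  (\near x, derivable F x w) -> {for x, continuous ('D_w F)} ->
  is_derive x (v + w) F (a + 'D_w F x).
Proof.
move=> dv dw cw.
suff : (fun h : R => h^-1 *: ((F \o shift x) (h *: (v + w)) - F x)) @ 0^' --> a + 'D_w F x.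
  by move=> c; split; [apply/cvg_ex; exists (a + 'D_w F x)|exact: cvg_lim c].
have c1 : (fun h : R => h^-1 *: ((F \o shift x) (h *: v) - F x)) @ 0^' --> a.
  by case: dv => + <-; exact.
have c2 : (fun h : R => h^-1 *: (F (x + h *: v + h *: w) - F (x + h *: v))) @ 0^' --> 'D_w F x.
  apply/cvgrPdist_lt => e e0.
  have cwe : \forall y \near x, `|'D_w F x - 'D_w F y| < e /\ derivable F y w.
    apply: filterI => //; by move/cvgrPdist_lt : cw; exact.
  have pe := near_parallelogram v w cwe.
  near=> h.
  have h0 : h != 0 by near: h; exact: nbhs_dnbhs_neq.
  have pe2 : forall s t : R, 0 <= s <= 1 -> 0 <= t <= 1 ->
     `|'D_w F x - 'D_w F (x + (s * h) *: v + (t * h) *: w)| < e /\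
     derivable F (x + (s * h) *: v + (t * h) *: w) w.
    by near: h; exact: (nbhs_dnbhs pe).
  have {}pe2 t : 0 <= t <= 1 -> `|'D_w F x - 'D_w F (x + h *: v + t *: (h *: w))| < e /\
     derivable F (x + h *: v + t *: (h *: w)) w.
    by move=> tI; rewrite scalerA -[h in h *: v]mul1r; apply: pe2; rewrite ?ler01 ?lexx.
  have [t t01|t t01 ->] := @MVT_line F (x + h *: v) (h *: w).
    by have [_ /(is_deriveZv h)[]] := pe2 _ t01.
  have [pt /(is_deriveZv h)[_ ->]] := pe2 _ t01.
  by rewrite [_ *: _]mulrA mulVf// mul1r.
apply: cvg_trans; last exact: (cvgD c1 c2).
apply: near_eq_cvg; near=> h; move=> /=.
change (h^-1 *: (F (h *: v + x) - F x) + h^-1 *: (F (x + h *: v + h *: w) - F (x + h *: v)) =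
  h^-1 *: (F (h *: (v + w) + x) - F x)).
have -> : h *: (v + w) + x = x + h *: v + h *: w by rewrite scalerDr addrC addrA.
by rewrite [h *: v + x]addrC -scalerDr; congr (_ *: _); ring.
Unshelve. all: by end_near. Qed.

Lemma near_eq_continuous F G x : (\near x, F x = G x) ->
  {for x, continuous F} -> {for x, continuous G}.
Proof.
move=> FG cF A; rewrite -(nbhs_singleton FG) => /cF.
exact: (@near_eq_cvg V R (nbhs x) (nbhs_filter x) F G FG).
Qed.

Lemma is_derive_shift F x v w (a : R) :
  is_derive (x + w) v F a -> is_derive x v (fun y => F (y + w)) a.
Proof.
have E : (fun h : R => h^-1 *: (((fun y => F (y + w)) \o shift x) (h *: v) - F (x + w))) =
   (fun h => h^-1 *: ((F \o shift (x + w)) (h *: v) - F (x + w))).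
  by apply/funext => h /=; rewrite addrA.
by move=> -[]; rewrite /derivable /derive -E.
Qed.

(** Mean value theorem along [v] for the difference [G], then along [w] for ['D_v F]. The left side
    is symmetric in [v] and [w], which is what [schwarz] exploits. *)
Lemma second_difference F x v w (h : R) :
  (forall s t : R, 0 <= s <= 1 -> 0 <= t <= 1 ->
     derivable F (x + (s * h) *: v + (t * h) *: w) v /\
     derivable ('D_v F) (x + (s * h) *: v + (t * h) *: w) w) ->
  exists s t : R, [/\ 0 <= s <= 1, 0 <= t <= 1 &
    F (x + h *: v + h *: w) - F (x + h *: v) - (F (x + h *: w) - F x) =
    h * (h * 'D_w ('D_v F) (x + (s * h) *: v + (t * h) *: w))].
Proof.
move=> dF; pose G y := F (y + h *: w) - F y.
have I0 : 0 <= (0 : R) <= 1 by rewrite lexx ler01.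
have I1 : 0 <= (1 : R) <= 1 by rewrite lexx ler01.
have dG s : 0 <= s <= 1 -> is_derive (x + (s * h) *: v) v G
    ('D_v F (x + (s * h) *: v + h *: w) - 'D_v F (x + (s * h) *: v)).
  move=> sI; apply: is_deriveB; last first.
    by have [+ _] := dF s 0 sI I0; rewrite mul0r scale0r addr0 => /derivableP.
  apply: is_derive_shift; have [+ _] := dF s 1 sI I1.
  by rewrite mul1r => /derivableP.
have [s sI|s sI E1] := @MVT_line G x (h *: v).
  by rewrite scalerA; have [/(is_deriveZv h)[]] := dG s sI.
have [t tI|t tI E2] := @MVT_line ('D_v F) (x + (s * h) *: v) (h *: w).
  by rewrite scalerA; have [_ /(is_deriveZv h)[]] := dF s t sI tI.
exists s, t; split=> //; rewrite -/(G (x + h *: v)) -/(G x) E1 scalerA.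
have [dGs eGs] := dG s sI; have [_ ->] := is_deriveZv h dGs; rewrite eGs E2 scalerA.
by have [_ /(is_deriveZv h)[_ ->]] := dF s t sI tI.
Qed.

Lemma dist_half (a b c e : R) : `|a - c| < e / 2 -> `|b - c| < e / 2 -> `|a - b| <= e.
Proof. by rewrite !ltr_norml => b1 b2; rewrite ler_norml; lra. Qed.

Lemma schwarz F x v w :
  (\near x, (derivable F x v /\ derivable F x w) /\
            (derivable ('D_v F) x w /\ derivable ('D_w F) x v)) ->
  {for x, continuous ('D_w ('D_v F))} -> {for x, continuous ('D_v ('D_w F))} ->
  'D_w ('D_v F) x = 'D_v ('D_w F) x.
Proof.
move=> dF c1 c2; apply/eqP; rewrite -subr_eq0 -normr_le0; apply/ler_addgt0Pr => e e0.
rewrite add0r.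
have e20 : 0 < e / 2 by rewrite divr_gt0.
have n1 : \forall y \near x, ((derivable F y v /\ derivable F y w) /\
    (derivable ('D_v F) y w /\ derivable ('D_w F) y v)) /\
    (`|'D_w ('D_v F) x - 'D_w ('D_v F) y| < e / 2 /\
     `|'D_v ('D_w F) x - 'D_v ('D_w F) y| < e / 2).
  apply: filterI => //; apply: filterI.
    by move/cvgrPdist_lt : c1; exact.
  by move/cvgrPdist_lt : c2; exact.
have /nbhs_normP[r /= r0 rP] := near_parallelogram v w n1.
have /nbhs_normP[r' /= r'0 rP'] := near_parallelogram w v n1.
pose h := Num.min r r' / 2; have h0 : 0 < h by rewrite divr_gt0// lt_min r0.
have : `|h| < Num.min r r' by rewrite gtr0_norm// ltr_pdivrMr// ltr_pMr ?ltr1n// lt_min r0.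
rewrite lt_min => /andP[hr hr'].
have p1 := rP h; rewrite /= sub0r normrN in p1; have {}p1 := p1 hr.
have p2 := rP' h; rewrite /= sub0r normrN in p2; have {}p2 := p2 hr'.
have {}h0 : h != 0 by rewrite gt_eqF.
clearbody h.
have [|s [t [sI tI E1]]] := @second_difference F x v w h.
  by move=> s t sI tI; have [[[? _] [? _]] _] := p1 s t sI tI.
have [|s' [t' [sI' tI' E2]]] := @second_difference F x w v h.
  by move=> s' t' sI' tI'; have [[[_ ?] [_ ?]] _] := p2 s' t' sI' tI'.
have E : 'D_w ('D_v F) (x + (s * h) *: v + (t * h) *: w) =
         'D_v ('D_w F) (x + (s' * h) *: w + (t' * h) *: v).
  have : h * (h * 'D_w ('D_v F) (x + (s * h) *: v + (t * h) *: w)) =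
         h * (h * 'D_v ('D_w F) (x + (s' * h) *: w + (t' * h) *: v)).
    apply: etrans (esym E1) (etrans _ E2).
    have -> : x + h *: w + h *: v = x + h *: v + h *: w by rewrite addrAC.
    move: (F (x + h *: v + h *: w)) (F (x + h *: v)) (F (x + h *: w)) (F x) => a b c z.
    ring.
  move: ('D_w ('D_v F) _) ('D_v ('D_w F) _) => a b.
  by move=> /(mulfI h0)/(mulfI h0).
have [_ [b1 _]] := p1 s t sI tI; have [_ [_ b2]] := p2 s' t' sI' tI'.
move: b1 b2; rewrite E; move: ('D_w ('D_v F) x) ('D_v ('D_w F) x) ('D_v ('D_w F) _) => a b c.
exact: dist_half.
Qed.

Lemma near_line x v (P : V -> Prop) : (\near x, P x) ->
  exists2 r : R, 0 < r & forall s, `|s| < r -> P (x + s *: v).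
Proof.
move=> /(near_parallelogram v 0)/nbhs_normP[r /= r0 rP]; exists r => // s sr.
have := rP s; rewrite /= sub0r normrN => /(_ sr 1 0).
by rewrite mul1r mul0r scale0r addr0; apply; rewrite ?lexx ?ler01.
Qed.

Lemma derive_max0 F x v : (\near x, derivable F x v) ->
  (\forall y \near x, F y <= F x) -> 'D_v F x = 0.
Proof.
move=> dF mF; have [r r0 rP] := near_line v (filterI dF mF).
have I s : s \in `](- r), r[ -> `|s| < r by rewrite in_itv /= ltr_norml.
have [||||_] := @derive1_at_max R (fun s => F (x + s *: v)) (- r) r 0.
- by lra.
- by move=> t /I/rP[+ _] => /is_derive_line[].
- by rewrite in_itv /= oppr_lt0 r0.
- by move=> t /I/rP[_]; rewrite scale0r addr0.
have [] := @is_derive_line F x v 0; first by rewrite scale0r addr0; exact: nbhs_singleton dF.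
by rewrite scale0r addr0 => _ ->.
Qed.

(** Were the second derivative positive, ['D_v F], zero at [x], would be positive just after it, and
    the mean value theorem would give a larger value of [F]. *)
Lemma derive2_max F x v : (\near x, derivable F x v) -> derivable ('D_v F) x v ->
  (\forall y \near x, F y <= F x) -> 'D_v ('D_v F) x <= 0.
Proof.
move=> dF d2F mF; rewrite leNgt; apply/negP => pos.
have D0 := derive_max0 dF mF.
have [r r0 rP] := near_line v (filterI dF mF).
have /cvgr_gt/(_ 0 pos) : (fun h : R => h^-1 *: (('D_v F \o shift x) (h *: v) - 'D_v F x)) @ 0^' --> 'D_v ('D_v F) x := d2F.
rewrite /dnbhs /within /= => /nbhs_normP[r' /= r'0 r'P].
pose h := Num.min r r' / 2.
have h0 : 0 < h by rewrite divr_gt0// lt_min r0.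
have hm : h < Num.min r r' by rewrite /h ltr_pdivrMr// ltr_pMr ?ltr1n// lt_min r0.
have S s : 0 <= s <= h -> `|s| < r /\ `|s| < r'.
  move=> /andP[s0 sh]; rewrite ger0_norm//.
  by move: (le_lt_trans sh hm); rewrite lt_min => /andP[].
have D s : 0 <= s <= h -> is_derive s 1 (fun s => F (x + s *: v)) ('D_v F (x + s *: v)).
  by move=> /S[/rP[+ _] _]; exact: is_derive_line.
have [s|s|c] := @MVT R (fun s => F (x + s *: v)) (fun s => 'D_v F (x + s *: v)) 0 h h0.
- by rewrite in_itv /= => /andP[a b]; apply: D; rewrite !ltW.
- apply: derivable_within_continuous => t; rewrite in_itv /= => tI.
  by have [] := D t tI.
rewrite in_itv /= => /andP[c0 ch]; rewrite scale0r addr0 subr0 => E.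
have [|cr cr'] := S c; first by rewrite !ltW.
have := r'P c; rewrite /= sub0r normrN => /(_ cr').
rewrite gt_eqF// D0 subr0 /= => /(_ isT); rewrite [_ *: _]mulrC pmulr_lgt0 ?invr_gt0//.
rewrite [_ + x]addrC => Dc.
have := S h; rewrite (ltW h0) lexx => /(_ isT)[/rP[_ +] _].
by rewrite -subr_le0 E leNgt mulr_gt0.
Qed.

End Calculus.

(** * Functions of class C^k and the Euclidean Laplacian *)

Section CkTheory.
Variables (R : realType) (d : nat).
Local Notation V := 'rV[R]_d.
Local Notation e j := (e_ R j).
Implicit Types (F G : V -> R) (A B : set V) (x y v w : V).

Lemma near_open A x (P : V -> Prop) : open A -> A x -> (forall y, A y -> P y) ->
  \near x, P x.
Proof. by move=> oA Ax AP; apply: filterS (open_nbhs_nbhs (conj oA Ax)). Qed.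

Lemma Ck_cont k A F x : Ck k A F -> A x -> {for x, continuous F}.
Proof. by case: k => [|k] [cF _] /cF. Qed.

Lemma CkW k A F : Ck k.+1 A F -> Ck k A F.
Proof.
elim: k F => [|k IH] F [cF dF]; first by split.
by split=> // j; have [? /IH] := dF j.
Qed.

Lemma Ck_le m k A F : (m <= k)%N -> Ck k A F -> Ck m A F.
Proof.
by move=> /subnKC <-; elim: (k - m)%N => [|n IH]; rewrite ?addn0 // addnS => /CkW.
Qed.

Lemma Ck_sub k A B F : A `<=` B -> Ck k B F -> Ck k A F.
Proof.
move=> AB; elim: k F => [|k IH] F [cF dF]; first by split=> // x /AB/cF.
split=> [x /AB/cF //|j]; have [dj /IH Ck] := dF j.
by split=> // x /AB/dj.
Qed.

Lemma Ck_eq k A F G : open A -> (forall x, A x -> F x = G x) -> Ck k A F -> Ck k A G.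
Proof.
move=> oA; elim: k F G => [|k IH] F G FG [cF dF].
  by split=> // x Ax; apply: (near_eq_continuous _ (cF x Ax)); exact: (near_open oA Ax).
split=> [x Ax|j].
  by apply: (near_eq_continuous _ (cF x Ax)); exact: (near_open oA Ax).
have [dj Cj] := dF j; split=> [x Ax|].
  by apply: (near_eq_derivable _ (dj x Ax)); exact: (near_open oA Ax).
by apply: (IH _ _ _ Cj) => x Ax; apply: near_eq_derive; exact: (near_open oA Ax).
Qed.

Lemma Ck_derivable k A F x j : Ck k.+1 A F -> A x -> derivable F x (e j).
Proof. by move=> [_ /(_ j)[+ _]]; apply. Qed.

Arguments Ck_derivable {k A F x} j _ _.

Lemma Ck_partial k A F j : Ck k.+1 A F -> Ck k A ('D_(e j) F).
Proof. by move=> [_ /(_ j)[]]. Qed.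

Arguments Ck_partial {k A F} j _.

Lemma Ck_cst k A (c : R) : Ck k A (fun=> c).
Proof.
elim: k c => [|k IH] c; first by split=> // x _; exact: cst_continuous.
split=> [x _|j]; first exact: cst_continuous.
split=> [x _|]; first exact: derivable_cst.
suff -> : 'D_(e j) (fun=> c) = (fun=> 0) by [].
by apply/funext => x; rewrite (derive_cst c).
Qed.

Lemma CkD k A F G : open A -> Ck k A F -> Ck k A G -> Ck k A (fun x => F x + G x).
Proof.
move=> oA; elim: k F G => [|k IH] F G [cF dF] [cG dG].
  by split=> // x Ax; exact: (cvgD (cF x Ax) (cG x Ax)).
split=> [x Ax|j]; first exact: (cvgD (cF x Ax) (cG x Ax)).
have [dFj CFj] := dF j; have [dGj CGj] := dG j.
split=> [x Ax|]; first by apply: (derivableD (dFj x Ax) (dGj x Ax)).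
apply: (Ck_eq oA _ (IH _ _ CFj CGj)) => x Ax.
by rewrite (deriveD (dFj x Ax) (dGj x Ax)).
Qed.

Lemma CkM k A F G : open A -> Ck k A F -> Ck k A G -> Ck k A (fun x => F x * G x).
Proof.
move=> oA; elim: k F G => [|k IH] F G CF CG.
  by split=> // x Ax; exact: (cvgM (Ck_cont CF Ax) (Ck_cont CG Ax)).
split=> [x Ax|j]; first exact: (cvgM (Ck_cont CF Ax) (Ck_cont CG Ax)).
have dFj x := Ck_derivable (x := x) j CF; have dGj x := Ck_derivable (x := x) j CG.
split=> [x Ax|]; first by apply: (derivableM (dFj x Ax) (dGj x Ax)).
apply: (Ck_eq oA _ (CkD oA (IH _ _ (CkW CF) (Ck_partial j CG)) (IH _ _ (CkW CG) (Ck_partial j CF)))).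
by move=> x Ax; rewrite (deriveM (dFj x Ax) (dGj x Ax)).
Qed.

Lemma CkZ k A F (c : R) : open A -> Ck k A F -> Ck k A (fun x => c * F x).
Proof. by move=> oA; apply: CkM => //; exact: Ck_cst. Qed.

Lemma CkB k A F G : open A -> Ck k A F -> Ck k A G -> Ck k A (fun x => F x - G x).
Proof.
move=> oA CF CG; have -> : (fun x => F x - G x) = (fun x => F x + (-1) * G x).
  by apply/funext => x; rewrite mulN1r.
by apply: CkD => //; exact: CkZ.
Qed.

Lemma Ck_sum (I : Type) (s : seq I) (P : pred I) k A (F : I -> V -> R) : open A ->
  (forall i, P i -> Ck k A (F i)) -> Ck k A (fun x => \sum_(i <- s | P i) F i x).
Proof.
move=> oA CF; elim: s => [|i s IH].
  have -> : (fun x => \sum_(i <- [::] | P i) F i x) = (fun=> 0).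
    by apply/funext => x; rewrite big_nil.
  exact: Ck_cst.
have -> : (fun x => \sum_(j <- i :: s | P j) F j x) =
   if P i then (fun x => F i x + \sum_(j <- s | P j) F j x) else (fun x => \sum_(j <- s | P j) F j x).
  by apply/funext => x; rewrite big_cons; case: ifP.
by case: ifP => // Pi; apply: CkD => //; exact: CF.
Qed.

Lemma Ck_prod (I : Type) (s : seq I) (P : pred I) k A (F : I -> V -> R) : open A ->
  (forall i, P i -> Ck k A (F i)) -> Ck k A (fun x => \prod_(i <- s | P i) F i x).
Proof.
move=> oA CF; elim: s => [|i s IH].
  have -> : (fun x => \prod_(i <- [::] | P i) F i x) = (fun=> 1).
    by apply/funext => x; rewrite big_nil.
  exact: Ck_cst.
have -> : (fun x => \prod_(j <- i :: s | P j) F j x) =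
   if P i then (fun x => F i x * \prod_(j <- s | P j) F j x) else (fun x => \prod_(j <- s | P j) F j x).
  by apply/funext => x; rewrite big_cons; case: ifP.
by case: ifP => // Pi; apply: CkM => //; exact: CF.
Qed.

Lemma CkX k A F n : open A -> Ck k A F -> Ck k A (fun x => F x ^+ n).
Proof.
move=> oA CF; elim: n => [|n IH].
  have -> : (fun x => F x ^+ 0) = (fun=> 1) by apply/funext => x; rewrite expr0.
  exact: Ck_cst.
have -> : (fun x => F x ^+ n.+1) = (fun x => F x * F x ^+ n).
  by apply/funext => x; rewrite exprS.
exact: CkM.
Qed.

(** The basis directions are added one at a time by [is_deriveDv], each new one having a continuous
    derivative. *)
Lemma is_derive_C1 A F x v : open A -> Ck 1 A F -> A x ->
  is_derive x v F (\sum_j v 0 j * 'D_(e j) F x).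
Proof.
move=> oA CF Ax; rewrite [v in is_derive x v]row_sum_delta.
elim: (index_enum _) => [|j s IH].
  by rewrite !big_nil; split; [exact: derivable0|exact: derive0].
rewrite !big_cons [X in is_derive x X]addrC [X in is_derive x _ _ X]addrC.
have dZ y : A y -> is_derive y (v 0 j *: e j) F (v 0 j * 'D_(e j) F y).
  by move=> Ay; apply: is_deriveZv; exact: (Ck_derivable j CF Ay).
have [_ <-] := dZ x Ax; apply: (is_deriveDv IH).
  by apply: (near_open oA Ax) => y /dZ[].
have c : {for x, continuous (fun y => v 0 j * 'D_(e j) F y)}.
  exact: (Ck_cont (CkZ _ oA (Ck_partial j CF)) Ax).
apply: (near_eq_continuous _ c); apply: (near_open oA Ax) => y /dZ[_ <-] //.
Qed.

Lemma Ck_derivablev k A F x v : open A -> Ck k.+1 A F -> A x -> derivable F x v.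
Proof. by move=> oA CF Ax; have [] := is_derive_C1 v oA (Ck_le (ltn0Sn k) CF) Ax. Qed.

Arguments Ck_derivablev {k A F x} v _ _ _.

Lemma deriveEpartial k A F x v : open A -> Ck k.+1 A F -> A x ->
  'D_v F x = \sum_j v 0 j * 'D_(e j) F x.
Proof. by move=> oA CF Ax; have [] := is_derive_C1 v oA (Ck_le (ltn0Sn k) CF) Ax. Qed.

Lemma Ck_derive k A F v : open A -> Ck k.+1 A F -> Ck k A ('D_v F).
Proof.
move=> oA CF; apply: (@Ck_eq k A (fun x => \sum_j v 0 j * 'D_(e j) F x)) => //.
  by move=> x Ax; rewrite (deriveEpartial v oA CF Ax).
by apply: Ck_sum => // j _; apply: CkZ => //; exact: Ck_partial.
Qed.

Lemma deriveDv k A F x v w : open A -> Ck k.+1 A F -> A x ->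
  'D_(v + w) F x = 'D_v F x + 'D_w F x.
Proof.
move=> oA CF Ax; rewrite !(deriveEpartial _ oA CF Ax) -big_split /=.
by apply: eq_bigr => j _; rewrite mxE mulrDl.
Qed.

Lemma deriveZv k A F x v (c : R) : open A -> Ck k.+1 A F -> A x ->
  'D_(c *: v) F x = c * 'D_v F x.
Proof.
move=> oA CF Ax; rewrite !(deriveEpartial _ oA CF Ax) mulr_sumr.
by apply: eq_bigr => j _; rewrite mxE mulrA.
Qed.

Lemma deriveC k A F x v w : open A -> Ck k.+2 A F -> A x ->
  'D_w ('D_v F) x = 'D_v ('D_w F) x.
Proof.
move=> oA CF Ax; apply: schwarz.
- apply: (near_open oA Ax) => y Ay.
  have D u : derivable F y u := Ck_derivablev u oA CF Ay.
  have DD u u' : derivable ('D_u F) y u' := Ck_derivablev u' oA (Ck_derive u oA CF) Ay.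
  by [].
- exact: (Ck_cont (Ck_derive _ oA (Ck_derive _ oA CF)) Ax).
- exact: (Ck_cont (Ck_derive _ oA (Ck_derive _ oA CF)) Ax).
Qed.

Definition lap F x : R := \sum_j 'D_(e j) ('D_(e j) F) x.

Lemma derive_eq A F G x v : open A -> A x -> (forall y, A y -> F y = G y) ->
  'D_v F x = 'D_v G x.
Proof. by move=> oA Ax FG; apply: near_eq_derive; exact: (near_open oA Ax). Qed.

Lemma deriveMf k A F G x v : open A -> Ck k.+1 A F -> Ck k.+1 A G -> A x ->
  'D_v (fun y => F y * G y) x = F x * 'D_v G x + G x * 'D_v F x.
Proof.
move=> oA CF CG Ax.
have H : 'D_v (F * G) x = F x *: 'D_v G x + G x *: 'D_v F x.
  by apply: deriveM; [exact: (Ck_derivablev v oA CF Ax)|exact: (Ck_derivablev v oA CG Ax)].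
exact: H.
Qed.

Lemma deriveDf k A F G x v : open A -> Ck k.+1 A F -> Ck k.+1 A G -> A x ->
  'D_v (fun y => F y + G y) x = 'D_v F x + 'D_v G x.
Proof.
move=> oA CF CG Ax.
have H : 'D_v (F + G) x = 'D_v F x + 'D_v G x.
  by apply: deriveD; [exact: (Ck_derivablev v oA CF Ax)|exact: (Ck_derivablev v oA CG Ax)].
exact: H.
Qed.

Lemma deriveZf k A F x v (c : R) : open A -> Ck k.+1 A F -> A x ->
  'D_v (fun y => c * F y) x = c * 'D_v F x.
Proof.
move=> oA CF Ax; have H : 'D_v (c \*: F) x = c *: 'D_v F x.
  by apply: deriveZ; exact: (Ck_derivablev v oA CF Ax).
exact: H.
Qed.

Lemma lapD A F G x : open A -> Ck 2 A F -> Ck 2 A G -> A x ->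
  lap (fun y => F y + G y) x = lap F x + lap G x.
Proof.
move=> oA CF CG Ax; rewrite /lap -big_split; apply: eq_bigr => j _ /=.
rewrite -(deriveDf _ oA (Ck_partial j CF) (Ck_partial j CG) Ax).
by apply: (derive_eq _ oA Ax) => y Ay; rewrite (deriveDf _ oA CF CG Ay).
Qed.

Lemma lapM A F G x : open A -> Ck 2 A F -> Ck 2 A G -> A x ->
  lap (fun y => F y * G y) x = F x * lap G x + G x * lap F x +
    2 * \sum_j 'D_(e j) F x * 'D_(e j) G x.
Proof.
move=> oA CF CG Ax; rewrite /lap !mulr_sumr -!big_split; apply: eq_bigr => j _ /=.
have CFj := Ck_partial j CF; have CGj := Ck_partial j CG.
rewrite (@derive_eq A _ (fun y => F y * 'D_(e j) G y + G y * 'D_(e j) F y) x) //; last first.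
  by move=> y Ay; rewrite (deriveMf _ oA CF CG Ay).
rewrite (deriveDf _ oA (CkM oA (CkW CF) CGj) (CkM oA (CkW CG) CFj) Ax).
rewrite (deriveMf _ oA (CkW CF) CGj Ax) (deriveMf _ oA (CkW CG) CFj Ax).
move: ('D_(e j) ('D_(e j) G) x) ('D_(e j) ('D_(e j) F) x) ('D_(e j) G x) ('D_(e j) F x) => a b c f.
ring.
Qed.

Lemma lapZ A F x (c : R) : open A -> Ck 2 A F -> A x ->
  lap (fun y => c * F y) x = c * lap F x.
Proof.
move=> oA CF Ax; rewrite /lap mulr_sumr; apply: eq_bigr => j _ /=.
rewrite -(deriveZf _ c oA (Ck_partial j CF) Ax); apply: (derive_eq _ oA Ax) => y Ay.
by rewrite (deriveZf _ c oA CF Ay).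
Qed.

Lemma lap_cst x (c : R) : lap (fun=> c) x = 0.
Proof.
rewrite /lap big1// => j _.
have -> : 'D_(e j) (fun=> c) = (fun=> 0) by apply/funext => y; rewrite (derive_cst c).
by rewrite (derive_cst 0).
Qed.

Lemma lap_derive A F x v : open A -> Ck 3 A F -> A x -> lap ('D_v F) x = 'D_v (lap F) x.
Proof.
move=> oA CF Ax.
have E : 'D_v (lap F) x = \sum_j 'D_v ('D_(e j) ('D_(e j) F)) x.
  rewrite /lap; elim: (index_enum _) => [|i s IH].
    have -> : (fun y => \sum_(j <- [::]) 'D_(e j) ('D_(e j) F) y) = (fun=> 0).
      by apply/funext => y; rewrite big_nil.
    by rewrite (derive_cst 0) big_nil.
  have -> : (fun y => \sum_(j <- i :: s) 'D_(e j) ('D_(e j) F) y) =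
     (fun y => 'D_(e i) ('D_(e i) F) y + \sum_(j <- s) 'D_(e j) ('D_(e j) F) y).
    by apply/funext => y; rewrite big_cons.
  rewrite (@deriveDf 0 A) //; first by rewrite big_cons IH.
    by do 2 apply: Ck_partial.
  by apply: Ck_sum => // j _; do 2 apply: Ck_partial.
rewrite E; apply: eq_bigr => j _.
apply: (etrans _ (deriveC v (e j) oA (Ck_partial j CF) Ax)).
by apply: (derive_eq _ oA Ax) => y Ay; exact: (deriveC v (e j) oA CF Ay).
Qed.

Lemma lap_max A F x : open A -> Ck 2 A F -> A x -> (forall y, A y -> F y <= F x) ->
  (forall v, 'D_v F x = 0) /\ lap F x <= 0.
Proof.
move=> oA CF Ax mF; have nF : \forall y \near x, F y <= F x by exact: (near_open oA Ax).
split=> [v|]; first apply: (derive_max0 _ nF).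
  by apply: (near_open oA Ax) => y Ay; exact: (Ck_derivablev v oA CF Ay).
apply: sumr_le0 => j _; apply: (derive2_max _ _ nF).
  by apply: (near_open oA Ax) => y Ay; exact: (Ck_derivable j CF Ay).
exact: (Ck_derivable j (Ck_partial j CF) Ax).
Qed.

End CkTheory.

Arguments Ck_derivable {R d k A F x} j _ _.
Arguments Ck_partial {R d k A F} j _.
Arguments Ck_derivablev {R d k A F x} v _ _ _.

(** * Euclidean structure, radial projection and the function 1/|x| *)

Section Euclid.
Variables (R : realType) (d : nat).
Local Notation V := 'rV[R]_d.
Local Notation e j := (e_ R j).
Implicit Types (F G : V -> R) (A B : set V) (x y v w b : V).

Lemma dotpC x y : dotp x y = dotp y x.
Proof. by apply: eq_bigr => i _; rewrite mulrC. Qed.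

Lemma dotpDl x y z : dotp (x + y) z = dotp x z + dotp y z.
Proof. by rewrite /dotp -big_split; apply: eq_bigr => i _; rewrite mxE mulrDl. Qed.

Lemma dotpZl (c : R) x y : dotp (c *: x) y = c * dotp x y.
Proof. by rewrite /dotp mulr_sumr; apply: eq_bigr => i _; rewrite mxE mulrA. Qed.

Lemma dotpDr x y z : dotp z (x + y) = dotp z x + dotp z y.
Proof. by rewrite ![dotp z _]dotpC dotpDl. Qed.

Lemma dotpZr (c : R) x y : dotp y (c *: x) = c * dotp y x.
Proof. by rewrite ![dotp y _]dotpC dotpZl. Qed.

Lemma dotpNl x y : dotp (- x) y = - dotp x y.
Proof. by rewrite -scaleN1r dotpZl mulN1r. Qed.

Lemma dotpNr x y : dotp y (- x) = - dotp y x.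
Proof. by rewrite -scaleN1r dotpZr mulN1r. Qed.

Lemma dotpBl x y z : dotp (x - y) z = dotp x z - dotp y z.
Proof. by rewrite dotpDl dotpNl. Qed.

Lemma dotpBr x y z : dotp z (x - y) = dotp z x - dotp z y.
Proof. by rewrite dotpDr dotpNr. Qed.

Lemma dotp0l x : dotp 0 x = 0.
Proof. by rewrite -(scale0r 0) dotpZl mul0r. Qed.

Lemma dotp_suml (I : Type) (s : seq I) (P : pred I) (u : I -> V) w :
  dotp (\sum_(i <- s | P i) u i) w = \sum_(i <- s | P i) dotp (u i) w.
Proof.
by elim/big_rec2: _ => [|i a b _ <-]; rewrite ?dotp0l// dotpDl.
Qed.

Lemma dotp0r x : dotp x 0 = 0.
Proof. by rewrite dotpC dotp0l. Qed.

Lemma dotp_ge0 x : 0 <= dotp x x.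
Proof. by apply: sumr_ge0 => i _; rewrite -expr2 sqr_ge0. Qed.

Lemma dotp_eq0 x : (dotp x x == 0) = (x == 0).
Proof.
apply/idP/eqP => [|->]; last by rewrite dotp0l.
rewrite psumr_eq0 => [/allP x0|i _]; last by rewrite -expr2 sqr_ge0.
apply/rowP => i; rewrite mxE; apply/eqP.
by have := x0 i; rewrite mem_index_enum -expr2 sqrf_eq0; exact.
Qed.

Lemma dotp_gt0 x : x != 0 -> 0 < dotp x x.
Proof. by rewrite lt_def dotp_ge0 dotp_eq0 andbT. Qed.

Lemma dotp_e x j : dotp x (e j) = x 0 j.
Proof.
rewrite /dotp (bigD1 j)//= big1 ?addr0 => [|i ij]; rewrite mxE eqxx/=.
  by rewrite eqxx mulr1.
by rewrite (negbTE ij) mulr0.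
Qed.

Lemma dotp_mulmx x y (g : 'M[R]_d) : dotp (x *m g) y = dotp x (y *m g^T).
Proof.
have E u v : dotp u v = (u *m v^T) 0 0.
  by rewrite mxE; apply: eq_bigr => i _; rewrite mxE.
by rewrite !E trmx_mul trmxK mulmxA.
Qed.

Lemma CauchySchwarz x y : dotp x y ^+ 2 <= dotp x x * dotp y y.
Proof.
have [->|y0] := eqVneq y 0; first by rewrite !dotp0r expr0n mulr0.
have yy := dotp_gt0 y0; have := dotp_ge0 (dotp y y *: x - dotp x y *: y).
rewrite dotpBl !dotpBr !dotpZl !dotpZr [dotp y x]dotpC => H.
rewrite -subr_ge0 -(pmulr_rge0 _ yy); move: H.
by congr (0 <= _); ring.
Qed.

Lemma coord_cont (j : 'I_d) : continuous (fun x : V => x 0 j).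
Proof. by move=> x; exact: coord_continuous. Qed.

Lemma dotp_cont b : continuous (dotp b).
Proof.
move=> x; suff : Ck 0 setT (dotp b) by move=> /Ck_cont; apply.
apply: Ck_sum openT _ => j _; apply: CkZ openT _.
by split=> // y _; exact: coord_cont.
Qed.

Lemma sqnorm_cont : continuous (fun x : V => dotp x x).
Proof.
move=> x; suff : Ck 0 setT (fun x : V => dotp x x) by move=> /Ck_cont; apply.
by apply: Ck_sum openT _ => j _; apply: CkM openT _ _; split=> // y _; exact: coord_cont.
Qed.

Lemma is_derive_dotp b x v : is_derive x v (dotp b) (dotp b v).
Proof.
have E : x = x + 0 *: v by rewrite scale0r addr0.
rewrite E; apply/is_derive_lineP.
have -> : (fun s : R => dotp b (x + s *: v)) = (fun s => dotp b x + s * dotp b v).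
  by apply/funext => s; rewrite dotpDr dotpZr.
apply: is_derive_eq; rewrite scaler0 add0r add0r mul1r; exact: mulr1.
Qed.

Lemma is_derive_sqnorm x v : is_derive x v (fun y => dotp y y) (2 * dotp x v).
Proof.
have E : x = x + 0 *: v by rewrite scale0r addr0.
rewrite {1}E; apply/is_derive_lineP.
have -> : (fun s : R => dotp (x + s *: v) (x + s *: v)) =
    (fun s => dotp x x + s * (2 * dotp x v) + s * s * dotp v v).
  apply/funext => s; rewrite !dotpDr !dotpDl !dotpZr !dotpZl [dotp v x]dotpC; ring.
apply: is_derive_eq; rewrite !scaler0 !scale0r !add0r ?addr0.
rewrite mul1r scaler0 addr0; exact: mulr1.
Qed.

Lemma derive_dotp b x v : 'D_v (dotp b) x = dotp b v.
Proof. by have [] := is_derive_dotp b x v. Qed.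

Lemma Ck_dotp k A b : Ck k A (dotp b).
Proof.
case: k => [|k]; first by split=> // x _; exact: dotp_cont.
split=> [x _|j]; first exact: dotp_cont.
split=> [x _|]; first by have [] := is_derive_dotp b x (e j).
have -> : 'D_(e j) (dotp b) = (fun=> dotp b (e j)); last exact: Ck_cst.
by apply/funext => x; rewrite derive_dotp.
Qed.

Lemma lap_dotp b x : lap (dotp b) x = 0.
Proof.
rewrite /lap big1// => j _.
have -> : 'D_(e j) (dotp b) = (fun=> dotp b (e j)).
  by apply/funext => y; rewrite derive_dotp.
by rewrite (derive_cst (dotp b (e j))).
Qed.

Lemma enorm_sqr x : enorm x ^+ 2 = dotp x x.
Proof. by rewrite sqr_sqrtr// dotp_ge0. Qed.

Lemma enorm_gt0 x : x != 0 -> 0 < enorm x.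
Proof. by move=> x0; rewrite sqrtr_gt0 dotp_gt0. Qed.

Lemma enorm_eq0 x : (enorm x == 0) = (x == 0).
Proof. by rewrite -sqrf_eq0 enorm_sqr dotp_eq0. Qed.

Lemma enormZ (c : R) x : enorm (c *: x) = `|c| * enorm x.
Proof.
by rewrite /enorm dotpZl dotpZr mulrA -expr2 sqrtrM ?sqr_ge0// sqrtr_sqr.
Qed.

Lemma sphere_enorm x : @sphere R d x -> enorm x = 1.
Proof. by rewrite /sphere/= /enorm => ->; rewrite sqrtr1. Qed.

Lemma sphere_neq0 x : @sphere R d x -> x != 0.
Proof. by apply: contraPneq => -> /=; rewrite /sphere /= dotp0l; apply/eqP; rewrite eq_sym oner_eq0. Qed.

Lemma sphere_le x : @sphere R d x -> forall y, @sphere R d y -> `|dotp x y| <= 1.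
Proof.
move=> xS y yS; have := CauchySchwarz x y; rewrite xS yS mulr1 => H.
by rewrite -(@expr_le1 _ 2)// real_normK// num_real.
Qed.

Definition punctured : set V := [set x | x != 0].

Lemma open_punctured : open punctured.
Proof.
have -> : punctured = (fun x : V => dotp x x) @^-1` [set t | t != 0].
  by apply/seteqP; split=> x /=; rewrite dotp_eq0.
by apply: open_comp => [x _|]; [exact: sqnorm_cont|exact: open_neq].
Qed.

Lemma radial_id x : @sphere R d x -> radial x = x.
Proof. by move=> xS; rewrite /radial sphere_enorm// invr1 scale1r. Qed.

Lemma radialZ (c : R) x : 0 < c -> radial (c *: x) = radial x.
Proof.
move=> c0; rewrite /radial enormZ gtr0_norm// scalerA invfM.
by rewrite mulrAC mulVf ?gt_eqF// mul1r.
Qed.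

Lemma radial_sphere x : x != 0 -> @sphere R d (radial x).
Proof.
move=> x0; rewrite /sphere /= /radial dotpZl dotpZr -enorm_sqr expr2.
by rewrite mulKf ?mulVf ?enorm_eq0.
Qed.

Lemma radial0 : radial (0 : V) = 0.
Proof. by rewrite /radial scaler0. Qed.

Lemma cone_sphere : cone (@sphere R d) = punctured.
Proof.
apply/seteqP; split=> x /=; last exact: radial_sphere.
by rewrite /cone /= /punctured /=; have [->|] := eqVneq x 0 => //; rewrite radial0 => /sphere_neq0; rewrite eqxx.
Qed.

Lemma cone_sub U : U `<=` @sphere R d -> cone U `<=` punctured.
Proof. by move=> US; rewrite -cone_sphere => x /US. Qed.

Lemma cone_sphere_mem U x : U `<=` @sphere R d -> U x -> cone U x.
Proof. by move=> US Ux; rewrite /cone /= radial_id//; exact: US. Qed.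

Definition rho x : R := (enorm x)^-1.

Lemma is_derive_enorm x v : x != 0 -> is_derive x v (@enorm R d) (dotp v x * rho x).
Proof.
move=> x0; have E : x = x + 0 *: v by rewrite scale0r addr0.
have S : is_derive x v (fun y => dotp y y) (2 * dotp x v) by exact: is_derive_sqnorm.
have e0 : enorm x != 0 by rewrite enorm_eq0.
have -> : dotp v x * rho x = (2 * Num.sqrt (dotp x x))^-1 * (2 * dotp x v).
  rewrite dotpC /rho -/(enorm x).
  change (dotp x v * (enorm x)^-1 = (2 * enorm x)^-1 * (2 * dotp x v)).
  by field.
rewrite [x in is_derive x]E; apply/is_derive_lineP.
have -> : (fun s : R => enorm (x + s *: v)) = Num.sqrt \o (fun s => dotp (x + s *: v) (x + s *: v)) by [].
apply: is_derive1_comp.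
  by rewrite -E; exact: is_derive1_sqrt (dotp_gt0 x0).
by apply: (is_derive_lineP (fun y => dotp y y) x v 0 _).2; rewrite -E.
Qed.

Lemma is_derive_rho x v : x != 0 -> is_derive x v rho (- dotp v x * rho x ^+ 3).
Proof.
move=> x0; have e0 : enorm x != 0 by rewrite enorm_eq0.
have [d1 d2] := is_derive_enorm v x0.
split; first exact: derivableV.
rewrite (deriveV e0 d1) d2 /rho.
change (- enorm x ^- 2 * (dotp v x * (enorm x)^-1) = - dotp v x * (enorm x)^-1 ^+ 3).
by field.
Qed.

Lemma rho_cont x : x != 0 -> {for x, continuous rho}.
Proof.
move=> x0; have e0 : enorm x != 0 by rewrite enorm_eq0.
have c : {for dotp x x, continuous (@Num.sqrt R)} := @sqrt_continuous R (dotp x x).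
exact: (cvgV e0 (continuous_comp (@sqnorm_cont x) c)).
Qed.

Lemma Ck_rho k : Ck k punctured rho.
Proof.
elim: k => [|k IH]; first by split=> // x; exact: rho_cont.
split=> [x|j]; first exact: rho_cont.
split=> [x x0|]; first by have [] := is_derive_rho (e j) x0.
apply: (@Ck_eq _ _ k punctured (fun x => (- 1) * dotp (e j) x * rho x ^+ 3)).
- exact: open_punctured.
- by move=> x x0; have [_ ->] := is_derive_rho (e j) x0; rewrite mulN1r.
by apply: CkM open_punctured (CkZ _ open_punctured (Ck_dotp _ _ _)) (CkX _ open_punctured IH).
Qed.

End Euclid.

(** * The Laplace-Beltrami operator in homogeneous coordinates *)

Section LaplaceBeltrami.
Variables (R : realType) (d : nat).
Local Notation V := 'rV[R]_d.
Local Notation e j := (e_ R j).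
Implicit Types (F G f : V -> R) (A U : set V) (x y v w : V).

Lemma is_derive_scale F x v (c : R) : derivable F (c *: x) v ->
  is_derive x v (fun y => F (c *: y)) (c * 'D_v F (c *: x)).
Proof.
move=> dF; have E : x = x + 0 *: v by rewrite scale0r addr0.
rewrite {1}E; apply/is_derive_lineP.
have -> : (fun s : R => F (c *: (x + s *: v))) = (fun s => F (c *: x + s *: (c *: v))).
  by apply/funext => s; rewrite scalerDr !scalerA [c * s]mulrC.
apply/is_derive_lineP; rewrite scale0r addr0; exact: is_deriveZv.
Qed.

Lemma derive_radial F x (p : R -> R) (a : R) :
  (\forall s \near 0, F ((1 + s) *: x) = p s) ->
  is_derive (0 : R) (1 : R) p a -> 'D_x F x = a.
Proof.
move=> Fp dp; have E : x = x + 0 *: x by rewrite scale0r addr0.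
suff : is_derive (x + 0 *: x) x F a by rewrite -E => -[].
apply/is_derive_lineP; apply: (near_eq_is_derive _ dp).
by apply: filterS Fp => s <-; rewrite scalerDl scale1r.
Qed.

Definition homog0 A F := forall (c : R) x, 0 < c -> A x -> F (c *: x) = F x.

Definition conic A := forall (c : R) x, 0 < c -> A x -> A (c *: x).

Lemma near_gtN1 : \forall s \near (0 : R), 0 < 1 + s.
Proof.
apply/nbhs_normP; exists 1 => //= s; rewrite /= sub0r normrN ltr_norml => /andP[s1 _].
by rewrite -ltrBlDl sub0r.
Qed.

Lemma euler0 A F x : homog0 A F -> A x -> 'D_x F x = 0.
Proof.
move=> hF Ax; apply: (@derive_radial F x (fun=> F x)).
  by apply: filterS near_gtN1 => s s0; exact: hF.
Qed.

Lemma derive_homog A F x v (c : R) : conic A -> open A -> Ck 1 A F -> homog0 A F ->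
  0 < c -> A x -> 'D_v F (c *: x) = c^-1 * 'D_v F x.
Proof.
move=> cA oA CF hF c0 Ax.
have [_ E] := is_derive_scale (Ck_derivablev v oA CF (cA _ _ c0 Ax)).
apply: (mulfI (lt0r_neq0 c0)); rewrite -E mulVKf ?lt0r_neq0//.
by apply: (derive_eq _ oA Ax) => y Ay; exact: hF.
Qed.

(** Euler's identity in degree -1, which is the degree of ['D_v F] by [derive_homog]. *)
Lemma euler1 A F x v : conic A -> open A -> Ck 1 A F -> homog0 A F -> A x ->
  'D_x ('D_v F) x = - 'D_v F x.
Proof.
move=> cA oA CF hF Ax.
apply: (@derive_radial _ _ (fun s => (1 + s)^-1 * 'D_v F x)).
  by apply: filterS near_gtN1 => s s0; exact: (derive_homog _ cA).
have n0 : 1 + (0 : R) != 0 by rewrite addr0 oner_neq0.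
apply: is_derive_eq.
rewrite addr0 expr1n invr1 add0r scaler0 add0r.
change ('D_v F x * (- 1 * 1) = - 'D_v F x).
by rewrite mulr1 mulrN1.
Qed.

Lemma lap_homog A F x (c : R) : conic A -> open A -> Ck 2 A F -> homog0 A F ->
  0 < c -> A x -> lap F (c *: x) = (c ^+ 2)^-1 * lap F x.
Proof.
move=> cA oA CF hF c0 Ax.
have aux (X Y Z : R) : X = c * Y -> X = c^-1 * Z -> Y = (c ^+ 2)^-1 * Z.
  move=> -> /(congr1 (fun t => c^-1 * t)); rewrite mulKf ?lt0r_neq0// => ->.
  by rewrite mulrA expr2 invfM.
rewrite /lap mulr_sumr; apply: eq_bigr => j _.
have CFj := Ck_partial j CF.
have [_ E] := is_derive_scale (Ck_derivable j CFj (cA _ _ c0 Ax)).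
apply: (aux _ _ _ E).
apply: (etrans _ (deriveZf (e j) _ oA CFj Ax)).
by apply: (derive_eq _ oA Ax) => y Ay; rewrite (derive_homog _ cA oA (CkW CF)).
Qed.

Lemma cone_conic U : conic (cone U).
Proof. by move=> c x c0; rewrite /cone /= radialZ. Qed.

Lemma ext_homog0 A f : homog0 A (ext f).
Proof. by move=> c x c0 _; rewrite /ext /= radialZ. Qed.

Lemma is_derive_mx (X : V -> V) x v (Y : V) :
  (forall j, is_derive x v (fun y => X y 0 j) (Y 0 j)) -> is_derive x v X Y.
Proof.
move=> dX; have D : derivable X x v.
  by apply/derivable_mxP => i j; rewrite (ord1 i); have [] := dX j.
split=> //; rewrite (derive_mx D); apply/rowP => j; rewrite mxE.
by have [_ ->] := dX j.
Qed.

(** Euler's identities remove every curvature term: the radial derivative of [F] is 0, and that of a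
    partial derivative is its opposite. The first makes the tangential projection in the gradient
    harmless; together they reduce the trace of the projected Hessian to the full trace. *)
Lemma laplace_beltramiE U f x : U `<=` @sphere R d -> open (cone U) ->
  sphere_Ck 2 U f -> U x -> laplace_beltrami f x = lap (ext f) x.
Proof.
move=> US oU CF Ux; set F := ext f; set A := cone U.
have hF : homog0 A F := @ext_homog0 A f.
have cA : conic A := @cone_conic U.
have Ax : A x by exact: cone_sphere_mem.
have xS : dotp x x = 1 by exact: US.
have x0 : x != 0 by apply/sphere_neq0/US.
have CF2 : Ck 2 A F by exact: CF.
have CF1 := CkW CF2.
have T v : tproj x v = v + (- dotp v x) *: x by rewrite /tproj scaleNr.
(* The partial derivatives have degree -1 while [ext] has degree 0, whence the factor [enorm y]. *)
have gradE y : A y -> ext (sgrad f) y = \row_j (enorm y * 'D_(e j) F y).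
  move=> Ay; have y0 : y != 0 := cone_sub US Ay.
  have c0 : 0 < (enorm y)^-1 by rewrite invr_gt0 enorm_gt0.
  apply/rowP => j; rewrite /ext /= /sgrad !mxE /sdiff -/F.
  have Ar : A (radial y) by exact: cA.
  have -> : tproj (radial y) (e j) = e j + (- dotp (e j) (radial y)) *: radial y.
    by rewrite /tproj scaleNr.
  rewrite (deriveDv _ _ oU CF1 Ar) (deriveZv _ _ oU CF1 Ar) (euler0 hF Ar) mulr0 addr0.
  by rewrite (derive_homog _ cA oU CF1 hF c0 Ay) invrK.
(* The factor [enorm] has zero derivative in tangent directions and equals 1 at [x], so only the
   Hessian is left. *)
have nablaE v : dotp v x = 0 -> nabla (sgrad f) x v = tproj x (\row_i 'D_v ('D_(e i) F) x).
  move=> vx; rewrite /nabla; congr tproj.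
  suff [_ ->] : is_derive x v (ext (sgrad f)) (\row_i 'D_v ('D_(e i) F) x) by [].
  apply: is_derive_mx => i; rewrite mxE.
  have [d1 e1] := is_derive_enorm v x0.
  have D2 := Ck_derivablev v oU (Ck_partial i CF2) Ax.
  have := is_deriveM (DeriveDef d1 e1) (DeriveDef D2 erefl).
  rewrite vx mul0r scaler0 addr0 (sphere_enorm (US _ Ux)) scale1r.
  apply: near_eq_is_derive; apply: (near_open oU Ax) => y Ay.
  by rewrite gradE// mxE.
rewrite /laplace_beltrami /sdiv.
pose h i j := 'D_(e j) ('D_(e i) F) x.
pose g i := 'D_(e i) F x.
have xg : \sum_i x 0 i * g i = 0.
  by rewrite -(deriveEpartial x oU CF1 Ax) (euler0 hF Ax).
have xh i : \sum_j x 0 j * h i j = - g i.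
  by rewrite -(deriveEpartial x oU (Ck_partial i CF2) Ax) (euler1 _ cA oU CF1 hF Ax).
have W i j : 'D_(tproj x (e j)) ('D_(e i) F) x = h i j + x 0 j * g i.
  rewrite T (deriveDv _ _ oU (Ck_partial i CF2) Ax) (deriveZv _ _ oU (Ck_partial i CF2) Ax).
  by rewrite (euler1 _ cA oU CF1 hF Ax) mulrNN [dotp (e j) x]dotpC dotp_e.
transitivity (\sum_j (h j j + x 0 j * g j - (\sum_i (h i j * x 0 i + x 0 j * g i * x 0 i)) * x 0 j)).
  apply: eq_bigr => j _; rewrite nablaE; last first.
    by rewrite T dotpDl dotpZl xS mulr1 subrr.
  rewrite /tproj !mxE W /dotp; congr (_ - _ * _); apply: eq_bigr => i _.
  by rewrite mxE W mulrDl.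
rewrite sumrB big_split /= xg addr0.
rewrite (_ : \sum_j (\sum_i _) * _ = 0) ?subr0//.
transitivity (\sum_j \sum_i (x 0 i * (x 0 j * h i j) + x 0 j ^+ 2 * (x 0 i * g i))).
  apply: eq_bigr => j _; rewrite mulr_suml; apply: eq_bigr => i _; ring.
rewrite exchange_big /= (eq_bigr (fun i => x 0 i * (- g i) + x 0 i * g i * \sum_j x 0 j ^+ 2)); last first.
  move=> i _; rewrite big_split /= -mulr_sumr xh; congr (_ + _).
  by rewrite mulr_sumr; apply: eq_bigr => j _; rewrite mulrC.
have -> : \sum_j x 0 j ^+ 2 = 1 by rewrite -xS; apply: eq_bigr => j _; rewrite expr2.
by rewrite big1// => i _; rewrite mulr1 mulrN addNr.
Qed.

End LaplaceBeltrami.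

(** * Eigenfunctions and unique continuation *)

(* Uniqueness for an infinite system of differential inequalities: iterating the
   mean value theorem m times on an interval of length 1/(2C) gains a factor 2^-m. *)
Lemma vanish_of_growth (R : realType) (f : nat -> R -> R) (C M : R) : 0 < C ->
  (forall n t, derivable (f n) t 1) ->
  (forall n t, `|'D_1 (f n) t| <= `|f n.+1 t|) ->
  (forall n t, `|f n t| <= C ^+ n * M) ->
  (forall n, f n 0 = 0) -> forall n t, f n t = 0.
Proof.
move=> C0 df df1 fM f0.
have M0 : 0 <= M by have := fM 0 0; rewrite mul1r; apply: le_trans.
pose h := (2 * C)^-1; have h0 : 0 < h by rewrite invr_gt0 mulr_gt0.
have step t0 : (forall n, f n t0 = 0) -> forall n t, `|t - t0| <= h -> f n t = 0.
  move=> ft0; have B m : forall n t, `|t - t0| <= h -> `|f n t| <= 2^-1 ^+ m * (C ^+ n * M).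
    elim: m => [|m IH] n t th; first by rewrite mul1r.
    have dg (s : R) : is_derive s 1 (fun s => f n (t0 + s * (t - t0)))
        ('D_1 (f n) (t0 + s * (t - t0)) * (t - t0)).
      apply: (@is_derive1_comp R (f n) (fun s => t0 + s * (t - t0))).
        exact: derivableP.
      apply: is_derive_eq; rewrite scaler0 add0r add0r mul1r; exact: mulr1.
    have [|c] := @MVT_segment R (fun s => f n (t0 + s * (t - t0))) _ 0 1 ler01 (fun s _ => dg s).
      apply: derivable_within_continuous => s _; by have [] := dg s.
    rewrite in_itv /= => /andP[c0 c1]; rewrite mul1r mul0r addr0 subrKC ft0 !subr0 mulr1 => ->.
    have cth : `|t0 + c * (t - t0) - t0| <= h.
      rewrite addrAC subrr add0r normrM ger0_norm//; apply: le_trans th.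
      by rewrite -[leRHS]mul1r ler_wpM2r.
    rewrite normrM; apply: (@le_trans _ _ (2^-1 ^+ m * (C ^+ n.+1 * M) * h)).
      by apply: ler_pM => //; apply: le_trans (df1 _ _) (IH _ _ cth).
    have -> : 2^-1 ^+ m.+1 * (C ^+ n * M) = 2^-1 ^+ m * (C ^+ n.+1 * M) * h.
      by rewrite /h !exprS; field; exact: lt0r_neq0.
    exact: lexx.
  move=> n t th; apply/eqP; rewrite -normr_le0 leNgt; apply/negP => pos.
  have K0 : 0 <= C ^+ n * M by rewrite mulr_ge0// exprn_ge0// ltW.
  have [m mP] : exists m : nat, C ^+ n * M < `|f n t| * m%:R.
    exists (Num.truncn (C ^+ n * M / `|f n t|)).+1.
    by rewrite [ltRHS]mulrC -ltr_pdivrMr// truncnS_gt.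
  have := B m n t th; rewrite exprVn leNgt => /negP; apply.
  rewrite mulrC ltr_pdivrMr ?exprn_gt0//; apply: (lt_le_trans mP).
  apply: ler_wpM2l; first exact: ltW.
  by have := ltnW (ltn_expl m (isT : (1 < 2)%N)); rewrite -(ler_nat R) natrX.
(* Steps of length at most [h] are chained from 0 until they reach [t]. *)
suff H N : forall n t, `|t| <= N%:R * h -> f n t = 0.
  move=> n t; apply: (H (Num.truncn (`|t| / h)).+1).
  by rewrite -ler_pdivrMr// ltW// truncnS_gt.
elim: N => [|N IH] n t; first by rewrite mul0r normr_le0 => /eqP ->.
move=> tN; have N0 : 0 < N.+1%:R :> R by rewrite ltr0n.
have NN : N.+1%:R != 0 :> R by rewrite gt_eqF.
pose u := t / N.+1%:R.
have uh : `|u| <= h.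
  by rewrite /u normrM normfV (ger0_norm (ltW N0)) ler_pdivrMr// mulrC.
apply: (step (N%:R * u)) => [m|].
  by apply: IH; rewrite normrM (ger0_norm (ler0n _ _)) ler_wpM2l// ler0n.
suff -> : t - N%:R * u = u by [].
have {1}-> : t = N.+1%:R * u by rewrite /u mulrC divfK.
by rewrite -addn1 natrD; ring.
Qed.

(** Here [f] and [L] stand for the values of a function and of its rotational derivative at a
    maximum point, [gF] and [gL] for their squared gradients, and [n] for |mu|. The gradient term
    [8 (n + 1) gF >= 2 (n + 1) L ^+ 2] absorbs [2 mu L ^+ 2] and leaves at least [2 L ^+ 2]. *)
Lemma gradient_bound_arith (R : realType) (mu n L f gF gL : R) : 0 <= n -> mu <= n ->
  0 <= gL -> L ^+ 2 <= 4 * gF ->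
  L * (- mu * L) + L * (- mu * L) + 2 * gL +
    4 * (n + 1) * (f * (- mu * f) + f * (- mu * f) + 2 * gF) <= 0 ->
  L ^+ 2 <= 4 * (n + 1) * n * f ^+ 2.
Proof.
move=> n0 mn gL0 LF.
have : (n + 1) * (L ^+ 2) <= (n + 1) * (4 * gF) by rewrite ler_wpM2l// addr_ge0.
have : 0 <= (n - mu) * (L ^+ 2) by rewrite mulr_ge0 ?subr_ge0// sqr_ge0.
have : 0 <= (n - mu) * ((n + 1) * (f ^+ 2)).
  by rewrite mulr_ge0 ?subr_ge0// mulr_ge0 ?addr_ge0// sqr_ge0.
rewrite !expr2; nra.
Qed.

(** * Rotational derivatives of eigenfunctions *)

Section Eigen.
Variables (R : realType) (d : nat).
Local Notation V := 'rV[R]_d.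
Local Notation e j := (e_ R j).
Local Notation A0 := (@punctured R d).
Implicit Types (F G : V -> R) (x y v w p q : V).

Lemma sphere_compact : compact (@sphere R d).
Proof.
apply: bounded_closed_compact.
  exists 1; split=> [|M M1 x xS]; first exact: num_real.
  apply: le_trans (ltW M1); rewrite [leLHS]mx_normrE.
  apply/bigmax_leP; split=> // -[i j] _; rewrite (ord1 i) /=.
  rewrite -(@expr_le1 _ 2)// real_normK ?num_real// -xS /dotp (bigD1 j)//= expr2.
  by rewrite lerDl sumr_ge0// => k _; rewrite -expr2 sqr_ge0.
have -> : @sphere R d = (fun x : V => dotp x x) @^-1` [set 1] by [].
apply: preimage_closed => [x _|]; first exact: sqnorm_cont.
exact: closed_eq.
Qed.

Lemma lapB (A : set V) F G x : open A -> Ck 2 A F -> Ck 2 A G -> A x ->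
  lap (fun y => F y - G y) x = lap F x - lap G x.
Proof.
move=> oA CF CG Ax; have -> : (fun y => F y - G y) = (fun y => F y + (-1) * G y).
  by apply/funext => y; rewrite mulN1r.
by rewrite (lapD oA CF (CkZ _ oA CG) Ax) (lapZ _ oA CG Ax) mulN1r.
Qed.

Lemma Ck_lap k (A : set V) F : open A -> Ck k.+2 A F -> Ck k A (lap F).
Proof.
move=> oA CF; suff : Ck k A (fun x => \sum_j 'D_(e j) ('D_(e j) F) x) by [].
by apply: Ck_sum => // j _; do 2 apply: Ck_partial.
Qed.

Lemma Ck_sqnorm k (A : set V) : open A -> Ck k A (fun x => dotp x x).
Proof.
move=> oA; have -> : (fun x : V => dotp x x) = (fun x => \sum_j dotp (e j) x * dotp (e j) x).
  by apply/funext => x; apply: eq_bigr => j _; rewrite dotpC dotp_e.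
by apply: Ck_sum => // j _; apply: CkM => //; exact: Ck_dotp.
Qed.

Lemma punctured_conic : conic A0.
Proof. by move=> c x c0; rewrite /punctured /= scaler_eq0 negb_or gt_eqF. Qed.

(* 0-homogeneous extensions of the eigenfunctions on the sphere; at a general point
   the spherical Laplacian is |x|^2 times the Euclidean one. *)
Definition eigen0 (mu : R) F :=
  [/\ forall k, Ck k A0 F, homog0 A0 F &
      forall x, x != 0 -> lap F x * dotp x x = - mu * F x].

Local Notation oA := (@open_punctured R d).

Lemma eigen0_sphere mu F x : eigen0 mu F -> @sphere R d x -> lap F x = - mu * F x.
Proof.
move=> [_ _ eF] xS; have := eF x (sphere_neq0 xS).
by have -> : dotp x x = 1 := xS; rewrite mulr1.
Qed.

Lemma eigen0_ext mu f : sphere_eigenfunction mu f -> eigen0 mu (ext f).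
Proof.
move=> [sf _ ef]; have Cf k : Ck k A0 (ext f) by rewrite -cone_sphere; exact: sf.
split=> [//||x x0]; first exact: ext_homog0.
have c0 := enorm_gt0 x0; have rS := radial_sphere x0.
have {1}-> : x = enorm x *: radial x.
  by rewrite /radial scalerA divff ?gt_eqF// scale1r.
have rA : A0 (radial x) by apply: sphere_neq0.
rewrite (lap_homog punctured_conic oA (Cf 2) (@ext_homog0 _ _ _ _) c0 rA).
have L : laplace_beltrami f (radial x) = lap (ext f) (radial x).
  apply: (@laplace_beltramiE _ _ (@sphere R d)) => //.
  by rewrite cone_sphere; exact: oA.
rewrite -L -enorm_sqr mulrAC mulVf ?mul1r ?expf_neq0 ?gt_eqF//.
by rewrite -[LHS]opprK ef// mulNr.
Qed.

(* Derivative along the infinitesimal rotation of the plane (p, q); it commutes with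
   the Laplacian and with |x|^2, hence preserves eigen0. *)
Definition rotD p q F x := dotp p x * 'D_q F x - dotp q x * 'D_p F x.

Lemma rotD_derive p q F x : A0 x -> Ck 1 A0 F ->
  rotD p q F x = 'D_(dotp p x *: q - dotp q x *: p) F x.
Proof.
move=> Ax CF; rewrite /rotD -[- (_ *: p)]scaleNr (deriveDv _ _ oA CF Ax) !(deriveZv _ _ oA CF Ax).
by rewrite mulNr.
Qed.

Lemma lap_dotpM p F x : Ck 2 A0 F -> A0 x ->
  lap (fun y => dotp p y * F y) x = dotp p x * lap F x + 2 * 'D_p F x.
Proof.
move=> CF Ax; rewrite (lapM oA (Ck_dotp _ _ _) CF Ax) lap_dotp mulr0 addr0.
rewrite (deriveEpartial p oA CF Ax); congr (_ + 2 * _); apply: eq_bigr => j _.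
by rewrite derive_dotp dotp_e.
Qed.

(** The commutators of the Laplacian with the two linear forms contribute the same mixed second
    derivative, which cancels. [H] differentiates the eigenvalue equation; its terms coming from
    |x|^2 cancel by antisymmetry in [p] and [q]. *)
Lemma eigen0_rotD mu p q F : eigen0 mu F -> eigen0 mu (rotD p q F).
Proof.
move=> [CF hF eF].
have C1 u w k : Ck k A0 (fun x => dotp u x * 'D_w F x).
  by apply: (CkM oA (Ck_dotp _ _ _)); exact: (Ck_derive _ oA (CF k.+1)).
split=> [k|c x c0 Ax|x x0].
- exact: (CkB oA (C1 _ _ _) (C1 _ _ _)).
- rewrite /rotD !(derive_homog _ punctured_conic oA (CF 1) hF c0 Ax) !dotpZr.
  move: ('D_q F x) ('D_p F x) (dotp p x) (dotp q x) => a b P Q.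
  by field; rewrite gt_eqF.
rewrite /rotD (lapB oA (C1 _ _ 2) (C1 _ _ 2) x0).
rewrite (lap_dotpM _ (Ck_derive q oA (CF 3)) x0) (lap_dotpM _ (Ck_derive p oA (CF 3)) x0).
rewrite (deriveC p q oA (CF 2) x0) !(lap_derive _ oA (CF 3) x0).
have CL : Ck 1 A0 (lap F) := Ck_lap oA (CF 3).
have CS : Ck 1 A0 (fun x => dotp x x) := Ck_sqnorm _ oA.
have H v : 'D_v (lap F) x * dotp x x + lap F x * (2 * dotp x v) = - mu * 'D_v F x.
  rewrite -(deriveZf v (- mu) oA (CF 1) x0).
  have E : 'D_v (fun y => lap F y * dotp y y) x = 'D_v (fun y => - mu * F y) x.
    by apply: (derive_eq _ oA x0) => y y0; exact: eF.
  rewrite -E (deriveMf _ oA CL CS x0) (derive_val (is_derive := is_derive_sqnorm x v)).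
  by rewrite addrC; congr (_ + _); exact: mulrC.
move: (H p) (H q); rewrite (dotpC x p) (dotpC x q).
move: ('D_p (lap F) x) ('D_q (lap F) x) ('D_q F x) ('D_p F x) (lap F x) ('D_p ('D_q F) x) => lp lq Fq Fp L W.
move: (dotp p x) (dotp q x) (dotp x x) => P Q S Hp Hq.
have -> : (P * lq + 2 * W - (Q * lp + 2 * W)) * S = P * (lq * S) - Q * (lp * S) by ring.
have -> : lq * S = - mu * Fq - L * (2 * Q) by rewrite -Hq; ring.
have -> : lp * S = - mu * Fp - L * (2 * P) by rewrite -Hp; ring.
ring.
Qed.

(** By homogeneity a maximum over the compact sphere is one over the open set [A0], so the interior
    criterion [lap_max] applies without charts. *)
Lemma eigen0_max F : (0 < d)%N -> Ck 0 A0 F -> homog0 A0 F ->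
  exists2 x, @sphere R d x & forall y, A0 y -> F y <= F x.
Proof.
move=> d0 CF hF; have [||c cS cM] := @EVT_max_rV R d F (@sphere R d) _ sphere_compact.
- by exists (e (Ordinal d0)); rewrite /sphere /= dotp_e mxE !eqxx.
- apply: continuous_in_subspaceT => x; rewrite inE => /sphere_neq0 x0.
  exact: Ck_cont CF x0.
rewrite inE in cS; exists c => // y y0.
have -> : F y = F (radial y).
  by rewrite /radial hF// invr_gt0 enorm_gt0.
by apply: cM; rewrite inE; exact: radial_sphere.
Qed.

Lemma eigen0_bounded mu F : (0 < d)%N -> eigen0 mu F ->
  exists2 M, 0 <= M & forall x, A0 x -> `|F x| <= M.
Proof.
move=> d0 [CF hF _].
have [|c x c0 Ax|x _ xM] := @eigen0_max (fun x => F x ^+ 2) d0.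
- exact: (CkX 2 oA (CF 0%N)).
- by rewrite hF.
exists `|F x| => // y /xM.
by rewrite -[leLHS]real_normK ?num_real// -[leRHS]real_normK ?num_real// ler_sqr// nnegrE.
Qed.

(** Cauchy-Schwarz: [F] is differentiated along a vector of squared length
    [P ^+ 2 + Q ^+ 2 - 2 P Q W], where [P], [Q] and [W] are at most 1 in absolute value. *)
Lemma rotD_sqr_le p q F x : dotp p p = 1 -> dotp q q = 1 -> @sphere R d x ->
  Ck 1 A0 F -> rotD p q F x ^+ 2 <= 4 * \sum_j 'D_(e j) F x ^+ 2.
Proof.
move=> pp qq xS CF; have Ax : A0 x by exact: sphere_neq0.
rewrite (rotD_derive _ _ Ax CF) (deriveEpartial _ oA CF Ax).
pose g : V := \row_j 'D_(e j) F x; set v := _ - _.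
have -> : \sum_j v 0 j * 'D_(e j) F x = dotp v g.
  by apply: eq_bigr => j _; rewrite [g 0 j]mxE.
have -> : \sum_j 'D_(e j) F x ^+ 2 = dotp g g.
  by apply: eq_bigr => j _; rewrite [g 0 j]mxE expr2.
apply: le_trans (CauchySchwarz v g) _; rewrite ler_wpM2r ?dotp_ge0// /v.
rewrite dotpBl !dotpBr !dotpZl !dotpZr pp qq !mulr1 [dotp q p]dotpC.
have sq1 (t : R) : `|t| <= 1 -> t ^+ 2 <= 1.
  by move=> t1; rewrite -real_normK ?num_real// expr_le1.
have := sq1 _ (sphere_le pp xS); have := sq1 _ (sphere_le qq xS).
have := sq1 _ (sphere_le pp qq).
move: (dotp p x) (dotp q x) (dotp p q) => P Q W W1 Q1 P1.
have := sqr_ge0 (P + Q * W); have : 0 <= Q ^+ 2 * (1 - W ^+ 2).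
  by rewrite mulr_ge0 ?sqr_ge0// subr_ge0.
rewrite !expr2 in W1 Q1 P1 *; nra.
Qed.

(* Bernstein's argument: apply the maximum principle to (L F)^2 + A F^2, where L is
   the infinitesimal rotation and A = 4 (|mu| + 1). *)
Lemma eigen0_rotD_bound mu p q F M : (0 < d)%N -> dotp p p = 1 -> dotp q q = 1 ->
  eigen0 mu F -> 0 <= M -> (forall x, A0 x -> `|F x| <= M) ->
  forall x, A0 x -> `|rotD p q F x| <= 2 * (`|mu| + 1) * M.
Proof.
move=> d0 pp qq eF M0 FM; have eL := eigen0_rotD p q eF.
case: (eF) => CF hF EF; case: (eL) => CL hL EL.
pose A := 4 * (`|mu| + 1).
pose G x := rotD p q F x * rotD p q F x + A * (F x * F x).
have CL2 k := CkM oA (CL k) (CL k); have CF2 k := CkM oA (CF k) (CF k).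
have CG k : Ck k A0 G := CkD oA (CL2 k) (CkZ A oA (CF2 k)).
have hG : homog0 A0 G by move=> c x c0 Ax; rewrite /G hF// hL.
have [x0 x0S x0M] := eigen0_max d0 (CG 0%N) hG.
have Ax0 : A0 x0 by exact: sphere_neq0.
have [_] := lap_max oA (CG 2) Ax0 x0M.
rewrite (lapD oA (CL2 2) (CkZ A oA (CF2 2)) Ax0) (lapZ A oA (CF2 2) Ax0).
rewrite (lapM oA (CL 2) (CL 2) Ax0) (lapM oA (CF 2) (CF 2) Ax0).
rewrite (eigen0_sphere eF x0S) (eigen0_sphere eL x0S).
have := rotD_sqr_le pp qq x0S (CF 1).
rewrite (eq_bigr (fun j => 'D_(e j) F x0 * 'D_(e j) F x0)); last by move=> j _; rewrite expr2.
have : 0 <= \sum_j 'D_(e j) (rotD p q F) x0 * 'D_(e j) (rotD p q F) x0.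
  by apply: sumr_ge0 => j _; rewrite -expr2 sqr_ge0.
move: (\sum_j _) (\sum_j _) => gL gF gL0 LF H.
have Lx0 : rotD p q F x0 ^+ 2 <= A * `|mu| * F x0 ^+ 2.
  exact: (gradient_bound_arith (normr_ge0 mu) (ler_norm mu) gL0 LF).
have F2 y : A0 y -> F y ^+ 2 <= M ^+ 2.
  by move=> Ay; rewrite -[leLHS]real_normK ?num_real// ler_sqr ?nnegrE// FM.
have A00 : 0 <= A by rewrite mulr_ge0// addr_ge0.
(* The constants match exactly: [A * (|mu| + 1)] is the square of [2 * (|mu| + 1)]. *)
have Gx0 : G x0 <= (2 * (`|mu| + 1) * M) ^+ 2.
  rewrite /G -!expr2; apply: (@le_trans _ _ (A * `|mu| * M ^+ 2 + A * M ^+ 2)).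
    apply: lerD; first by apply: le_trans Lx0 _; rewrite ler_wpM2l ?F2// mulr_ge0.
    by rewrite ler_wpM2l ?F2.
  have -> : (2 * (`|mu| + 1) * M) ^+ 2 = A * `|mu| * M ^+ 2 + A * M ^+ 2 by rewrite /A; ring.
  exact: lexx.
move=> y Ay; rewrite -ler_sqr ?nnegrE ?mulr_ge0 ?addr_ge0//.
apply: le_trans Gx0; apply: le_trans (x0M y Ay).
by rewrite real_normK ?num_real// /G -!expr2 lerDl mulr_ge0// sqr_ge0.
Qed.

End Eigen.

(** * Vanishing to infinite order and its propagation *)

Section UniqueContinuation.
Variables (R : realType) (d : nat).
Local Notation V := 'rV[R]_d.
Local Notation e j := (e_ R j).
Local Notation A0 := (@punctured R d).
Local Notation oA := (@open_punctured R d).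
Implicit Types (F G : V -> R) (x y z v w p q n : V) (O : set V) (g : 'M[R]_d).

Lemma eigen0_iter mu p q F m : eigen0 mu F -> eigen0 mu (iter m (rotD p q) F).
Proof. by move=> eF; elim: m => [|m IH] //=; exact: eigen0_rotD. Qed.

(** Each iterate is an eigenfunction for the same [mu], so the bound for a single rotation can be
    repeated with the same constant. *)
Lemma eigen0_iter_bound mu p q F : (0 < d)%N -> dotp p p = 1 -> dotp q q = 1 ->
  eigen0 mu F -> exists M, forall m x, A0 x ->
  `|iter m (rotD p q) F x| <= (2 * (`|mu| + 1)) ^+ m * M.
Proof.
move=> d0 pp qq eF; have [M M0 FM] := eigen0_bounded d0 eF.
exists M; elim=> [|m IH] x Ax /=; first by rewrite mul1r FM.
rewrite exprS -mulrA; apply: (eigen0_rotD_bound d0 pp qq (eigen0_iter p q m eF)) => //.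
by rewrite mulr_ge0// exprn_ge0// mulr_ge0// addr_ge0.
Qed.

(* Along s |-> p + s q the rotation is (1 + s^2) d/ds, and the iterated rotations
   play the role of the derivatives in vanish_of_growth. *)
Lemma eigen0_line_vanish mu F p q t : (0 < d)%N -> eigen0 mu F ->
  dotp p p = 1 -> dotp q q = 1 -> dotp p q = 0 ->
  (forall m, iter m (rotD p q) F p = 0) -> F (p + t *: q) = 0.
Proof.
move=> d0 eF pp qq pq H0.
have A s : A0 (p + s *: q).
  rewrite /punctured /=; apply/eqP => /(congr1 (dotp p)).
  by rewrite dotpDr dotpZr pp pq mulr0 addr0 dotp0r; apply/eqP; exact: oner_neq0.
have [M FM] := eigen0_iter_bound d0 pp qq eF.
have C0 : 0 < 2 * (`|mu| + 1) by rewrite mulr_gt0// ltr_wpDl.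
have [D E] : (forall m s, derivable (fun s : R => iter m (rotD p q) F (p + s *: q)) s 1) /\
   (forall m s, 'D_1 (fun s : R => iter m (rotD p q) F (p + s *: q)) s =
      'D_q (iter m (rotD p q) F) (p + s *: q)).
  have L m s := is_derive_line (Ck_derivablev q oA
    (let: And3 C _ _ := eigen0_iter p q m eF in C 1%N) (A s)).
  by split=> m s; have [] := L m s.
have := @vanish_of_growth R (fun m s => iter m (rotD p q) F (p + s *: q)) _ M C0 D.
move=> /(_ _ _ _ 0 t); apply => [m s|m s|m]; last by rewrite scale0r addr0.
  (* Degree 0 gives ['D_p = - s * 'D_q] at [p + s *: q], so the rotation there is
     [(1 + s ^+ 2) * 'D_q], which dominates the derivative along the line. *)
  rewrite E; have [CG hG _] := eigen0_iter p q m eF.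
  have := euler0 hG (A s); rewrite (deriveDv _ _ oA (CG 1) (A s)) (deriveZv _ _ oA (CG 1) (A s)).
  rewrite /= /rotD !dotpDr !dotpZr pp qq pq [dotp q p]dotpC pq mulr0 addr0 mulr1 add0r.
  move: ('D_q _ _) ('D_p _ _) => a b /(canRL (addrK _)); rewrite sub0r => ->.
  have -> : 1 * a - s * - (s * a) = (1 + s ^+ 2) * a by ring.
  rewrite normrM -[leLHS]mul1r ler_wpM2r// ger0_norm ?addr_ge0 ?sqr_ge0//.
  by rewrite lerDl sqr_ge0.
exact: FM.
Qed.

(** Great circles through [p] fill the half-space: up to a positive factor, [x] is [p] itself or
    [p + t q] with [q] a unit vector orthogonal to [p]. *)
Lemma eigen0_half_vanish mu F p x : (0 < d)%N -> eigen0 mu F -> dotp p p = 1 ->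
  (forall q m, iter m (rotD p q) F p = 0) -> 0 < dotp p x -> F x = 0.
Proof.
move=> d0 eF pp H c0; have [_ hF _] := eF.
set c := dotp p x; pose w := x - c *: p.
have p0 : A0 p by apply: sphere_neq0.
have xE : x = c *: p + w by rewrite addrC subrK.
have [w0|w0] := eqVneq w 0.
  by rewrite xE w0 addr0 hF//; exact: (H p 0%N).
have s0 := enorm_gt0 w0; pose q := (enorm w)^-1 *: w.
have qq : dotp q q = 1 by exact: (radial_sphere w0).
have pq : dotp p q = 0 by rewrite dotpZr dotpBr dotpZr pp mulr1 subrr mulr0.
have -> : x = c *: (p + (enorm w / c) *: q).
  rewrite /q scalerDr !scalerA.
  have -> : c * (enorm w / c) * (enorm w)^-1 = 1 by field; rewrite !gt_eqF.
  by rewrite scale1r -xE.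
rewrite hF//; first exact: (eigen0_line_vanish _ d0 eF pp qq pq (H q)).
rewrite /punctured /=; apply/eqP => /(congr1 (dotp p)).
by rewrite dotpDr dotpZr pp pq mulr0 addr0 dotp0r; apply/eqP; exact: oner_neq0.
Qed.

Lemma open_derive_vanish O G x v : open O -> (forall x, O x -> G x = 0) -> O x -> 'D_v G x = 0.
Proof.
move=> oO G0 Ox; rewrite (derive_eq v oO Ox G0); exact: (derive_cst (0 : R)).
Qed.

Lemma open_iter_vanish O G p q m : open O -> (forall x, O x -> G x = 0) ->
  forall x, O x -> iter m (rotD p q) G x = 0.
Proof.
move=> oO G0; elim: m => [|m IH] x Ox //=; first exact: G0.
by rewrite /rotD !(open_derive_vanish _ oO IH Ox) !mulr0 subrr.
Qed.

Lemma iter_rotD_radial mu F p q m z : eigen0 mu F -> z != 0 ->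
  iter m (rotD p q) F (radial z) = iter m (rotD p q) F z.
Proof.
move=> eF z0; have [_ hG _] := eigen0_iter p q m eF.
by rewrite hG// invr_gt0 enorm_gt0.
Qed.

Lemma eigen0_open_vanish mu F O z x : (0 < d)%N -> eigen0 mu F -> open O -> O z ->
  z != 0 -> (forall x, O x -> F x = 0) -> 0 < dotp z x -> F x = 0.
Proof.
move=> d0 eF oO Oz z0 F0 zx.
apply: (@eigen0_half_vanish mu F (radial z) x) => //.
- exact: radial_sphere.
- by move=> q m; rewrite (iter_rotD_radial _ _ _ eF z0) (open_iter_vanish _ _ _ oO F0).
- by rewrite dotpZl mulr_gt0// invr_gt0 enorm_gt0.
Qed.

(* G vanishes to second order along the part of the hyperplane n^\perp inside O. *)
Definition flat_on O n G :=
  forall x, O x -> dotp n x = 0 -> G x = 0 /\ forall v, 'D_v G x = 0.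

Lemma derive_along O n G x v : open O -> (forall x, O x -> dotp n x = 0 -> G x = 0) ->
  O x -> dotp n x = 0 -> dotp n v = 0 -> 'D_v G x = 0.
Proof.
move=> oO G0 Ox nx nv.
have [r r0 rO] := near_line v (open_nbhs_nbhs (conj oO Ox)).
suff [_] : is_derive (x + (0 : R) *: v) v G 0 by rewrite scale0r addr0.
have C0 : is_derive (0 : R) (1 : R) (fun=> 0 : R) 0 by exact: is_derive_cst.
apply/is_derive_lineP; apply: (near_eq_is_derive _ C0).
apply/nbhs_normP; exists r => // s /=; rewrite sub0r normrN => sr.
symmetry; apply: G0; first exact: rO.
by rewrite dotpDr dotpZr nx nv mulr0 addr0.
Qed.

(* Second derivatives with a tangential direction vanish by flatness; the remaining
   one, in the direction n, is then the Laplacian, which is a multiple of G = 0. *)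
Lemma flat_hessian mu O n G x v w : dotp n n = 1 -> open O -> O `<=` A0 ->
  eigen0 mu G -> flat_on O n G -> O x -> dotp n x = 0 -> 'D_v ('D_w G) x = 0.
Proof.
move=> nn oO OA [CG _ eG] fG Ox nx; have Ax := OA _ Ox.
have T u u' : dotp n u = 0 -> 'D_u ('D_u' G) x = 0.
  by apply: (derive_along oO) => // y Oy ny; have [_] := fG y Oy ny.
have B u u' : 'D_u ('D_u' G) x = dotp n u * dotp n u' * 'D_n ('D_n G) x.
  have S t t' : 'D_t ('D_t' G) x = dotp n t * 'D_n ('D_t' G) x.
    have {1}-> : t = (t - dotp n t *: n) + dotp n t *: n by rewrite subrK.
    have Ct := Ck_derive t' oA (CG 2).
    rewrite (deriveDv _ _ oA Ct Ax) (deriveZv _ _ oA Ct Ax) (T (t - dotp n t *: n)) ?add0r//.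
    by rewrite dotpBr dotpZr nn mulr1 subrr.
  by rewrite S (deriveC u' n oA (CG 2) Ax) S mulrA.
rewrite B; suff -> : 'D_n ('D_n G) x = 0 by rewrite mulr0.
have := eG x Ax; rewrite (fG x Ox nx).1 mulr0 => /eqP.
rewrite mulf_eq0 dotp_eq0 (negbTE Ax) orbF => /eqP <-.
rewrite /lap (eq_bigr (fun j => n 0 j * n 0 j * 'D_n ('D_n G) x)).
  by rewrite -mulr_suml -/(dotp n n) nn mul1r.
by move=> j _; rewrite B !dotp_e.
Qed.

(** On the wall, the value and first derivatives of [rotD p q G] involve only derivatives of [G] of
    order one and two, all zero there. So flatness reproduces itself under iteration. *)
Lemma flat_rotD mu O n G p q : dotp n n = 1 -> open O -> O `<=` A0 ->
  eigen0 mu G -> flat_on O n G -> flat_on O n (rotD p q G).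
Proof.
move=> nn oO OA eG fG x Ox nx; have [Gx DGx] := fG x Ox nx.
split=> [|v]; first by rewrite /rotD !DGx !mulr0 subrr.
have Ax := OA _ Ox; have [CG _ _] := eG.
have C1 u w := CkM oA (@Ck_dotp _ _ 1 _ u) (Ck_derive w oA (CG 2%N)).
have -> : rotD p q G = (fun y => dotp p y * 'D_q G y + (- 1) * (dotp q y * 'D_p G y)).
  by apply/funext => y; rewrite mulN1r.
rewrite (deriveDf _ oA (C1 _ _) (CkZ _ oA (C1 _ _)) Ax) (deriveZf _ _ oA (C1 _ _) Ax).
rewrite !(deriveMf _ oA (@Ck_dotp _ _ 1 _ _) (Ck_derive _ oA (CG 2%N)) Ax).
by rewrite !(flat_hessian _ _ nn oO OA eG fG Ox nx) (DGx q) (DGx p) !(mulr0, mul0r, addr0).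
Qed.

Lemma flat_iter mu O n G p q m : dotp n n = 1 -> open O -> O `<=` A0 ->
  eigen0 mu G -> flat_on O n G -> flat_on O n (iter m (rotD p q) G).
Proof.
move=> nn oO OA eG fG; elim: m => [|m IH] //=.
exact: (flat_rotD _ _ nn oO OA (eigen0_iter p q m eG) IH).
Qed.

Lemma exists_orthogonal p : (1 < d)%N -> p != 0 -> exists2 w, w != 0 & dotp p w = 0.
Proof.
move=> d1 p0; pose i0 : 'I_d := Ordinal (ltnW d1); pose i1 : 'I_d := Ordinal d1.
have [pi0|pi0] := eqVneq (p 0 i0) 0.
  exists (e i0); last by rewrite dotp_e.
  by apply: sphere_neq0; rewrite /sphere /= dotp_e mxE !eqxx.
exists (p 0 i1 *: e i0 - p 0 i0 *: e i1).
  apply/eqP => /rowP /(_ i1); rewrite !mxE !eqxx /= mulr0 mulr1 sub0r => /eqP.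
  by rewrite oppr_eq0 (negbTE pi0).
by rewrite dotpBr !dotpZr !dotp_e mulrC subrr.
Qed.

(* Vanishing at infinite order at p gives vanishing on the open half-space around p;
   every point is then reached from p by at most two more such half-spaces. *)
Lemma eigen0_flat_vanish mu O n G z : (1 < d)%N -> dotp n n = 1 -> open O -> O `<=` A0 ->
  eigen0 mu G -> flat_on O n G -> O z -> dotp n z = 0 -> forall x, x != 0 -> G x = 0.
Proof.
move=> d1 nn oO OA eG fG Oz nz; have d0 := ltnW d1; have z0 := OA _ Oz.
set p := radial z; have pp : dotp p p = 1 by exact: radial_sphere.
have p0 : p != 0 by apply: sphere_neq0.
have H1 x : 0 < dotp p x -> G x = 0.
  apply: (@eigen0_half_vanish mu) => // q m.
  by rewrite (iter_rotD_radial _ _ _ eG z0); case: (flat_iter p q m nn oO OA eG fG Oz nz).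
clearbody p.
have oD w : open [set y | 0 < dotp w y].
  have -> : [set y | 0 < dotp w y] = dotp w @^-1` [set t | 0 < t] by [].
  by apply: open_comp => [y _|]; [exact: dotp_cont|exact: open_gt].
(* The bisector [x + enorm x *: p] makes an acute angle with both [p] and [x]: [G] vanishes around
   it by [H1], hence at [x]. *)
have H2 x : x + enorm x *: p != 0 -> x != 0 -> G x = 0.
  move=> u0 x0; have ex := enorm_gt0 x0.
  have sx : 0 < dotp x p + enorm x.
    have : `|dotp (radial x) p| <= 1 by apply: sphere_le => //; exact: radial_sphere.
    rewrite ler_norml => /andP[+ _]; rewrite dotpZl => H.
    have : 0 <= enorm x * ((enorm x)^-1 * dotp x p + 1).
      by apply: mulr_ge0; [exact: ltW|rewrite -lerBlDr sub0r].
    rewrite mulrDr mulVKf ?gt_eqF// mulr1 le_eqVlt => /orP[/eqP H0|//].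
    exfalso; move/eqP: u0; apply; apply/eqP; rewrite -dotp_eq0.
    rewrite dotpDl !dotpDr !dotpZl !dotpZr pp -enorm_sqr [dotp p x]dotpC.
    have -> : dotp x p = - enorm x by apply/eqP; rewrite -addr_eq0 H0.
    by apply/eqP; ring.
  apply: (@eigen0_open_vanish mu G _ (x + enorm x *: p) x d0 eG (oD p)) => //=.
    by rewrite dotpDr dotpZr pp mulr1 dotpC.
  rewrite dotpDl dotpZl -enorm_sqr expr2 -mulrDr [dotp p x]dotpC addrC mulr_gt0//.
(* Only the direction of [- p] remains. The half-space of [w] avoids the line of [p], so [H2]
   applies throughout it, in particular around [x + w]. *)
move=> x x0; have [u0|u0] := eqVneq (x + enorm x *: p) 0; last exact: H2.
have [w w0 pw] := exists_orthogonal d1 p0.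
have xE : x = - enorm x *: p by apply/eqP; rewrite scaleNr -addr_eq0 u0.
have ex := enorm_gt0 x0.
apply: (@eigen0_open_vanish mu G _ (x + w) x d0 eG (oD w)) => //=.
- by rewrite dotpDr xE dotpZr [dotp w p]dotpC pw mulr0 add0r dotp_gt0.
- apply/eqP => /(congr1 (dotp w)); rewrite dotpDr xE dotpZr [dotp w p]dotpC pw mulr0 add0r dotp0r.
  by apply/eqP; rewrite dotp_eq0.
- move=> y /= wy; apply: H2; last by apply: contraTneq wy => ->; rewrite dotp0r ltxx.
  apply/eqP => /(congr1 (dotp w)); rewrite dotpDr dotpZr [dotp w p]dotpC pw mulr0 addr0 dotp0r.
  by apply/eqP; rewrite gt_eqF.
- have wx : dotp w x = 0 by rewrite xE dotpZr dotpC pw mulr0.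
  by rewrite dotpDl wx addr0 dotp_gt0.
Qed.

End UniqueContinuation.

(** * Reflections and cells *)

Section Reflections.
Variables (R : realType) (d : nat).
Local Notation V := 'rV[R]_d.
Local Notation e j := (e_ R j).
Local Notation A0 := (@punctured R d).
Local Notation oA := (@open_punctured R d).
Implicit Types (F G : V -> R) (x y z v w p q n a : V) (O : set V) (g : 'M[R]_d).

Lemma cont_rV (X : V -> V) x : (forall j, {for x, continuous (fun y => X y 0 j)}) ->
  {for x, continuous X}.
Proof.
move=> cX; have -> : X = (fun y => \sum_j X y 0 j *: e j).
  by apply/funext => y; exact: row_sum_delta.
elim: (index_enum _) => [|j s IH].
  have -> : (fun y => \sum_(j <- [::]) X y 0 j *: e j) = (fun=> 0).
    by apply/funext => y; rewrite big_nil.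
  exact: cst_continuous.
have -> : (fun y => \sum_(i <- j :: s) X y 0 i *: e i) =
    (fun y => X y 0 j *: e j + \sum_(i <- s) X y 0 i *: e i).
  by apply/funext => y; rewrite big_cons.
have H1 : (fun y => X y 0 j *: e j) @ x --> X x 0 j *: e j.
  exact: (continuous_comp (cX j) (@scalel_continuous R V (e j) (X x 0 j))).
exact: (cvgD H1 IH).
Qed.

Lemma mulmx_cont g : continuous (fun x : V => x *m g).
Proof.
move=> x; apply: cont_rV => j.
have -> : (fun y : V => (y *m g) 0 j) = dotp (\row_i g i j); last exact: dotp_cont.
by apply/funext => y; rewrite mxE; apply: eq_bigr => i _; rewrite mxE mulrC.
Qed.

Lemma is_derive_mulmx g F x v : derivable F (x *m g) (v *m g) ->
  is_derive x v (fun y => F (y *m g)) ('D_(v *m g) F (x *m g)).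
Proof.
move=> dF; have E : x = x + 0 *: v by rewrite scale0r addr0.
rewrite {1}E; apply/is_derive_lineP.
have -> : (fun s : R => F ((x + s *: v) *m g)) = (fun s => F (x *m g + s *: (v *m g))).
  by apply/funext => s; rewrite mulmxDl scalemxAl.
by apply/is_derive_lineP; rewrite scale0r addr0.
Qed.

Section OrthogonalChange.
Variable g : 'M[R]_d.
Hypothesis gO : g *m g^T = 1%:M.

Lemma orth_neq0 x : (x *m g != 0) = (x != 0).
Proof. by congr negb; rewrite -[LHS]dotp_eq0 dotp_mulmx -mulmxA gO mulmx1 dotp_eq0. Qed.

Lemma Ck_mulmx k F : Ck k A0 F -> Ck k A0 (fun x => F (x *m g)).
Proof.
have H x : A0 x -> A0 (x *m g) by rewrite /punctured /= orth_neq0.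
elim: k F => [|k IH] F CF.
  by split=> // x Ax; exact: (continuous_comp (mulmx_cont (x:=x)) (Ck_cont CF (H x Ax))).
split=> [x Ax|j]; first exact: (continuous_comp (mulmx_cont (x:=x)) (Ck_cont CF (H x Ax))).
have D x (Ax : A0 x) := is_derive_mulmx (Ck_derivablev (e j *m g) oA CF (H x Ax)).
split=> [x /D[] //|].
apply: (Ck_eq oA _ (IH _ (Ck_derive (e j *m g) oA CF))) => x Ax.
by have [_ ->] := D x Ax.
Qed.

Lemma derive_mulmx F x v : Ck 1 A0 F -> A0 x ->
  'D_v (fun y => F (y *m g)) x = 'D_(v *m g) F (x *m g).
Proof.
move=> CF Ax; have Ag : A0 (x *m g) by rewrite /punctured /= orth_neq0.
by have [_ ->] := is_derive_mulmx (Ck_derivablev (v *m g) oA CF Ag).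
Qed.

Lemma orth_trace (H : 'I_d -> 'I_d -> R) :
  \sum_j \sum_k \sum_l g j k * g j l * H k l = \sum_k H k k.
Proof.
have gT k l : \sum_j g j k * g j l = (k == l)%:R.
  have := mulmx1C gO => /matrixP /(_ k l); rewrite !mxE => <-.
  by apply: eq_bigr => i _; rewrite !mxE.
rewrite exchange_big; apply: eq_bigr => k _ /=.
rewrite exchange_big (bigD1 k)//= [X in _ + X]big1 ?addr0 => [|l lk].
  by rewrite -mulr_suml gT eqxx mul1r.
by rewrite -mulr_suml gT eq_sym (negbTE lk) mul0r.
Qed.

Lemma lap_mulmx F x : Ck 2 A0 F -> A0 x -> lap (fun y => F (y *m g)) x = lap F (x *m g).
Proof.
move=> CF Ax; have Ag : A0 (x *m g) by rewrite /punctured /= orth_neq0.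
have E j : 'D_(e j) ('D_(e j) (fun y => F (y *m g))) x =
    'D_(e j *m g) ('D_(e j *m g) F) (x *m g).
  rewrite -(derive_mulmx _ (Ck_derive (e j *m g) oA CF) Ax).
  by apply: (derive_eq _ oA Ax) => y Ay; exact: (derive_mulmx _ (CkW CF) Ay).
have E2 v : 'D_v ('D_v F) (x *m g) =
    \sum_k \sum_l v 0 k * v 0 l * 'D_(e l) ('D_(e k) F) (x *m g).
  rewrite (deriveEpartial v oA (Ck_derive v oA CF) Ag); apply: eq_bigr => k _.
  rewrite (deriveC v (e k) oA CF Ag) (deriveEpartial v oA (Ck_partial k CF) Ag).
  by rewrite mulr_sumr; apply: eq_bigr => l _; rewrite mulrA.
transitivity (\sum_j \sum_k \sum_l
    (e j *m g) 0 k * (e j *m g) 0 l * 'D_(e l) ('D_(e k) F) (x *m g)).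
  by apply: eq_bigr => j _; exact: (etrans (E j) (E2 _)).
under eq_bigr do under eq_bigr do under eq_bigr do rewrite -!rowE !mxE.
exact: (orth_trace (fun k l => 'D_(e l) ('D_(e k) F) (x *m g))).
Qed.

Lemma eigen0_mulmx mu F : eigen0 mu F -> eigen0 mu (fun x => F (x *m g)).
Proof.
move=> [CF hF eF]; split=> [k|c x c0 Ax|x x0]; first exact: Ck_mulmx.
  by rewrite -scalemxAl hF// /punctured /= orth_neq0.
rewrite (lap_mulmx (CF 2) x0) -(eF (x *m g)) ?orth_neq0//; congr (_ * _).
by rewrite dotp_mulmx -mulmxA gO mulmx1.
Qed.

End OrthogonalChange.

(** The reflection with an explicit normal; [reflection H] uses an arbitrarily chosen one, and
    [reflection_hyperplane] identifies the two. *)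
Definition refl a : 'M[R]_d := 1%:M - (2 / dotp a a) *: (a^T *m a).

Lemma mulmx_refl a x : x *m refl a = x - (2 / dotp a a * dotp x a) *: a.
Proof.
rewrite mulmxBr mulmx1; congr (_ - _); rewrite -scalemxAr mulmxA.
have -> : x *m a^T = (dotp x a)%:M.
  by rewrite [LHS]mx11_scalar mxE; congr (_%:M); apply: eq_bigr => i _; rewrite mxE.
by rewrite mul_scalar_mx scalerA.
Qed.

Lemma refl_tr a : (refl a)^T = refl a.
Proof. by rewrite /refl linearB /= trmx1 linearZ /= trmx_mul trmxK. Qed.

Lemma dotp_refl a x y : dotp (x *m refl a) y = dotp x (y *m refl a).
Proof. by rewrite dotp_mulmx refl_tr. Qed.

Lemma reflK a x : a != 0 -> x *m refl a *m refl a = x.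
Proof.
move=> /dotp_gt0/lt0r_neq0 aa; rewrite !mulmx_refl dotpBl dotpZl.
rewrite -addrA -opprD -scalerDl.
have -> : 2 / dotp a a * dotp x a +
   2 / dotp a a * (dotp x a - 2 / dotp a a * dotp x a * dotp a a) = 0 by field.
by rewrite scale0r subr0.
Qed.

Lemma refl_orth a : a != 0 -> refl a *m (refl a)^T = 1%:M.
Proof.
move=> a0; rewrite refl_tr; apply/row_matrixP => i.
by rewrite -[refl a *m refl a]mul1mx mulmxA row_mul row_mul reflK.
Qed.

Lemma refl_fix a x : dotp x a = 0 -> x *m refl a = x.
Proof. by move=> xa; rewrite mulmx_refl xa mulr0 scale0r subr0. Qed.

Lemma refl_self a : a != 0 -> a *m refl a = - a.
Proof.
move=> /dotp_gt0/lt0r_neq0 aa; rewrite mulmx_refl divfK// scaler_nat mulr2n opprD addrA.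
by rewrite subrr sub0r.
Qed.

Lemma reflZ (c : R) a : c != 0 -> refl (c *: a) = refl a.
Proof.
move=> c0; rewrite /refl; congr (_ - _).
have [->|a0] := eqVneq a 0; first by rewrite scaler0.
have -> : (c *: a)^T *m (c *: a) = (c * c) *: (a^T *m a).
  by apply/matrixP => i j; rewrite !mxE !big_ord_recl !big_ord0 !mxE !addr0; ring.
rewrite dotpZl dotpZr scalerA; congr (_ *: _).
have := lt0r_neq0 (dotp_gt0 a0) => aa.
by field; rewrite aa c0.
Qed.

(* F + F o s_n is flat on the wall: it vanishes there, and its normal derivative is
   zero by symmetry. *)
Lemma eigen0_odd mu F n O z : (1 < d)%N -> dotp n n = 1 -> open O -> O `<=` A0 ->
  eigen0 mu F -> (forall x, O x -> dotp n x = 0 -> F x = 0) -> O z -> dotp n z = 0 ->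
  forall x, x != 0 -> F (x *m refl n) = - F x.
Proof.
move=> d1 nn oO OA eF F0 Oz nz x x0; have n0 : n != 0 by apply: sphere_neq0.
have gO := refl_orth n0; have eg := eigen0_mulmx gO eF.
have [CF hF EF] := eF; have [Cg hg Eg] := eg.
pose G y := F y + F (y *m refl n).
have eG : eigen0 mu G.
  split=> [k|c y c0 Ay|y y0]; first exact: (CkD oA (CF k) (Cg k)).
    by rewrite /G hF// (hg c y c0 Ay).
  have L := lapD oA (CF 2) (Cg 2) y0; rewrite /G L.
  move: (EF y y0) (Eg y y0); move: (lap F y) (lap _ y) => b c Eb Ec.
  by rewrite mulrDl Eb Ec mulrDr.
have fG : flat_on O n G.
  move=> y Oy ny; have Ay := OA _ Oy; split=> [|v].
    by rewrite /G refl_fix 1?dotpC// F0// addr0.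
  (* At a wall point the two derivatives add up to the derivative of [F] along [v + v *m refl n],
     which is tangent to the wall. *)
  rewrite (deriveDf v oA (CF 1) (Cg 1) Ay) (derive_mulmx gO v (CF 1) Ay).
  rewrite (refl_fix (x := y)) 1?dotpC// -(deriveDv _ _ oA (CF 1) Ay).
  apply: (derive_along oO F0 Oy ny).
  rewrite mulmx_refl nn dotpDr dotpBr dotpZr nn dotpC; by field.
have := eigen0_flat_vanish d1 nn oO OA eG fG Oz nz x0.
by rewrite /G addrC => /eqP; rewrite addr_eq0 => /eqP.
Qed.

End Reflections.

(** * Topology of spherical cells, their sides and hyperplanes *)

Section Cells.
Variables (R : realType) (d : nat).
Local Notation V := 'rV[R]_d.
Local Notation oA := (@open_punctured R d).
Implicit Types (x y z v w n : V).

Lemma closed_sub_closure (T : topologicalType) (A B : set T) : closed B -> A `<=` B ->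
  closure A `<=` B.
Proof. by move=> cB AB; rewrite [X in _ `<=` X]((closure_id B).1 cB); exact: closureS. Qed.

Lemma open_dotp_gt n : open [set y | 0 < dotp n y].
Proof.
have -> : [set y | 0 < dotp n y] = dotp n @^-1` [set t | 0 < t] by [].
by apply: open_comp => [y _|]; [exact: dotp_cont|exact: open_gt].
Qed.

Lemma closed_dotp_ge n : closed [set y | 0 <= dotp n y].
Proof.
have -> : [set y | 0 <= dotp n y] = dotp n @^-1` [set t | 0 <= t] by [].
by apply: preimage_closed => [y _|]; [exact: dotp_cont|exact: closed_ge].
Qed.

Lemma sphere_closed : closed (@sphere R d).
Proof.
have -> : @sphere R d = (fun x : V => dotp x x) @^-1` [set 1] by [].
by apply: preimage_closed => [x _|]; [exact: sqnorm_cont|exact: closed_eq].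
Qed.

Lemma radial_cont x : x != 0 -> {for x, continuous (@radial R d)}.
Proof.
move=> x0; apply: cont_rV => j.
have -> : (fun y : V => radial y 0 j) = (fun y => rho y * y 0 j).
  by apply/funext => y; rewrite mxE.
exact: (cvgM (rho_cont x0) (@coord_cont R d j x)).
Qed.

Lemma sphere_norm_le1 x : @sphere R d x -> `|x| <= 1.
Proof.
move=> xS; rewrite [leLHS]mx_normrE; apply/bigmax_leP; split=> // -[i j] _.
rewrite (ord1 i) /= -(@expr_le1 _ 2)// real_normK ?num_real//.
have -> : 1 = dotp x x by []; rewrite /dotp (bigD1 j)//= expr2.
by rewrite lerDl sumr_ge0// => k _; rewrite -expr2 sqr_ge0.
Qed.

Section Cell.
Variables (r : nat) (a : 'I_r -> V).

Lemma cell_sphere : cell a `<=` @sphere R d.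
Proof. by move=> x []. Qed.

Lemma cone_cellE : cone (cell a) = [set x | x != 0 /\ forall i, 0 < dotp (a i) x].
Proof.
apply/seteqP; split=> x /=.
  move=> [xS xa]; have x0 : x != 0 by apply: (cone_sub cell_sphere); split.
  split=> // i; have := xa i I; rewrite /half_space /= dotpZr pmulr_rgt0//.
  by rewrite invr_gt0 enorm_gt0.
move=> [x0 xa]; split; first exact: radial_sphere.
by move=> i _; rewrite /half_space /= dotpZr mulr_gt0// invr_gt0 enorm_gt0.
Qed.

Lemma open_dotp_family (P : pred 'I_r) : open [set x | x != 0 /\ forall i, P i -> 0 < dotp (a i) x].
Proof.
suff H (x : V) : x != 0 -> (forall i, P i -> 0 < dotp (a i) x) ->
    \forall y \near x, y != 0 /\ forall i, P i -> 0 < dotp (a i) y.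
  by rewrite openE => x [x0 xa]; exact: H.
move=> x0 xa; apply: filterI; first exact: (open_nbhs_nbhs (conj oA x0)).
apply: (@filter_forall _ _ (fun (i : 'I_r) (y : V) => P i -> 0 < dotp (a i) y) (nbhs x)) => i; have [Pi|nPi] := boolP (P i); last by apply: filterE.
by apply: filterS (open_nbhs_nbhs (conj (@open_dotp_gt (a i)) (xa i Pi))) => y.
Qed.

Lemma open_cone_cell : open (cone (cell a)).
Proof.
rewrite cone_cellE; have := @open_dotp_family xpredT; congr open.
by apply/seteqP; split=> x [x0 xa]; split=> // i; exact: xa.
Qed.

Lemma closure_cell x : closure (cell a) x ->
  @sphere R d x /\ forall i, 0 <= dotp (a i) x.
Proof.
move=> cx; split; first exact: (closed_sub_closure sphere_closed cell_sphere).
move=> i; apply: (closed_sub_closure (@closed_dotp_ge (a i)) _ cx).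
by move=> y [_ ya]; apply: ltW; exact: ya.
Qed.

Lemma closure_cell_boundary x : closure (cell a) x -> cell a x \/ boundary a x.
Proof.
move=> cx; have [xS xa] := closure_cell cx.
have [/forallP H|] := boolP [forall i, 0 < dotp (a i) x].
  by left; split=> // i _; exact: H.
rewrite negb_forall => /existsP[i]; rewrite -leNgt => H; right.
by exists i => //; split=> //; apply/eqP; rewrite eq_le H xa.
Qed.

Lemma compact_closure_cell : compact (closure (cell a)).
Proof.
apply: (subclosed_compact (@closed_closure _ _) (@sphere_compact R d)).
by move=> x /closure_cell[].
Qed.

Definition great_arc x y : set V := [set radial ((1 - t) *: x + t *: y) | t in `[0, 1]].

Lemma great_arc_connected x y : (forall t : R, 0 <= t <= 1 -> (1 - t) *: x + t *: y != 0) ->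
  connected (great_arc x y).
Proof.
move=> H; apply: connected_continuous_connected; first exact: segment_connected.
apply: continuous_in_subspaceT => t; rewrite inE /= in_itv /= => tI.
apply: (@continuous_comp _ _ _ (fun t : R => (1 - t) *: x + t *: y) (@radial R d)).
  have c1 : {for t, continuous (fun t : R => (1 - t) *: x)}.
    apply: (@continuous_comp _ _ _ (fun t : R => 1 - t) ( *:%R^~ x)).
      by apply: cvgB; [exact: cvg_cst|exact: cvg_id].
    exact: scalel_continuous.
  exact: (cvgD c1 (@scalel_continuous R V y t)).
exact: radial_cont (H t tI).
Qed.

Lemma great_arc_left x y : @sphere R d x -> great_arc x y x.
Proof.
move=> xS; exists 0; first by rewrite /= in_itv /= lexx ler01.
by rewrite subr0 scale1r scale0r addr0 radial_id.
Qed.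

Lemma great_arc_right x y : @sphere R d y -> great_arc x y y.
Proof.
move=> yS; exists 1; first by rewrite /= in_itv /= lexx ler01.
by rewrite subrr scale0r scale1r add0r radial_id.
Qed.

Lemma great_arc_neq0 x y : @sphere R d x -> @sphere R d y -> x != - y ->
  forall t : R, 0 <= t <= 1 -> (1 - t) *: x + t *: y != 0.
Proof.
move=> xS yS xy t /andP[t0 t1]; apply: contra_neq xy => E.
have {}E : (1 - t) *: x = - (t *: y) by apply/eqP; rewrite -addr_eq0 E.
have N : 1 - t = t.
  have := congr1 (@enorm R d) E; rewrite -[- (t *: y)]scaleNr !enormZ (sphere_enorm xS) (sphere_enorm yS).
  by rewrite normrN !mulr1 !ger0_norm ?subr_ge0.
have t2 : t != 0 by apply/eqP => H; move: N; rewrite H subr0 => /eqP; rewrite oner_eq0.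
by move: E; rewrite N -scalerN => /(scalerI t2).
Qed.

Lemma great_arc_cell x y : cell a x -> cell a y -> x != - y -> great_arc x y `<=` cell a.
Proof.
move=> [xS xa] [yS ya] xy _ [t tI <-]; rewrite /= in_itv /= in tI.
suff : cone (cell a) ((1 - t) *: x + t *: y) by [].
rewrite cone_cellE; split=> [|i]; first exact: great_arc_neq0.
have /andP[t0 t1] := tI; have xi : 0 < dotp (a i) x := xa i I; have yi : 0 < dotp (a i) y := ya i I.
rewrite dotpDr !dotpZr; have [->|tn] := eqVneq t 0; first by rewrite subr0 mul1r mul0r addr0.
apply: ltr_wpDl; first by rewrite mulr_ge0 ?subr_ge0// ltW.
by rewrite mulr_gt0// lt_def tn.
Qed.

(** Arcs from a base point suffice unless [y] is antipodal to it. No open half-space contains both,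
    so there is then no constraint, the cell is the whole sphere, and a detour through an orthogonal
    point [u] works. *)
Lemma cell_connected : (1 < d)%N -> connected (cell a).
Proof.
move=> d1; have [[x0 x0c]|] := pselect (cell a !=set0); last first.
  by move=> /set0P/negP; rewrite negbK => /eqP ->; exact: connected0.
pose P := [set C : set V | [/\ connected C, C `<=` cell a & C x0]].
have -> : cell a = \bigcup_(C in P) C.
  apply/seteqP; split=> [y yc|y [C [_ CC _] Cy]]; last exact: CC.
  have [x0S _] := x0c; have [yS _] := yc.
  have [xy|xy] := eqVneq x0 (- y); last first.
    exists (great_arc x0 y); last exact: great_arc_right.
    by split; [exact/great_arc_connected/great_arc_neq0|exact: great_arc_cell|exact: great_arc_left].
  have ci x : @sphere R d x -> cell a x.
    move=> xS; split=> // i _; have := x0c.2 i I; have := yc.2 i I.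
    rewrite /half_space /= xy dotpNr => p q.
    by move: q; rewrite oppr_gt0 => q; have := lt_trans p q; rewrite ltxx.
  have [w w0 pw] := exists_orthogonal d1 (sphere_neq0 x0S).
  pose u := radial w; have uS : @sphere R d u by exact: radial_sphere.
  have xu : dotp x0 u = 0 by rewrite dotpZr pw mulr0.
  have n1 : x0 != - u.
    by apply: contra_eq_neq xu => ->; rewrite dotpNl oppr_eq0; rewrite uS; exact: oner_neq0.
  have n2 : u != - y.
    rewrite -xy; apply: contra_eq_neq xu => ->.
    by rewrite x0S; exact: oner_neq0.
  exists (great_arc x0 u `|` great_arc u y); last by right; exact: great_arc_right.
  split; [|by rewrite subUset; split; apply: great_arc_cell => //; exact: ci|by left; exact: great_arc_left].
  apply: connectedU; [|exact/great_arc_connected/great_arc_neq0|exact/great_arc_connected/great_arc_neq0].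
  by exists u; split; [exact: great_arc_right|exact: great_arc_left].
apply: bigcup_connected; last by move=> C [].
by exists x0 => C [].
Qed.

(** The cell is open and closed in [A]: open as the trace of its cone, closed because a limit point
    outside it would lie on one of its hyperplanes, which miss [A]. *)
Lemma cell_component (A : set V) x0 : (1 < d)%N -> cell a `<=` A ->
  A `<=` @sphere R d -> (forall x i, A x -> dotp (a i) x != 0) -> cell a x0 ->
  cell a = connected_component A x0.
Proof.
move=> d1 cA AS Aa x0c; apply/seteqP; split.
  exact: connected_component_max x0c cA (cell_connected d1).
set C := connected_component _ _.
have CA : C `<=` A by exact: connected_component_sub.
have E : C `&` cell a = C.
  apply: (component_connected (A := A) (x := x0)).
  - by exists x0; split=> //; apply: connected_component_refl; exact: cA.
  - exists (cone (cell a)); first exact: open_cone_cell.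
    apply/seteqP; split=> x [Cx xc]; split=> //.
      by apply: cone_sphere_mem => //; exact: cell_sphere.
    by move: xc; rewrite /cone /= radial_id//; exact/AS/CA.
  - exists (closure (cell a)); first exact: closed_closure.
    apply/seteqP; split=> x [Cx xc]; split=> //; first exact: subset_closure.
    have [//|[i _ [xi _]]] := closure_cell_boundary xc.
    by have := Aa x i (CA x Cx); rewrite (xi : dotp (a i) x = 0) eqxx.
by move=> x Cx; have [] : (C `&` cell a) x by rewrite E.
Qed.

End Cell.

(* By minimality of r, dropping the i-th constraint enlarges the cell; join a point
   of the cell to a new point. *)
Lemma side_point r (a : 'I_r -> V) (i : 'I_r) : (1 < d)%N -> polyhedral a ->
  exists z, [/\ z != 0, dotp (a i) z = 0 & forall j, j != i -> 0 < dotp (a j) z].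
Proof.
case: r a i => [|r] a i d1 [[x xc] a0 amin]; first by case: i.
pose b (k : 'I_r) := a (lift i k).
have [y [yb ya]] : exists y, cell b y /\ ~ cell a y.
  apply: contrapT => H; have := amin r b (fun k => a0 _); rewrite ltnn.
  suff E : cell b = cell a by move=> /(_ E).
  apply/seteqP; split=> y yc; first by apply: contrapT => yn; apply: H; exists y.
  by split; [exact: yc.1|move=> k _; exact: yc.2].
have bj j z : j != i -> (forall k, 0 < dotp (b k) z) -> 0 < dotp (a j) z.
  by move=> ji H; case: (unliftP i j) => [k ->|jE]; [exact: H|rewrite jE eqxx in ji].
have yi : dotp (a i) y <= 0.
  rewrite leNgt; apply/negP => yi; apply: ya; split; first exact: yb.1.
  move=> j _; have [->|ji] := eqVneq j i; first exact: yi.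
  by apply: (bj j y ji) => k; exact: yb.2.
have xi : 0 < dotp (a i) x := xc.2 i I.
pose z := - dotp (a i) y *: x + dotp (a i) x *: y.
have zi : dotp (a i) z = 0 by rewrite dotpDr !dotpZr mulNr mulrC addNr.
have zj j : j != i -> 0 < dotp (a j) z.
  move=> ji; rewrite dotpDr !dotpZr; apply: ltr_wpDl.
    by rewrite mulr_ge0 ?oppr_ge0// ltW//; exact: xc.2.
  by rewrite mulr_gt0//; apply: (bj j y ji) => k; exact: yb.2.
(* By [zj], [z = 0] leaves no index other than [i]; any nonzero vector orthogonal to [a i] then
   serves. *)
have [z0|z0] := eqVneq z 0; last by exists z.
have [w w0 aw] := exists_orthogonal d1 (a0 i).
by exists w; split=> // j /zj; rewrite z0 dotp0r ltxx.
Qed.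

Lemma hyperplane_eq (u v : V) : u != 0 -> v != 0 -> hyperplane u = hyperplane v ->
  exists2 c : R, c != 0 & v = c *: u.
Proof.
move=> u0 v0 E; have uu := lt0r_neq0 (dotp_gt0 u0).
pose c := dotp u v / dotp u u; pose w := v - c *: u.
have uw : dotp u w = 0 by rewrite dotpBr dotpZr divfK// subrr.
have vw : dotp v w = 0.
  by have : hyperplane u w by []; rewrite E.
have : w == 0 by rewrite -dotp_eq0 {1}/w dotpBl dotpZl uw vw mulr0 subr0.
rewrite subr_eq0 => /eqP vE; exists c => //.
by apply: contra_neq v0 => c0; rewrite vE c0 scale0r.
Qed.

Lemma reflection_hyperplane (u : V) : u != 0 -> reflection (hyperplane u) = refl u.
Proof.
move=> u0; have [v0 vE] : normal (hyperplane u) != 0 /\ hyperplane u = hyperplane (normal (hyperplane u)).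
  by apply: (xgetPex 0 (P := [set b | b != 0 /\ hyperplane u = hyperplane b])); exists u.
have [c c0 nE] := hyperplane_eq u0 v0 vE.
by rewrite /reflection -/(refl _) nE reflZ.
Qed.

Lemma hyperplaneZ (c : R) (u : V) : c != 0 -> hyperplane (c *: u) = hyperplane u.
Proof.
move=> c0; apply/seteqP; split=> x; rewrite /hyperplane /= dotpZl.
  by move/eqP; rewrite mulf_eq0 (negbTE c0) => /eqP.
by move=> ->; rewrite mulr0.
Qed.

(** A ball of squared radius [e / 4] contains at most one point of [S], by the parallelogram law,
    and finitely many such balls cover the sphere. *)
Lemma finite_separated (S : set V) (e : R) : S `<=` @sphere R d -> 0 < e ->
  (forall x y, S x -> S y -> dotp (x - y) (x - y) < e -> x = y) -> finite_set S.
Proof.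
move=> SS e0 sep; have := @sphere_compact R d; rewrite compact_cover => C.
pose f (c : V) := [set x : V | dotp (x - c) (x - c) < e / 4].
have fE c : f c = (fun x : V => dotp x x - (2 * dotp c x - dotp c c)) @^-1` [set t | t < e / 4].
  apply/seteqP; split=> x; rewrite /f /= dotpBl !dotpBr [dotp x c]dotpC => H;
    by move: H; congr (_ < _); ring.
have [||D' D'S cov] := C V (@sphere R d) f.
- move=> c _; rewrite fE; apply: open_comp; last exact: open_lt.
  move=> x _; suff H : Ck 0 setT (fun x : V => dotp x x - (2 * dotp c x - dotp c c)).
    exact: (Ck_cont H).
  apply: (CkB openT (Ck_sqnorm _ openT)).
  exact: (CkB openT (CkZ _ openT (Ck_dotp _ _ _)) (Ck_cst _ _ _)).
- by move=> x xS; exists x => //; rewrite /f /= subrr dotp0l divr_gt0.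
apply: (@sub_finite_set _ _ (\bigcup_(c in [set` D']) (S `&` f c))).
  by move=> x Sx; have [c Dc fc] := cov x (SS x Sx); exists c.
apply: bigcup_finite => // c _.
have [[x [Sx fx]]|] := pselect (S `&` f c !=set0); last first.
  by move=> /set0P/negP; rewrite negbK => /eqP ->.
apply: (@sub_finite_set _ _ [set x]) => // y [Sy fy] /=.
apply: sep => //; have := dotp_ge0 (y - c + (x - c)); move: fx fy; rewrite /f /=.
have -> : y - x = (y - c) - (x - c) by rewrite opprB addrA subrK.
move: (y - c) (x - c) => u v; rewrite !(dotpBl, dotpBr, dotpDl, dotpDr) (dotpC v u).
lra.
Qed.

End Cells.

(** * From nodal domains to Coxeter arrangements *)

Section Forward.
Variables (R : realType) (d : nat).
Local Notation V := 'rV[R]_d.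
Implicit Types (x y z v w n c : V) (g h : 'M[R]_d).

Section OddNormals.
Variable F : V -> R.

(* The arrangement attached to F consists of the hyperplanes whose reflection changes
   the sign of F. *)
Definition odd_normal n := dotp n n = 1 /\ forall x, x != 0 -> F (x *m refl n) = - F x.

Definition sign_invariant g := g *m g^T = 1%:M /\
  exists2 e : R, e * e = 1 & forall x, x != 0 -> F (x *m g) = e * F x.

Lemma odd_normal_neq0 n : odd_normal n -> n != 0.
Proof. by move=> [nn _]; apply: sphere_neq0. Qed.

Lemma odd_normal_vanish n x : odd_normal n -> x != 0 -> dotp n x = 0 -> F x = 0.
Proof.
move=> [nn H] x0 nx; have := H x x0; rewrite refl_fix 1?dotpC// => /eqP.
by rewrite -addr_eq0 -mulr2n mulrn_eq0 => /eqP.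
Qed.

Lemma orth_trmx g : g *m g^T = 1%:M -> g^T *m (g^T)^T = 1%:M.
Proof. by move=> gO; rewrite trmxK; exact: mulmx1C. Qed.

Lemma orth_invmx g : g *m g^T = 1%:M -> invmx g = g^T.
Proof.
move=> gO; have [gu _] := mulmx1_unit gO.
by rewrite -[RHS](mulKmx gu) gO mulmx1.
Qed.

Lemma refl_orth_conj n g x : g *m g^T = 1%:M ->
  x *m refl (n *m g) = x *m g^T *m refl n *m g.
Proof.
move=> gO; rewrite !mulmx_refl mulmxBl -mulmxA (mulmx1C gO) mulmx1 -scalemxAl.
rewrite !dotp_mulmx -mulmxA gO mulmx1; congr (_ - (_ * _) *: _).
by rewrite -{1}[g]trmxK dotpC dotp_mulmx dotpC.
Qed.

(** The reflection in [n *m g] is the conjugate by [g] of that in [n]; the sign of [g] enters twice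
    and cancels. *)
Lemma odd_normal_mulmx n g : odd_normal n -> sign_invariant g -> odd_normal (n *m g).
Proof.
move=> [nn H] [gO [e ee Hg]]; split; first by rewrite dotp_mulmx -mulmxA gO mulmx1.
have n0 : n != 0 by apply: sphere_neq0.
move=> x x0; rewrite refl_orth_conj//.
have x1 : x *m g^T != 0 by rewrite (orth_neq0 (orth_trmx gO)).
rewrite Hg ?(orth_neq0 (refl_orth n0))//.
rewrite H// mulrN; congr (- _).
by rewrite -Hg// -mulmxA (mulmx1C gO) mulmx1.
Qed.

Lemma odd_normalN n : odd_normal n -> odd_normal (- n).
Proof.
move=> [nn H]; split; first by rewrite dotpNl dotpNr opprK.
by rewrite -scaleN1r reflZ// oppr_eq0 oner_neq0.
Qed.

Lemma odd_normal_sign_invariant n : odd_normal n -> sign_invariant (refl n).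
Proof.
move=> nO; split; first exact/refl_orth/odd_normal_neq0.
by exists (- 1) => [|x x0]; [rewrite mulrNN mulr1|rewrite nO.2// mulN1r].
Qed.

Lemma sign_invariant_subgroup : orthogonal_subgroup (sign_invariant : set 'M[R]_d).
Proof.
split.
- by move=> g [].
- split; first by rewrite trmx1 mulmx1.
  by exists 1 => [|x x0]; rewrite ?mulr1// mulmx1 mul1r.
- move=> g h [gO [e ee Hg]] [hO [e' ee' Hh]]; split.
    by rewrite trmx_mul mulmxA -(mulmxA g) hO mulmx1.
  exists (e' * e) => [|x x0]; first by rewrite mulrACA ee' ee mulr1.
  by rewrite mulmxA Hh ?orth_neq0// Hg// mulrA.
- move=> g [gO [e ee Hg]]; rewrite orth_invmx//; split; first exact: orth_trmx.
  exists e => // x x0.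
  have x1 : x *m g^T != 0 by rewrite (orth_neq0 (orth_trmx gO)).
  by rewrite -{2}[x]mulmx1 -(mulmx1C gO) mulmxA Hg// mulrA ee mul1r.
Qed.

Definition odd_hyperplanes : set (set V) := [set hyperplane n | n in odd_normal].

Lemma coxeter_sub (L : set (set V)) (Q : set 'M[R]_d) : orthogonal_subgroup Q ->
  (forall H, L H -> Q (reflection H)) -> coxeter_group L `<=` Q.
Proof.
move=> sQ LQ g; apply; split=> // _ [H LH <-]; exact: LQ.
Qed.

Lemma odd_coxeter_sub : coxeter_group odd_hyperplanes `<=` sign_invariant.
Proof.
apply: coxeter_sub; first exact: sign_invariant_subgroup.
move=> _ [n nO <-]; rewrite reflection_hyperplane; last exact: odd_normal_neq0.
exact: odd_normal_sign_invariant.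
Qed.

Lemma image_hyperplane n g : g *m g^T = 1%:M ->
  [set x *m g | x in hyperplane n] = hyperplane (n *m g).
Proof.
move=> gO; apply/seteqP; split=> [_ [x nx <-]|x nx].
  by rewrite /hyperplane /= dotp_mulmx -mulmxA gO mulmx1.
exists (x *m g^T); last by rewrite -mulmxA (mulmx1C gO) mulmx1.
by move: nx; rewrite /hyperplane /= dotp_mulmx.
Qed.

Lemma odd_acts_on : acts_on (coxeter_group odd_hyperplanes) odd_hyperplanes.
Proof.
move=> g _ /odd_coxeter_sub gS [n nO <-]; rewrite image_hyperplane; last exact: gS.1.
by exists (n *m g) => //; exact: odd_normal_mulmx.
Qed.

(* Two distinct close normals a, b in this set would generate, by iterated
   reflections, normals c_m turning by a small fixed angle in the plane spanned by a
   and b, so that <c_m, z> would eventually become small or change sign by a small step. *)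
Lemma odd_normal_separated z (eta : R) : 0 < eta -> dotp z z = 1 ->
  (forall c, odd_normal c -> eta <= `|dotp c z|) ->
  forall a b, odd_normal a -> odd_normal b ->
    dotp (a - b) (a - b) < 4 * eta ^+ 2 -> a = b.
Proof.
move=> eta0 zz Hz a b aO bO ab; apply/eqP; rewrite -subr_eq0 -dotp_eq0.
apply/eqP/le_anti; rewrite dotp_ge0 andbT leNgt; apply/negP => ab0.
pose s := dotp a b; pose k := 2 - 2 * s.
have abE : dotp (a - b) (a - b) = k.
  by rewrite dotpBl !dotpBr aO.1 bO.1 [dotp b a]dotpC /k /s; ring.
rewrite abE in ab ab0.
(* Runs through pairs of consecutive normals: the next normal is minus the reflection of the first
   in the second. *)
pose T (p : V * V) := (p.2, (2 * s) *: p.2 - p.1).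
pose P m := iter m T (a, b).
have PI m : [/\ odd_normal (P m).1, odd_normal (P m).2 & dotp (P m).1 (P m).2 = s].
  elim: m => [|m [N1 N2 E]] //=; split=> //.
    have -> : (2 * s) *: (P m).2 - (P m).1 = - ((P m).1 *m refl (P m).2).
      by rewrite mulmx_refl N2.1 divr1 E opprB.
    by apply/odd_normalN/odd_normal_mulmx => //; exact: odd_normal_sign_invariant.
  by rewrite dotpBr dotpZr N2.1 [dotp (P m).2 _]dotpC E; ring.
have [e [ee e0]] : exists e : R, e * e = 1 /\ eta <= e * dotp a z.
  have := Hz a aO; case: (lerP 0 (dotp a z)) => H.
    by rewrite ger0_norm// => H1; exists 1; rewrite !mul1r.
  by rewrite ltr0_norm// => H1; exists (- 1); rewrite mulrNN mulr1 mulN1r.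
pose y m := e * dotp (P m).1 z.
have yS m : y m.+1 = e * dotp (P m).2 z by [].
have yabs m : eta <= `|y m|.
  rewrite /y normrM; have -> : `|e| = 1.
    by apply/eqP; rewrite -(@pexpr_eq1 _ _ 2)//; rewrite -normrX expr2 ee normr1.
  by rewrite mul1r; apply: Hz; case: (PI m).
(* Consecutive normals are less than [2 * eta] apart, so by Cauchy-Schwarz [y] cannot jump over the
   gap from [- eta] to [eta]. *)
have step m : `|y m.+1 - y m| < 2 * eta.
  rewrite -ltr_sqr ?nnegrE//; last by rewrite mulr_ge0// ltW.
  rewrite real_normK ?num_real// yS -mulrBr -dotpBl exprMn expr2 ee mul1r.
  have [N1 N2 E] := PI m.
  apply: le_lt_trans (CauchySchwarz _ _) _; rewrite zz mulr1.
  rewrite dotpBl !dotpBr N1.1 N2.1 [dotp (P m).2 _]dotpC E.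
  by move: ab; rewrite /k; nra.
have ypos m : eta <= y m.
  elim: m => [|m IH] //; have := yabs m.+1; have := step m.
  rewrite ltr_norml => /andP[H1 H2]; case: (lerP 0 (y m.+1)) => H.
    by rewrite ger0_norm.
  by rewrite ltr0_norm// => H3; exfalso; lra.
have rec m : y m.+2 = 2 * s * y m.+1 - y m.
  by rewrite /y /= dotpBl dotpZl; ring.
(* By [rec] the second differences are [- k * y m.+1], at most [- k * eta]: the increments fall at
   least linearly, in the end below [- 2 * eta], against [step]. *)
have conc m : y m.+1 - y m <= y 1%N - y 0%N - m%:R * (k * eta).
  elim: m => [|m IH]; first by rewrite mul0r subr0.
  have : k * eta <= k * y m.+1 by rewrite ler_wpM2l// ltW.
  by move: IH; rewrite rec -natr1 /k; lra.
have ke : 0 < k * eta by rewrite mulr_gt0.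
pose N := (Num.truncn ((y 1%N - y 0%N + 2 * eta) / (k * eta))).+1.
have : y 1%N - y 0%N + 2 * eta < N%:R * (k * eta).
  by rewrite -ltr_pdivrMr// truncnS_gt.
have := conc N; have := step N; rewrite ltr_norml => /andP[+ _]; lra.
Qed.

Lemma finite_coxeter : finite_set (odd_normal : set V) ->
  finite_set (coxeter_group odd_hyperplanes).
Proof.
move=> /finite_seqP[s sE].
have memP n : odd_normal n <-> n \in s by rewrite [odd_normal n](congr1 (fun A => A n) sE).
pose W := coxeter_group odd_hyperplanes.
pose m := size s.
pose agree (f : {ffun 'I_m -> 'I_m}) g := W g /\
  forall i : 'I_m, nth 0 s i *m g = nth 0 s (f i).
have uniq g h : W g -> W h -> (forall n, odd_normal n -> n *m g = n *m h) -> g = h.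
  move=> Wg Wh gh; apply/row_matrixP => i; rewrite !rowE; set x := delta_mx 0 i.
  have [gO _] := odd_coxeter_sub Wg; have [hO _] := odd_coxeter_sub Wh.
  pose z := x *m g - x *m h.
  have zN n : odd_normal n -> dotp z n = 0.
    move=> nO; have n1 : odd_normal (n *m g^T).
      apply: (odd_normal_mulmx nO).
      by have [_ _ _ H] := sign_invariant_subgroup; rewrite -orth_invmx//; exact/H/odd_coxeter_sub.
    have ng : n = n *m g^T *m g by rewrite -mulmxA (mulmx1C gO) mulmx1.
    rewrite /z dotpBl [in X in X - _]ng [in X in _ - X]ng [in X in _ - X]gh//.
    by rewrite !dotp_mulmx -!mulmxA gO hO !mulmx1 subrr.
  (* The normals need not span. But [z], orthogonal to all of them, is fixed by every generator,
     hence by [W], and so [<z, z> = <x g, z> - <x h, z> = <x, z> - <x, z> = 0]. *)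
  pose Q := [set k : 'M[R]_d | k *m k^T = 1%:M /\ z *m k = z].
  have WQ : W `<=` Q.
    apply: coxeter_sub; last first.
      move=> _ [n nO <-]; have n0 := odd_normal_neq0 nO; rewrite reflection_hyperplane//.
      by split; [exact: refl_orth|rewrite refl_fix// zN].
    split.
    - by move=> k [].
    - by split; rewrite ?trmx1 mulmx1.
    - move=> k l [kO kz] [lO lz]; split; last by rewrite mulmxA kz.
      by rewrite trmx_mul mulmxA -(mulmxA k) lO mulmx1.
    - move=> k [kO kz]; rewrite orth_invmx//; split; first exact: orth_trmx.
      by rewrite -{1}kz -mulmxA kO mulmx1.
  have [_ zg] := WQ g Wg; have [_ zh] := WQ h Wh.
  apply/eqP; rewrite -subr_eq0 -/z -dotp_eq0 {1}/z dotpBl -{1}zg -{2}zh.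
  by rewrite !dotp_mulmx -!mulmxA gO hO !mulmx1 subrr.
(* By [uniq] each self-map of the indices is realised by at most one element of [W]; [xget] names
   it, with the value 0 for the maps realised by none. *)
apply: (@sub_finite_set _ _ [set xget 0 (agree f) | f in [set: {ffun 'I_m -> 'I_m}]]); last first.
  exact: finite_image.
move=> g Wg; have gS := odd_coxeter_sub Wg.
have idx (i : 'I_m) : (index (nth 0%R s i *m g) s < m)%N.
  by rewrite index_mem -memP; apply: odd_normal_mulmx => //; apply/memP/mem_nth.
pose f : {ffun 'I_m -> 'I_m} := [ffun i => Ordinal (idx i)].
exists f => //; have ag : agree f g.
  split=> // i; rewrite ffunE /= nth_index//.
  by rewrite -memP; apply: odd_normal_mulmx => //; apply/memP/mem_nth.
have [Wh ah] := xgetPex 0 (ex_intro _ g ag).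
apply: uniq => // n /memP ns; have ni : (index n s < m)%N by rewrite index_mem.
have := ah (Ordinal ni); have := ag.2 (Ordinal ni); rewrite /= nth_index// => <- <- //.
Qed.

End OddNormals.

Lemma nodal_arrangement r (a : 'I_r -> V) : (1 < d)%N -> polyhedral a -> nodal a ->
  exists L, coxeter_arrangement (cell a) L.
Proof.
move=> d1 pa [mu [phi [sphi pos bd]]]; have eF := eigen0_ext sphi.
set F := ext phi in eF; have [CF hF _] := eF; have [[x0 x0c] an0 _] := pa.
have Fpos x : cone (cell a) x -> 0 < F x by move=> xc; exact: pos.
have x0S := cell_sphere x0c.
(* Inside [O] only the constraint [a i] can fail: points of its hyperplane there are limits of
   points of the cone over the cell, so [F] vanishes at them. *)
have sides i : odd_normal F (radial (a i)).
  have nn : dotp (radial (a i)) (radial (a i)) = 1 by exact: radial_sphere (an0 i).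
  split=> //; have [z [z0 zi zj]] := side_point i d1 pa.
  pose O := [set x : V | x != 0 /\ forall j, j != i -> 0 < dotp (a j) x].
  have rz y : dotp (radial (a i)) y = 0 -> dotp (a i) y = 0.
    rewrite dotpZl => /eqP; rewrite mulf_eq0 invr_eq0 enorm_eq0 (negbTE (an0 i)) => /eqP //.
  apply: (eigen0_odd d1 nn (@open_dotp_family R d r a (fun j => j != i)) _ eF _ (z := z)).
  - by move=> y [].
  - move=> y [y0 yj] /rz yi; apply: bd; exists i => //; split.
      by rewrite /hyperplane /= dotpZr yi mulr0.
    move=> B nB.
    have /(near_line x0)[e e0 He] : \forall u \near y, B (radial u) by exact: (radial_cont y0 nB).
    (* Moving from [y] in the direction of [x0] makes every constraint strict. *)
    exists (radial (y + (e / 2) *: x0)); split; last first.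
      by apply: He; rewrite gtr0_norm ?divr_gt0//; lra.
    suff : cone (cell a) (y + (e / 2) *: x0) by [].
    have pj j : 0 < dotp (a j) (y + (e / 2) *: x0).
      have pj : 0 < e / 2 * dotp (a j) x0 by rewrite mulr_gt0 ?divr_gt0//; exact: x0c.2.
      rewrite dotpDr dotpZr; have [->|ji] := eqVneq j i; last by rewrite addr_gt0// yj.
      by rewrite yi add0r mulr_gt0 ?divr_gt0//; exact: x0c.2.
    rewrite cone_cellE; split=> //; apply/eqP => E.
    by have := pj i; rewrite E dotp0r ltxx.
  - by [].
  - by rewrite dotpZl zi mulr0.
have x0C : cone (cell a) x0 by apply: cone_sphere_mem => //; exact: cell_sphere.
(* If [c] were almost orthogonal to [x0], the projection of [x0] to the hyperplane of [c] would
   still lie in the cone, and [F] would be both positive and 0 there. *)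
have [eta eta0 Heta] : exists2 eta : R, 0 < eta & forall c, odd_normal F c -> eta <= `|dotp c x0|.
  have /nearP[e e0 He] := open_nbhs_nbhs (conj (@open_cone_cell R d r a) x0C).
  exists e => // c cO; rewrite leNgt; apply/negP => ce.
  have C : cone (cell a) (x0 + - dotp c x0 *: c).
    apply: He; rewrite normrZ normrN; apply: le_lt_trans ce.
    by rewrite -[leRHS]mulr1 ler_wpM2l// sphere_norm_le1//; exact: cO.1.
  have := Fpos _ C; rewrite (odd_normal_vanish cO) ?ltxx//.
    by apply: (cone_sub (@cell_sphere R d r a)).
  by rewrite dotpDr dotpZr cO.1 mulr1 subrr.
have finN : finite_set (odd_normal F : set V).
  apply: (@finite_separated R d _ (4 * eta ^+ 2)); first by move=> n [].
    by rewrite mulr_gt0// exprn_gt0.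
  by move=> x y xO yO; exact: (odd_normal_separated eta0 x0S Heta).
exists (odd_hyperplanes F); split.
- exact: finite_image.
- by move=> _ [n nO <-]; exists n => //; exact: odd_normal_neq0 nO.
- have cA : cell a `<=` @sphere R d `\` \bigcup_(H in odd_hyperplanes F) H.
    move=> x xc; have xS := cell_sphere xc; split=> // -[_ [n nO <-] nx].
    have := pos x xc; have -> : phi x = F x by rewrite /F /ext /= radial_id.
    by rewrite (odd_normal_vanish nO) ?ltxx//; exact: sphere_neq0.
  exists x0; first exact: cA.
  apply: (cell_component d1 cA _ _ x0c) => [x []//|x i [_ xL]].
  apply/eqP => xi; apply: xL; exists (hyperplane (radial (a i))).
    by exists (radial (a i)) => //; exact: sides.
  by rewrite /hyperplane /= dotpZl xi mulr0.
- exact: finite_coxeter.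
- exact: odd_acts_on.
Qed.

End Forward.

(** * From Coxeter arrangements to nodal domains *)

Section RootSystems.
Variables (R : realType) (d : nat).
Local Notation V := 'rV[R]_d.
Implicit Types (x y z v w n : V) (O : set V).

(** The hyperplanes are avoided one at a time: a small move along [w] leaves the hyperplane of [w],
    whose complement is open. *)
Lemma generic_dense (s : seq V) O x : (forall w, w \in s -> w != 0) -> open O -> O x ->
  exists2 v, O v & forall w, w \in s -> dotp w v != 0.
Proof.
elim: s O x => [|w s IH] O x s0 oO Ox; first by exists x.
pose O' := O `&` [set v | dotp w v != 0].
have oO' : open O'.
  apply: openI => //.
  have -> : [set v | dotp w v != 0] = dotp w @^-1` [set t | t != 0] by [].
  by apply: open_comp => [y _|]; [exact: dotp_cont|exact: open_neq].
have [y Oy] : exists y, O' y.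
  have [wx|wx] := eqVneq (dotp w x) 0; last by exists x.
  have [r r0 rO] := near_line w (open_nbhs_nbhs (conj oO Ox)).
  exists (x + (r / 2) *: w); split; first by apply: rO; rewrite gtr0_norm ?divr_gt0//; lra.
  rewrite /= dotpDr dotpZr wx add0r mulf_neq0 ?gt_eqF ?divr_gt0//.
  by apply: dotp_gt0; apply: s0; rewrite mem_head.
have [|v [Ov wv] sv] := IH O' y _ oO' Oy.
  by move=> u us; apply: s0; rewrite inE us orbT.
by exists v => // u; rewrite inE => /predU1P[->|/sv].
Qed.

Section Roots.
Variables (k : nat) (b : 'I_k -> V).

(** One unit root from each opposite pair; [c] is the sign lost by this choice. *)
Definition root_family :=
  [/\ forall i, dotp (b i) (b i) = 1,
      forall i j, hyperplane (b i) = hyperplane (b j) -> i = j &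
      forall i j, exists j' : 'I_k, exists2 c : R, c * c = 1 & b j *m refl (b i) = c *: b j'].

Hypothesis bP : root_family.

Let bn0 i : b i != 0.
Proof. by case: bP => b1 _ _; apply: sphere_neq0; exact: b1. Qed.

Lemma root_family_indep i j (s t : R) : i != j -> s != 0 -> s *: b j - t *: b i != 0.
Proof.
case: bP => b1 binj _ ij s0; apply/eqP => /eqP; rewrite subr_eq0 => /eqP E.
have bj : b j = (s^-1 * t) *: b i by rewrite -scalerA -E scalerA mulVf// scale1r.
have c0 : s^-1 * t != 0.
  by have := bn0 j; rewrite bj; apply: contra_neq => ->; rewrite scale0r.
by move/eqP: ij; apply; apply: binj; rewrite bj hyperplaneZ.
Qed.

(* The reflection in b i permutes the other roots up to sign and fixes y, while it
   changes the sign of b i: the sum is its own opposite. *)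
Lemma root_sum_wall i y : dotp (b i) y = 0 -> (forall j, j != i -> dotp (b j) y != 0) ->
  \sum_(j | j != i) dotp (b i) (b j) / dotp (b j) y = 0.
Proof.
move=> yi yj; have [b1 binj bact] := bP.
have /choice[p pP] : forall j : 'I_k, exists j' : 'I_k, exists2 c : R, c * c = 1 &
   b j *m refl (b i) = c *: b j' := bact i.
have cn0 (c : R) : c * c = 1 -> c != 0.
  by move=> cc; apply/eqP => c0; move/eqP: cc; rewrite c0 mul0r eq_sym oner_eq0.
have pinj : injective p.
  move=> j j' E; have [c cc jE] := pP j; have [c' cc' jE'] := pP j'.
  apply: binj; have : b j = (c * c') *: b j'.
    rewrite -[b j](reflK _ (bn0 i)) jE E -[b (p j')]scale1r -cc' -scalerA -jE'.
    by rewrite scalerA -scalemxAl reflK.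
  by move=> ->; rewrite hyperplaneZ// mulf_neq0// cn0.
have pi : p i = i.
  have [c cc iE] := pP i; apply: binj; move: iE; rewrite refl_self// => /eqP.
  rewrite eqr_oppLR => /eqP ->; rewrite -scaleNr hyperplaneZ// oppr_eq0; exact: cn0.
set S := \sum_(j | _) _.
have : S = - S.
  rewrite {1}/S (reindex_inj pinj) /S -sumrN; apply: eq_big => [j|j].
    by rewrite -{1}pi (inj_eq pinj).
  rewrite -{1}pi (inj_eq pinj) => ji; have [c cc jE] := pP j.
  have pE : b (p j) = c *: (b j *m refl (b i)) by rewrite jE scalerA cc scale1r.
  rewrite pE !(dotpZr, dotpZl) -dotp_refl refl_self// dotpNl dotp_refl refl_fix 1?dotpC//.
  by field; rewrite (cn0 c cc) yj.
by move/eqP; rewrite -addr_eq0 -mulr2n mulrn_eq0 => /eqP.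
Qed.

(* On the line x + t v, for generic v, this is a polynomial in t of degree at most
   k - 2 which vanishes at the k distinct points where the line meets the walls. *)
Lemma root_sum_poly x : (forall j, dotp (b j) x != 0) ->
  \sum_i \sum_(j | j != i) dotp (b i) (b j) *
     \prod_(m | (m != i) && (m != j)) dotp (b m) x = 0.
Proof.
move=> xb; have [b1 binj bact] := bP.
(* The first list keeps [v] off the walls, so that the line meets each of them at one parameter
   [t i]; the second makes these parameters distinct. *)
pose s := [seq b i | i : 'I_k] ++
  [seq dotp (b ij.1) x *: b ij.2 - dotp (b ij.2) x *: b ij.1 |
    ij <- [seq ij <- enum {: 'I_k * 'I_k} | ij.1 != ij.2]].
have s0 w : w \in s -> w != 0.
  rewrite mem_cat => /orP[/mapP[i _ ->] //|/mapP[[i j]]].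
  by rewrite mem_filter /= => /andP[ij _] ->; exact: root_family_indep.
have [v _ vs] := generic_dense s0 openT (I : setT (0 : V)).
have vb i : dotp (b i) v != 0.
  by apply: vs; rewrite mem_cat; apply/orP; left; apply/mapP; exists i; rewrite ?mem_enum.
have vij i j : i != j -> dotp (b i) x * dotp (b j) v - dotp (b j) x * dotp (b i) v != 0.
  move=> ij; rewrite -!dotpZl -dotpBl; apply: vs; rewrite mem_cat; apply/orP; right.
  by apply/mapP; exists (i, j) => //; rewrite mem_filter /= ij mem_enum.
pose L m : {poly R} := (dotp (b m) x)%:P + (dotp (b m) v) *: 'X.
have LE m t : (L m).[t] = dotp (b m) (x + t *: v).
  by rewrite !hornerE dotpDr dotpZr mulrC.
pose p : {poly R} := \sum_i \sum_(j | j != i) dotp (b i) (b j) *: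
     \prod_(m | (m != i) && (m != j)) L m.
have pE t : p.[t] = \sum_i \sum_(j | j != i) dotp (b i) (b j) *
     \prod_(m | (m != i) && (m != j)) dotp (b m) (x + t *: v).
  rewrite horner_sum; apply: eq_bigr => i _; rewrite horner_sum; apply: eq_bigr => j _.
  by rewrite hornerZ horner_prod; congr (_ * _); apply: eq_bigr => m _; rewrite LE.
suff p0 : p = 0.
  have := pE 0; rewrite p0 horner0 => /esym; under eq_bigr do under eq_bigr do
    under eq_bigr do rewrite scale0r addr0.
  by [].
pose t i := - (dotp (b i) x / dotp (b i) v).
have ti i : dotp (b i) (x + t i *: v) = 0.
  by rewrite dotpDr dotpZr /t mulNr divfK// subrr.
have tij i j : j != i -> dotp (b j) (x + t i *: v) != 0.
  move=> ji; apply: contra_neq (vij j i ji) => E.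
  have : (dotp (b j) (x + t i *: v)) * dotp (b i) v = 0 by rewrite E mul0r.
  rewrite dotpDr dotpZr /t mulrDl => <-; field; exact: vb.
apply: (@roots_geq_poly_eq0 _ p [seq t i | i : 'I_k]).
- apply/allP => _ /mapP[i _ ->]; apply/rootP; rewrite pE.
  set y := x + t i *: v; have W := root_sum_wall (ti i) (@tij i).
  rewrite -/y in W; pose l m := dotp (b m) y.
  have li : l i = 0 by exact: ti.
  have lj j : j != i -> l j != 0 by exact: tij.
  have PE j : j != i -> \prod_(m | (m != i) && (m != j)) l m =
      (\prod_(m | m != i) l m) / l j.
    move=> ji; rewrite [in RHS](bigD1 j)//= mulrC mulKf ?lj//.
  (* A product omitting neither index [i] contains [l i = 0]. The terms with [i] first and those
     with [i] second survive, forming two equal sums, each a multiple of the one in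
     [root_sum_wall]. *)
  have Z i' j : i' != i -> j != i -> \prod_(m | (m != i') && (m != j)) l m = 0.
    by move=> i'i ji; rewrite (bigD1 i) /= ?li ?mul0r// eq_sym i'i eq_sym ji.
  have H1 : \sum_(j | j != i) dotp (b i) (b j) * \prod_(m | (m != i) && (m != j)) l m = 0.
    rewrite (eq_bigr (fun j => (\prod_(m | m != i) l m) * (dotp (b i) (b j) / l j))).
      by rewrite -mulr_sumr W mulr0.
    by move=> j ji; rewrite PE//; ring.
  rewrite (bigD1 i)//= H1 add0r; rewrite -[RHS]H1; apply: eq_bigr => i' i'i.
  rewrite (bigD1 i) /= 1?eq_sym// [X in _ + X]big1 ?addr0 => [|j /andP[_ ji]].
    rewrite dotpC; congr (_ * _); apply: eq_bigl => m; exact: andbC.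
  by rewrite Z// mulr0.
- rewrite map_inj_uniq ?enum_uniq// => i j E; apply/eqP; apply: contraT => ij.
  by have := tij j i ij; rewrite -E ti eqxx.
rewrite size_map size_enum_ord.
apply: leq_trans (size_sum _ _ _) _; apply/bigmax_leqP => i _.
apply: leq_trans (size_sum _ _ _) _; apply/bigmax_leqP => j ji.
apply: leq_trans (size_scale_leq _ _) _; apply: leq_trans (size_poly_prod_leq _ _) _.
have LS m : (size (L m) <= 2)%N.
  apply: leq_trans (size_polyD _ _) _; rewrite geq_max; apply/andP; split.
    by apply: leq_trans (size_polyC_leq1 _) _.
  by apply: leq_trans (size_scale_leq _ _) _; rewrite size_polyX.
pose A := [pred m | (m != i) && (m != j)].
change ((\sum_(m | A m) size (L m)).+1 - #|A| <= k)%N.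
have SA : (\sum_(m | A m) size (L m) <= #|A| * 2)%N.
  rewrite -sum_nat_const [leqRHS](eq_bigl A)//.
  by apply: leq_sum => m _; exact: LS.
have : (#|A| + 2 = k)%N.
  rewrite -[RHS](card_ord k) -(cardC A); congr (_ + _)%N.
  have -> : #|[predC A]| = #|pred2 i j|.
    by apply: eq_card => m; rewrite !inE negb_and !negbK.
  by rewrite card2 eq_sym ji.
by lia.
Qed.

(** With P the product of the forms, the two sides are |grad log P|^2 and - lap (log |P|), so the
    equality says that P is harmonic. It is [root_sum_poly] divided by P. *)
Lemma root_sum_sqr x : (forall j, dotp (b j) x != 0) ->
  dotp (\sum_i (dotp (b i) x)^-1 *: b i) (\sum_i (dotp (b i) x)^-1 *: b i) =
  \sum_i (dotp (b i) x) ^- 2.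
Proof.
move=> xb; have H := root_sum_poly xb; have [b1 _ _] := bP.
pose l m := dotp (b m) x; pose P := \prod_m l m.
have P0 : P != 0 by apply/prodf_neq0 => m _; exact: xb.
have {}H : \sum_i \sum_(j | j != i) dotp (b i) (b j) / (l i * l j) = 0.
  apply: (mulfI P0); rewrite mulr0 -[RHS]H mulr_sumr; apply: eq_bigr => i _.
  rewrite mulr_sumr; apply: eq_bigr => j ji.
  rewrite /P (bigD1 i)//= (bigD1 j) //=.
  have -> : \prod_(m | (m != i) && (m != j)) dotp (b m) x =
    \prod_(m | (m != i) && (m != j)) l m by [].
  by field; rewrite !xb.
transitivity (\sum_i (l i ^- 2 + \sum_(j | j != i) dotp (b i) (b j) / (l i * l j))); last first.
  by rewrite big_split /= H addr0.
rewrite dotp_suml; apply: eq_bigr => i _ /=.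
rewrite dotpZl [dotp (b i) (\sum_(_ <- _) _)]dotpC dotp_suml (bigD1 i)//= mulrDr dotpZl b1 mulr1 -/(l i) -invfM -expr2.
congr (_ + _); rewrite mulr_sumr; apply: eq_bigr => j ji.
by rewrite dotpZl [dotp (b j) (b i)]dotpC -/(l j) invfM; ring.
Qed.

End Roots.
End RootSystems.

(** * The product of the root forms as an eigenfunction *)

Section RootProduct.
Variables (R : realType) (d : nat).
Local Notation V := 'rV[R]_d.
Local Notation e j := (e_ R j).
Local Notation A0 := (@punctured R d).
Local Notation oA := (@open_punctured R d).
Implicit Types (x y z v w n : V) (F : V -> R).

Lemma ext_dotpE n : ext (dotp n) = (fun x => rho x * dotp n x).
Proof. by apply/funext => x; rewrite /ext /= dotpZr. Qed.

Lemma Ck_ext_dotp k n : Ck k A0 (ext (dotp n)).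
Proof. by rewrite ext_dotpE; apply: (CkM oA (Ck_rho R d _)); exact: Ck_dotp. Qed.

Lemma rho_sphere x : @sphere R d x -> rho x = 1.
Proof. by move=> xS; rewrite /rho sphere_enorm// invr1. Qed.

Lemma derive_ext_dotp n x v : @sphere R d x ->
  'D_v (ext (dotp n)) x = dotp n v - dotp n x * dotp v x.
Proof.
move=> xS; have Ax : A0 x := sphere_neq0 xS.
rewrite ext_dotpE (deriveMf v oA (Ck_rho R d 1) (Ck_dotp 1 A0 n) Ax) derive_dotp.
by have [_ ->] := is_derive_rho v Ax; rewrite rho_sphere// expr1n; ring.
Qed.

(** The case s = -1 of lap |x|^s = s (s + d - 2) |x|^(s - 2). *)
Lemma lap_rho x : @sphere R d x -> lap (@rho R d) x = 3 - d%:R.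
Proof.
move=> xS; have Ax : A0 x := sphere_neq0 xS.
have E j : 'D_(e j) ('D_(e j) (@rho R d)) x = 3 * (x 0 j * x 0 j) - 1.
  have C2 : Ck 1 A0 (fun y => (- 1) * dotp (e j) y) := CkZ _ oA (Ck_dotp 1 A0 (e j)).
  have C3 : Ck 1 A0 (fun y => rho y * rho y) := CkM oA (Ck_rho R d 1) (Ck_rho R d 1).
  have C4 : Ck 1 A0 (fun y => rho y * rho y * rho y) := CkM oA C3 (Ck_rho R d 1).
  rewrite (@derive_eq _ _ A0 _ (fun y => (- 1) * dotp (e j) y * (rho y * rho y * rho y)) x) //.
  - rewrite (deriveMf _ oA C2 C4 Ax) (deriveZf _ _ oA (Ck_dotp 1 A0 (e j)) Ax) derive_dotp.
    rewrite (deriveMf _ oA C3 (Ck_rho R d 1) Ax) (deriveMf _ oA (Ck_rho R d 1) (Ck_rho R d 1) Ax).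
    have [_ ->] := is_derive_rho (e j) Ax; rewrite rho_sphere// [dotp (e j) x]dotpC !dotp_e.
    by rewrite mxE !eqxx /=; ring.
  - exact: oA.
  - by move=> y Ay; have [_ ->] := is_derive_rho (e j) Ay; rewrite mulN1r !exprS expr0 mulr1 !mulrA.
rewrite /lap (eq_bigr _ (fun j _ => E j)) sumrB -mulr_sumr -/(dotp x x) (xS : dotp x x = 1) mulr1.
by rewrite sumr_const card_ord.
Qed.

(** Linear forms are the spherical harmonics of degree 1, with eigenvalue [d - 1]. *)
Lemma lap_ext_dotp n x : @sphere R d x -> lap (ext (dotp n)) x = (1 - d%:R) * dotp n x.
Proof.
move=> xS; have Ax : A0 x := sphere_neq0 xS.
rewrite ext_dotpE (lapM oA (Ck_rho R d 2) (Ck_dotp 2 A0 n) Ax) lap_dotp lap_rho// mulr0 add0r.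
rewrite (eq_bigr (fun j => - (n 0 j * x 0 j))).
  by rewrite sumrN -/(dotp n x); ring.
move=> j _; have [_ ->] := is_derive_rho (e j) Ax.
by rewrite derive_dotp rho_sphere// expr1n mulr1 [dotp (e j) x]dotpC !dotp_e; ring.
Qed.

Lemma derive_prod (I : Type) (s : seq I) (G : I -> V -> R) (A : set V) k x v : open A ->
  (forall i, Ck k.+1 A (G i)) -> A x -> (forall i, G i x != 0) ->
  'D_v (fun y => \prod_(i <- s) G i y) x =
  (\prod_(i <- s) G i x) * \sum_(i <- s) 'D_v (G i) x / G i x.
Proof.
move=> oA' CG Ax Gx; elim: s => [|i s IH].
  rewrite !big_nil mulr0; have -> : (fun y => \prod_(i <- [::]) G i y) = (fun=> 1).
    by apply/funext => y; rewrite big_nil.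
  exact: (derive_cst (1 : R)).
have -> : (fun y => \prod_(j <- i :: s) G j y) = (fun y => G i y * \prod_(j <- s) G j y).
  by apply/funext => y; rewrite big_cons.
rewrite (deriveMf v oA' (CG i) (Ck_prod s oA' (P := xpredT) (fun j _ => CG j)) Ax) IH !big_cons.
move: ('D_v (G i) x) (\sum_(j <- s) _) (\prod_(j <- s) _) => D S P; field; exact: Gx.
Qed.

(** The last bracket is twice the sum, over pairs of factors, of products of logarithmic
    derivatives; as a difference of squares, it later turns into squared Euclidean lengths. *)
Lemma lap_prod (I : Type) (s : seq I) (G : I -> V -> R) (A : set V) x : open A ->
  (forall i, Ck 2 A (G i)) -> A x -> (forall i, G i x != 0) ->
  lap (fun y => \prod_(i <- s) G i y) x = (\prod_(i <- s) G i x) *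
   (\sum_(i <- s) lap (G i) x / G i x +
    \sum_c ((\sum_(i <- s) 'D_(e c) (G i) x / G i x) ^+ 2 -
            \sum_(i <- s) ('D_(e c) (G i) x / G i x) ^+ 2)).
Proof.
move=> oA' CG Ax Gx; elim: s => [|i s IH].
  have -> : (fun y => \prod_(i <- [::]) G i y) = (fun=> 1).
    by apply/funext => y; rewrite big_nil.
  rewrite lap_cst !big_nil big1 ?addr0 ?mulr0// => c _.
  by rewrite !big_nil expr0n subr0.
have -> : (fun y => \prod_(j <- i :: s) G j y) = (fun y => G i y * \prod_(j <- s) G j y).
  by apply/funext => y; rewrite big_cons.
have CP := Ck_prod s oA' (P := xpredT) (fun j _ => CG j).
rewrite (lapM oA' (CG i) CP Ax) IH !big_cons.
pose u c := \sum_(j <- s) 'D_(e c) (G j) x / G j x.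
pose t c := 'D_(e c) (G i) x / G i x.
have gi := Gx i.
rewrite [X in _ + 2 * X](eq_bigr (fun c => G i x * (\prod_(j <- s) G j x) * (t c * u c))); last first.
  move=> c _; rewrite (derive_prod s (e c) oA' CG Ax Gx) /t /u.
  by move: ('D_(e c) (G i) x) (\sum_(j <- s) _) (\prod_(j <- s) _) => D S P; field.
rewrite -mulr_sumr [in RHS](eq_bigr (fun c => (u c ^+ 2 - \sum_(j <- s) ('D_(e c) (G j) x / G j x) ^+ 2) + 2 * (t c * u c))); last first.
  by move=> c _; rewrite !big_cons -/(t c) -/(u c); ring.
have E2 : \sum_c 2 * (t c * u c) = 2 * \sum_c t c * u c by rewrite mulr_sumr.
rewrite [in RHS]big_split /= E2 /u.
have key (g P S w z l : R) : g != 0 ->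
  g * (P * (S + w)) + P * l + 2 * (g * P * z) = g * P * (l / g + S + (w + 2 * z)).
  by move=> g0; field.
exact: key.
Qed.

Lemma lap_radial F y : (forall k, Ck k A0 F) -> homog0 A0 F -> y != 0 ->
  lap F y * dotp y y = lap F (radial y).
Proof.
move=> CF hF y0; have c0 : 0 < (enorm y)^-1 by rewrite invr_gt0 enorm_gt0.
rewrite (lap_homog (@punctured_conic R d) oA (CF 2) hF c0 y0) -enorm_sqr.
by rewrite exprVn invrK mulrC.
Qed.

Section Roots.
Variables (k : nat) (b : 'I_k -> V).
Hypothesis bP : root_family b.

Definition root_prod x := \prod_i dotp (b i) x.

Definition root_eigenvalue : R := k%:R * (d%:R - 2 + k%:R).

Lemma ext_root_prod : ext root_prod = (fun x => \prod_i ext (dotp (b i)) x).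
Proof. by []. Qed.

Lemma Ck_root_prod m : Ck m A0 (ext root_prod).
Proof. by rewrite ext_root_prod; apply: (Ck_prod _ oA) => i _; exact: Ck_ext_dotp. Qed.

(* Through logarithmic derivatives; the cross terms <b i, b j> / (l i * l j) cancel by
   root_sum_sqr. *)
Lemma lap_root_prod_generic x : @sphere R d x -> (forall i, dotp (b i) x != 0) ->
  lap (ext root_prod) x = - root_eigenvalue * ext root_prod x.
Proof.
move=> xS xb; have Ax : A0 x := sphere_neq0 xS; have [b1 _ _] := bP.
have qx i : ext (dotp (b i)) x = dotp (b i) x by rewrite /ext /= radial_id.
rewrite ext_root_prod (lap_prod _ oA (fun i => Ck_ext_dotp 2 (b i)) Ax); last first.
  by move=> i; rewrite qx.
rewrite mulrC; congr (_ * _).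
pose l i := dotp (b i) x; have l0 i : l i != 0 by exact: xb.
(* The term [- x 0 c] is the logarithmic derivative of 1/|x|, which makes each factor homogeneous of
   degree 0. *)
have D i c : 'D_(e c) (ext (dotp (b i))) x / ext (dotp (b i)) x = (l i)^-1 * b i 0 c - x 0 c.
  rewrite derive_ext_dotp// qx -/(l i) [dotp (e c) x]dotpC !dotp_e; field; exact: l0.
(* The logarithmic gradient of the product of the linear forms; [Bx] is Euler's identity in degree
   [k]. *)
pose B := \sum_i (l i)^-1 *: b i.
have H1 : \sum_i lap (ext (dotp (b i))) x / ext (dotp (b i)) x = k%:R * (1 - d%:R).
  rewrite (eq_bigr (fun=> 1 - d%:R)) => [|i _].
    by rewrite sumr_const card_ord mulr_natl.
  by rewrite lap_ext_dotp// qx mulfK.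
have Bc c : \sum_i 'D_(e c) (ext (dotp (b i))) x / ext (dotp (b i)) x = B 0 c - k%:R * x 0 c.
  rewrite (eq_bigr _ (fun i _ => D i c)) sumrB sumr_const card_ord mulr_natl; congr (_ - _).
  by rewrite summxE; apply: eq_bigr => i _; rewrite mxE.
have Bx : dotp B x = k%:R.
  rewrite dotp_suml (eq_bigr (fun=> 1)) => [|i _]; first by rewrite sumr_const card_ord.
  by rewrite dotpZl mulVf.
have H2 : \sum_c (B 0 c - k%:R * x 0 c) ^+ 2 = \sum_i l i ^- 2 - k%:R ^+ 2.
  transitivity (dotp (B - k%:R *: x) (B - k%:R *: x)).
    by apply: eq_bigr => c _; rewrite !mxE expr2.
  rewrite dotpBl !dotpBr !dotpZl !dotpZr [dotp x B]dotpC Bx (xS : dotp x x = 1).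
  by rewrite (root_sum_sqr bP xb) -/l; ring.
have H3 : \sum_c \sum_i ('D_(e c) (ext (dotp (b i))) x / ext (dotp (b i)) x) ^+ 2 =
    \sum_i l i ^- 2 - k%:R.
  rewrite exchange_big /= [RHS](_ : _ = \sum_i (l i ^- 2 - 1)); last first.
    by rewrite sumrB sumr_const card_ord.
  apply: eq_bigr => i _.
  transitivity (dotp ((l i)^-1 *: b i - x) ((l i)^-1 *: b i - x)).
    by apply: eq_bigr => c _; rewrite D !mxE expr2.
  rewrite dotpBl !dotpBr !dotpZl !dotpZr [dotp x (b i)]dotpC b1 (xS : dotp x x = 1) -/(l i).
  by field.
rewrite H1 sumrB (eq_bigr _ (fun c _ => congr1 (fun t => t ^+ 2) (Bc c))) H2 H3 /root_eigenvalue.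
ring.
Qed.

(** On the walls the logarithmic derivatives are undefined, but both sides are continuous and
    generic points are dense. *)
Lemma lap_root_prod x : x != 0 ->
  lap (ext root_prod) x * dotp x x = - root_eigenvalue * ext root_prod x.
Proof.
move=> x0; have hF : homog0 A0 (ext root_prod) := @ext_homog0 _ _ _ _.
pose D y := lap (ext root_prod) y * dotp y y + root_eigenvalue * ext root_prod y.
suff : D x = 0 by rewrite /D mulNr => /eqP; rewrite addr_eq0 => /eqP.
apply/eqP; apply: contraT => Dx.
have CD : Ck 0 A0 D.
  apply: (CkD oA _ (CkZ _ oA (Ck_root_prod 0))).
  by apply: (CkM oA _ (Ck_sqnorm _ oA)); exact: Ck_lap oA (Ck_root_prod 2).
have nD : \forall y \near x, D y != 0.
  exact: (Ck_cont CD x0 (open_nbhs_nbhs (conj (@open_neq R 0) Dx))).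
have : nbhs x [set y | y != 0 /\ D y != 0].
  by apply: filterI => //; exact: (open_nbhs_nbhs (conj oA x0)).
rewrite nbhsE => -[Q [oQ Qx] QD].
have [|v /QD[v0 /eqP Dv] vs] := @generic_dense R d [seq b i | i : 'I_k] Q x _ oQ Qx.
  by move=> _ /mapP[i _ ->]; case: bP => b1 _ _; apply: sphere_neq0; exact: b1.
exfalso; apply: Dv; rewrite /D (lap_radial Ck_root_prod hF v0) lap_root_prod_generic.
- have -> : ext root_prod (radial v) = ext root_prod v.
    by rewrite /ext /= radial_id//; exact: radial_sphere.
  by rewrite mulNr addNr.
- exact: radial_sphere.
- move=> i; rewrite dotpZr mulf_neq0 ?invr_eq0 ?enorm_eq0//.
  by apply: vs; apply/mapP; exists i; rewrite ?mem_enum.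
Qed.

Lemma laplace_beltrami_root_prod x : @sphere R d x ->
  - laplace_beltrami root_prod x = root_eigenvalue * root_prod x.
Proof.
move=> xS; rewrite (@laplace_beltramiE _ _ (@sphere R d)) //.
- have := lap_root_prod (sphere_neq0 xS); rewrite (xS : dotp x x = 1) mulr1 => ->.
  by rewrite /ext /= radial_id// mulNr opprK.
- by rewrite cone_sphere; exact: oA.
- by rewrite /sphere_Ck cone_sphere; exact: Ck_root_prod.
Qed.

Lemma root_prod_eigenfunction x : cell b x -> sphere_eigenfunction root_eigenvalue root_prod.
Proof.
move=> xc; split; last exact: laplace_beltrami_root_prod.
  by move=> m; rewrite /sphere_Ck cone_sphere; exact: Ck_root_prod.
exists x; first exact: cell_sphere xc.
by apply/prodf_neq0 => i _; apply: lt0r_neq0; exact: xc.2.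
Qed.

Lemma root_prod_gt0 x : cell b x -> 0 < root_prod x.
Proof. by move=> [_ xb]; apply: prodr_gt0 => i _; exact: xb. Qed.

Lemma root_prod_boundary x : closure (cell b) x -> ~ cell b x -> root_prod x = 0.
Proof.
move=> cx nx; have [//|[i _ [xi _]]] := closure_cell_boundary cx.
by rewrite /root_prod (bigD1 i)//= xi mul0r.
Qed.

End Roots.

(** Each hyperplane of [L] gets its unit normal positive at the base point, whether or not it bounds
    the cell; hence the degree of the product is the cardinality of [L] and not the number of
    sides. *)
Lemma arrangement_normals r (a : 'I_r -> V) (L : set (set V)) : (1 < d)%N ->
  coxeter_arrangement (cell a) L ->
  exists b : 'I_(#|` fset_set L|) -> V, root_family b /\ cell a = cell b.
Proof.
move=> d1 [finL LH [x0 x0A cE] finW actW]; set k := #|` fset_set L|.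
pose h (i : 'I_k) : set V := nth set0 (fset_set L) i.
have hL i : L (h i).
  have : h i \in fset_set L by apply: mem_nth.
  by rewrite in_fset_set// inE.
have hinj : injective h.
  move=> i j /eqP; rewrite nth_uniq ?fset_uniq// => /eqP; exact: val_inj.
have hsur H : L H -> exists i, H = h i.
  move=> /mem_set; rewrite -in_fset_set// => Hf.
  have Hi : (index H (fset_set L) < k)%N by rewrite index_mem.
  by exists (Ordinal Hi); rewrite /h /= nth_index.
have /choice[b bh] : forall i, exists n, [/\ dotp n n = 1, h i = hyperplane n & 0 < dotp n x0].
  move=> i; have [n n0 nE] := LH _ (hL i).
  pose m := radial n; have mm : dotp m m = 1 := radial_sphere n0.
  have mE : h i = hyperplane m.
    by rewrite nE /m /radial hyperplaneZ// invr_eq0 enorm_eq0.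
  have mx : dotp m x0 != 0.
    apply/eqP => mx; have [_] := x0A; apply; exists (h i); first exact: hL.
    by rewrite mE.
  have [mp|mn] := ltP 0 (dotp m x0); first by exists m.
  exists (- m); split; first by rewrite dotpNl dotpNr opprK.
    by rewrite -scaleN1r hyperplaneZ// oppr_eq0 oner_neq0.
  by rewrite dotpNl oppr_gt0 lt_neqAle mx.
have bn0 i : b i != 0 by have [b1 _ _] := bh i; exact: sphere_neq0 b1.
exists b; split.
  split=> [i|i j E|i j]; first by have [] := bh i.
    by apply: hinj; have [_ -> _] := bh i; have [_ -> _] := bh j.
  have [b1 hi _] := bh i; have [b1j hj _] := bh j.
  have Wi : coxeter_group L (refl (b i)).
    move=> G [_ LG]; apply: LG; exists (h i); first exact: hL.
    by rewrite hi reflection_hyperplane.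
  have := actW _ _ Wi (hL j); rewrite hj (image_hyperplane _ (refl_orth (bn0 i))).
  move=> /hsur[j']; have [b1' -> _] := bh j' => E; exists j'.
  have s0 : b j *m refl (b i) != 0 by rewrite (orth_neq0 (refl_orth (bn0 i))).
  have [c c0 cE'] := hyperplane_eq (bn0 j') s0 (esym E); exists c => //.
  have : dotp (b j *m refl (b i)) (b j *m refl (b i)) = 1.
    by rewrite dotp_refl reflK.
  by rewrite cE' dotpZl dotpZr b1' mulr1.
set A := _ `\` _ in x0A cE.
have bA y : A y -> forall i, dotp (b i) y != 0.
  move=> [_ yL] i; apply/eqP => yi; apply: yL; exists (h i); first exact: hL.
  by have [_ -> _] := bh i.
have x0b : cell b x0.
  by split; [exact: x0A.1|move=> i _; have [] := bh i].
have Ab : cell b `<=` A.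
  move=> y [yS yb]; split=> // -[H /hsur[i ->]]; have [_ -> _] := bh i.
  by move=> yi; have := yb i I; rewrite /half_space /= (yi : dotp (b i) y = 0) ltxx.
by rewrite cE -(cell_component d1 Ab _ _ x0b)// => [y []//|y i Ay]; exact: bA.
Qed.

Lemma arrangement_nodal r (a : 'I_r -> V) (L : set (set V)) : (1 < d)%N -> polyhedral a ->
  coxeter_arrangement (cell a) L -> nodal a.
Proof.
move=> d1 [[x xc] _ _] arr; have [b [bP cE]] := arrangement_normals d1 arr.
exists (root_eigenvalue #|` fset_set L|), (root_prod b); rewrite cE in xc *; split.
- exact: (root_prod_eigenfunction bP xc).
- exact: root_prod_gt0.
- move=> y [i _ [yi yc]]; apply: root_prod_boundary; first by rewrite -cE.
  rewrite -cE => -[_ ya]; have := ya i I.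
  by rewrite /half_space /= (yi : dotp (a i) y = 0) ltxx.
Qed.

End RootProduct.

(** * The first Dirichlet eigenvalue *)

Section Barrier.
Variables (R : realType) (d : nat).
Local Notation V := 'rV[R]_d.
Local Notation e j := (e_ R j).
Local Notation A0 := (@punctured R d).
Local Notation oA := (@open_punctured R d).
Implicit Types (x y z v w n : V) (F : V -> R).

Lemma derive_pow (A : set V) k F x v N : open A -> Ck k.+1 A F -> A x ->
  'D_v (fun y => F y ^+ N.+1) x = N.+1%:R * F x ^+ N * 'D_v F x.
Proof.
move=> oA' CF Ax; elim: N => [|N IH].
  by rewrite mul1r expr0 mul1r; congr derive; apply/funext => y; rewrite expr1.
have -> : (fun y => F y ^+ N.+2) = (fun y => F y * F y ^+ N.+1).
  by apply/funext => y; rewrite exprS.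
rewrite (deriveMf v oA' CF (CkX N.+1 oA' CF) Ax) IH.
by move: ('D_v F x) => D; rewrite -[N.+2%:R]natr1 exprS; ring.
Qed.

Lemma lap_sum (I : Type) (s : seq I) (A : set V) (G : I -> V -> R) x : open A ->
  (forall i, Ck 2 A (G i)) -> A x ->
  lap (fun y => \sum_(i <- s) G i y) x = \sum_(i <- s) lap (G i) x.
Proof.
move=> oA' CG Ax; elim: s => [|i s IH].
  have -> : (fun y => \sum_(i <- [::]) G i y) = (fun=> 0).
    by apply/funext => y; rewrite big_nil.
  by rewrite lap_cst big_nil.
have -> : (fun y => \sum_(j <- i :: s) G j y) = (fun y => G i y + \sum_(j <- s) G j y).
  by apply/funext => y; rewrite big_cons.
by rewrite (lapD oA' (CG i) (Ck_sum s oA' (P := xpredT) (fun j _ => CG j)) Ax) IH big_cons.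
Qed.

Lemma lap_pow (A : set V) F x N : open A -> Ck 2 A F -> A x ->
  lap (fun y => F y ^+ N.+2) x = N.+2%:R * F x ^+ N.+1 * lap F x +
    N.+2%:R * N.+1%:R * F x ^+ N * \sum_j 'D_(e j) F x ^+ 2.
Proof.
move=> oA' CF Ax; set S := \sum_j _.
have H M : lap (fun y => F y ^+ M.+2) x = F x * lap (fun y => F y ^+ M.+1) x +
    F x ^+ M.+1 * lap F x + 2 * (M.+1%:R * F x ^+ M * S).
  have -> : (fun y => F y ^+ M.+2) = (fun y => F y * F y ^+ M.+1).
    by apply/funext => y; rewrite exprS.
  rewrite (lapM oA' CF (CkX M.+1 oA' CF) Ax); congr (_ + 2 * _).
  rewrite /S mulr_sumr; apply: eq_bigr => j _; rewrite (derive_pow _ M oA' CF Ax).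
  by move: ('D_(e j) F x) => D; ring.
elim: N => [|N IH]; rewrite H.
  have -> : (fun y => F y ^+ 1) = F by apply/funext => y; rewrite expr1.
  by rewrite !expr1 expr0; ring.
rewrite IH; move: (lap F x) => l.
by rewrite -[N.+3%:R]natr1 -[N.+2%:R]natr1 !exprS; ring.
Qed.

(** On the sphere [1 - l] has Laplacian [(d - 1) l], and its gradient is minus the tangential part
    of [n], of squared length [1 - l ^+ 2]. *)
Lemma lap_subr_ext_dotp_pow n x N : dotp n n = 1 -> @sphere R d x ->
  let l := dotp n x in
  lap (fun y => (1 - ext (dotp n) y) ^+ N.+2) x =
    N.+2%:R * (1 - l) ^+ N.+1 * ((d%:R - 1) * l) +
    N.+2%:R * N.+1%:R * (1 - l) ^+ N * (1 - l ^+ 2).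
Proof.
move=> nn xS l; have Ax : A0 x := sphere_neq0 xS.
have Cq := Ck_ext_dotp 2 n; have C1 : Ck 2 A0 (fun=> 1 : R) by exact: Ck_cst.
have qx : ext (dotp n) x = l by rewrite /ext /= radial_id.
rewrite (lap_pow N oA (CkB oA C1 Cq) Ax) qx (lapB oA C1 Cq Ax) lap_cst.
rewrite lap_ext_dotp// sub0r -mulNr opprB; congr (_ + _ * _).
have -> : (fun y => 1 - ext (dotp n) y) = (fun y => 1 + (-1) * ext (dotp n) y).
  by apply/funext => y; rewrite mulN1r.
transitivity (dotp (n - l *: x) (n - l *: x)).
  apply: eq_bigr => j _.
  rewrite (deriveDf (e j) oA C1 (CkZ (-1) oA Cq) Ax) (deriveZf (e j) (-1) oA Cq Ax).
  rewrite (derive_cst (1 : R)) derive_ext_dotp// [dotp (e j) x]dotpC !dotp_e.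
  by rewrite !mxE -/l; ring.
rewrite dotpBl !dotpBr !dotpZl !dotpZr [dotp x n]dotpC nn (xS : dotp x x = 1) -/l.
ring.
Qed.

Section Supersolution.
Variables (k : nat) (b : 'I_k -> V).
Hypothesis bP : root_family b.
Hypothesis d1 : (1 < d)%N.

(* root_prod b alone vanishes on the boundary, where m / root_prod b cannot be
   controlled.  The second term is positive up to the boundary, and the concave
   functions 1 - (1 - l)^(N+2) make it a strict supersolution near the walls. *)
Definition barrier (N : nat) (t : R) x :=
  root_prod b x + t * (1 + k%:R - \sum_i (1 - dotp (b i) x) ^+ N.+2).

Lemma ext_barrier N t : ext (barrier N t) = (fun x => ext (root_prod b) x +
  t * (1 + k%:R - \sum_i (1 - ext (dotp (b i)) x) ^+ N.+2)).
Proof. by []. Qed.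

Lemma Ck_barrier m N t : Ck m A0 (ext (barrier N t)).
Proof.
rewrite ext_barrier; apply: (CkD oA (Ck_root_prod _ _)); apply: (CkZ _ oA).
apply: (CkB oA); first exact: Ck_cst.
apply: (Ck_sum _ oA) => i _; apply: (CkX _ oA); apply: (CkB oA (Ck_cst _ _ _)).
exact: Ck_ext_dotp.
Qed.

Lemma closure_cell_dotp x i : closure (cell b) x -> 0 <= dotp (b i) x <= 1.
Proof.
move=> /closure_cell[xS xb]; rewrite xb /=; have [b1 _ _] := bP.
by apply: le_trans (ler_norm _) _; exact: sphere_le.
Qed.

(** Keeps the bracket in [barrier] between 1 and [1 + k]. *)
Lemma barrier_sum_ge0 N x : closure (cell b) x ->
  0 <= \sum_i (1 - dotp (b i) x) ^+ N.+2 <= k%:R.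
Proof.
move=> xc; apply/andP; split.
  apply: sumr_ge0 => i _; have /andP[_ l1] := closure_cell_dotp i xc.
  by rewrite exprn_ge0// subr_ge0.
rewrite -[in leRHS](card_ord k) -sum1_card natr_sum; apply: ler_sum => i _.
have /andP[l0 l1] := closure_cell_dotp i xc.
by apply: exprn_ile1; rewrite ?subr_ge0// lerBlDr lerDl.
Qed.

Lemma barrier_gt0 N t x : 0 < t -> closure (cell b) x -> 0 < barrier N t x.
Proof.
move=> t0 xc; apply: ltr_wpDl.
  by apply: prodr_ge0 => i _; have /andP[] := closure_cell_dotp i xc.
have /andP[_ sk] := barrier_sum_ge0 N xc.
by rewrite mulr_gt0// -addrA ltr_pwDl// subr_ge0.
Qed.

Lemma lap_barrier N t x : @sphere R d x ->
  lap (ext (barrier N t)) x = - root_eigenvalue R d k * root_prod b x -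
    t * \sum_i lap (fun y => (1 - ext (dotp (b i)) y) ^+ N.+2) x.
Proof.
move=> xS; have Ax : A0 x := sphere_neq0 xS.
have CW i : Ck 2 A0 (fun y => (1 - ext (dotp (b i)) y) ^+ N.+2).
  apply: (CkX _ oA); apply: (CkB oA (Ck_cst _ _ _)); exact: Ck_ext_dotp.
have CS : Ck 2 A0 (fun y => \sum_i (1 - ext (dotp (b i)) y) ^+ N.+2).
  by apply: (Ck_sum _ oA) => i _.
have Cc : Ck 2 A0 (fun=> 1 + k%:R : R) by exact: Ck_cst.
rewrite ext_barrier (lapD oA (Ck_root_prod b 2) (CkZ t oA (CkB oA Cc CS)) Ax).
rewrite (lapZ t oA (CkB oA Cc CS) Ax) (lapB oA Cc CS Ax) lap_cst sub0r mulrN.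
have := lap_root_prod bP Ax; rewrite (xS : dotp x x = 1) mulr1 /ext /= radial_id// => ->.
by congr (_ - t * _); exact: (lap_sum _ oA CW Ax).
Qed.

Lemma lap_pow_ge0 N x i : cell b x ->
  0 <= lap (fun y => (1 - ext (dotp (b i)) y) ^+ N.+2) x.
Proof.
move=> xc; have [b1 _ _] := bP; rewrite lap_subr_ext_dotp_pow; [|exact: b1|exact: cell_sphere xc].
have /andP[l0 l1] := closure_cell_dotp i (subset_closure xc).
have d0 : (0 : R) <= d%:R - 1 by rewrite subr_ge0 ler1n ltnW.
have l2 : dotp (b i) x ^+ 2 <= 1 by rewrite exprn_ile1.
have w0 : 0 <= 1 - dotp (b i) x by rewrite subr_ge0.
by rewrite addr_ge0// !mulr_ge0// ?exprn_ge0// subr_ge0.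
Qed.

Lemma bernoulli_ineq (u : R) N : 0 <= u <= 1 -> 1 - N%:R * u <= (1 - u) ^+ N.
Proof.
move=> /andP[u0 u1]; elim: N => [|N IH]; first by rewrite mul0r subr0 expr0.
rewrite exprS -natr1; have : (1 - u) * (1 - N%:R * u) <= (1 - u) * (1 - u) ^+ N.
  by rewrite ler_wpM2l// subr_ge0.
apply: le_trans; have : 0 <= N%:R * (u * u) by rewrite !mulr_ge0.
by move: (N%:R : R) => M; nra.
Qed.

(** At height at most [1 / (2 (N + 2))] over the wall, Bernoulli's inequality gives
    [(1 - l) ^+ N >= 1/2], and [1 - l ^+ 2 >= 1/2] as well; the squared gradient thus contributes at
    least [(N + 2) (N + 1) / 4]. *)
Lemma lap_pow_large N x i : cell b x -> N.+2%:R * (2 * dotp (b i) x) <= 1 ->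
  N%:R <= 4 * lap (fun y => (1 - ext (dotp (b i)) y) ^+ N.+2) x.
Proof.
move=> xc; have [b1 _ _] := bP; rewrite lap_subr_ext_dotp_pow; [|exact: b1|exact: cell_sphere xc].
have := closure_cell_dotp i (subset_closure xc); move: (dotp (b i) x) => l l01 lN.
have B := bernoulli_ineq N l01; case/andP: l01 => l0 l1.
have d0 : (0 : R) <= d%:R - 1 by rewrite subr_ge0 ler1n ltnW.
have P1 : 0 <= N.+2%:R * (1 - l) ^+ N.+1 * ((d%:R - 1) * l).
  by rewrite !mulr_ge0// ?exprn_ge0 ?subr_ge0.
apply: (@le_trans _ _ (4 * (N.+2%:R * N.+1%:R * (1 - l) ^+ N * (1 - l ^+ 2)))); last first.
  by rewrite ler_pM2l// lerDr.
move: B lN; rewrite -[N.+2%:R]natr1 -[N.+1%:R]natr1; have : (0 : R) <= N%:R by [].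
move: (N%:R : R) ((1 - l) ^+ N) => M w M0 B lN.
have Ml : 0 <= M * l by rewrite mulr_ge0.
have w2 : 1 / 2 <= w by nra.
have l4 : l <= 1 / 4 by nra.
have l3 : 1 / 2 <= 1 - l ^+ 2 by rewrite expr2; nra.
have wl : 1 / 4 <= w * (1 - l ^+ 2).
  have -> : 1 / 4 = 1 / 2 * (1 / 2) :> R by field.
  by apply: ler_pM => //; lra.
rewrite -mulrA; apply: (@le_trans _ _ (4 * ((M + 1 + 1) * (M + 1) * (1 / 4)))).
  by nra.
rewrite ler_pM2l// ler_wpM2l//; nra.
Qed.

(** [K] exceeds [mu] times the bracket of the barrier. Since [N > 4 K], the Laplacian term exceeds
    [K] within height [tau] of some wall, [tau] being the bound in [lap_pow_large]. Elsewhere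
    [root_prod b] is at least [tau ^+ k], and [t] is such that the eigenvalue gap covers [t * K]
    there. *)
Lemma supersolution mu : mu < root_eigenvalue R d k -> exists g : V -> R,
  [/\ forall m, Ck m A0 (ext g),
      forall x, closure (cell b) x -> 0 < g x
    & forall x, cell b x -> mu * g x < - lap (ext g) x].
Proof.
move=> mul; pose K : R := `|mu| * (1 + k%:R) + 1.
have K0 : 0 < K by rewrite ltr_wpDl// mulr_ge0.
pose N := Num.bound (4 * K); have NK : 4 * K < N%:R.
  by apply: archi_boundP; rewrite mulr_ge0// ltW.
pose tau : R := (2 * N.+2%:R)^-1; have tau0 : 0 < tau by rewrite invr_gt0 mulr_gt0.
pose t : R := (root_eigenvalue R d k - mu) * tau ^+ k / K.
have t0 : 0 < t by rewrite divr_gt0// mulr_gt0 ?subr_gt0 ?exprn_gt0.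
exists (barrier N t); split=> [m|x|x xc]; [exact: Ck_barrier|exact: barrier_gt0|].
have xS := cell_sphere xc; have xcc := subset_closure xc.
rewrite lap_barrier//; set Q := \sum_i _.
have Q0 : 0 <= Q by apply: sumr_ge0 => i _; exact: lap_pow_ge0.
have P0 : 0 < root_prod b x := root_prod_gt0 xc.
rewrite /barrier; set S := 1 + k%:R - _.
have muS : mu * S < K.
  have /andP[s0 sk] := barrier_sum_ge0 N xcc.
  apply: (@le_lt_trans _ _ (`|mu| * (1 + k%:R))); last by rewrite ltrDl.
  apply: le_trans (ler_norm _) _; rewrite normrM ler_wpM2l// ger0_norm.
    by rewrite lerBlDr lerDl.
  by rewrite /S -addrA addr_ge0// subr_ge0.
suff : 0 < (root_eigenvalue R d k - mu) * root_prod b x + t * (Q - mu * S).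
  by move: (root_eigenvalue R d k) (root_prod b x) => l P; nra.
have [/existsP[i li]|] := boolP [exists i, dotp (b i) x <= tau].
  apply: ltr_pwDl; first by rewrite mulr_gt0 ?subr_gt0.
  rewrite mulr_ge0 ?(ltW t0)// subr_ge0; apply: le_trans (ltW muS) _.
  rewrite -(@ler_pM2l _ 4)//; apply: le_trans (ltW NK) _.
  apply: (@le_trans _ _ (4 * lap (fun y => (1 - ext (dotp (b i)) y) ^+ N.+2) x)).
    apply: lap_pow_large => //; rewrite mulrA -ler_pdivlMl ?mulr_gt0// mulr1.
    by rewrite [N.+2%:R * 2]mulrC.
  rewrite ler_pM2l// /Q (bigD1 i)//= lerDl; apply: sumr_ge0 => j _; exact: lap_pow_ge0.
rewrite negb_exists => /forallP lt.
have Pt : tau ^+ k <= root_prod b x.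
  rewrite /root_prod -[k in leLHS]card_ord -prodr_const; apply: ler_prod => i _.
  by rewrite (ltW tau0) /= ltW// ltNge; exact: lt.
have tK : t * K = (root_eigenvalue R d k - mu) * tau ^+ k by rewrite /t divfK// gt_eqF.
have tS : t * (mu * S) < t * K by rewrite ltr_pM2l.
have tQ : 0 <= t * Q by rewrite mulr_ge0// ltW.
have : (root_eigenvalue R d k - mu) * tau ^+ k <= (root_eigenvalue R d k - mu) * root_prod b x.
  by rewrite ler_pM2l// subr_gt0.
rewrite mulrBr -tK; move: (_ * root_prod b x) (t * K) (t * Q) (t * (mu * S)) tS tQ => p q r s.
by move=> *; lra.
Qed.

(** If [m / g] had a positive maximum [v], it would be attained at an interior point, where
    [m - v g] has maximum 0 and so Laplacian at most 0. But there [lap m = - mu v g > v lap g]. *)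
Lemma comparison mu g m : Ck 2 A0 (ext g) ->
  (forall x, closure (cell b) x -> 0 < g x) ->
  (forall x, cell b x -> mu * g x < - lap (ext g) x) ->
  sphere_Ck 2 (cell b) m -> {within closure (cell b), continuous m} ->
  (forall x, closure (cell b) x -> ~ cell b x -> m x = 0) ->
  (forall x, cell b x -> - lap (ext m) x = mu * m x) ->
  forall x, cell b x -> m x <= 0.
Proof.
move=> Cg g0 Lg Cm cm m0 Lm x xc; rewrite leNgt; apply/negP => mx.
have gE y : closure (cell b) y -> ext g y = g y.
  by move=> /closure_cell[yS _]; rewrite /ext /= radial_id.
have [||c ccl cM] := @EVT_max_rV R d (fun y => m y * (ext g y)^-1) (closure (cell b)) _ (@compact_closure_cell _ _ _ b).
- by exists x; exact: subset_closure.
- have cV : {within closure (cell b), continuous (fun y => (ext g y)^-1)}.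
    apply: continuous_in_subspaceT => y; rewrite inE => yc.
    have gy : ext g y != 0 by rewrite gE// gt_eqF// g0.
    by have [yS _] := closure_cell yc; exact: (cvgV gy (Ck_cont Cg (sphere_neq0 yS))).
  by move=> y; exact: (cvgM (cm y) (cV y)).
rewrite inE in ccl; pose v := m c / g c.
have xv y : closure (cell b) y -> m y <= v * g y.
  move=> yc; have := cM y; rewrite inE !gE// => /(_ yc).
  by rewrite ler_pdivrMr// g0.
have v0 : 0 < v.
  have := lt_le_trans mx (xv _ (subset_closure xc)).
  by rewrite pmulr_lgt0// g0//; exact: subset_closure.
have gc := g0 _ ccl.
have cc : cell b c.
  apply: contrapT => nc; move: v0; rewrite /v m0// mul0r ltxx//.
have oC := @open_cone_cell _ _ _ b; have cS := cell_sphere cc.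
have Ac : cone (cell b) c by apply: cone_sphere_mem => //; exact: cell_sphere.
have Cg' : Ck 2 (cone (cell b)) (ext g) := Ck_sub (cone_sub (@cell_sphere _ _ _ b)) Cg.
have [|_] := @lap_max _ _ (cone (cell b)) (fun y => ext m y - v * ext g y) c oC (CkB oC Cm (CkZ v oC Cg')) Ac.
  move=> y yA; apply: (@le_trans _ _ 0).
    by rewrite subr_le0; apply: xv; exact: subset_closure.
  by rewrite gE// {1}/ext /= radial_id// /v divfK ?subrr// gt_eqF.
rewrite (lapB oC Cm (CkZ v oC Cg') Ac) (lapZ v oC Cg' Ac).
have := Lm _ cc; have := Lg _ cc.
have -> : m c = v * g c by rewrite /v divfK// gt_eqF.
move: (lap _ c) (lap _ c) (g c) v0 => lm lg G v0 H1 H2.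
have : v * (mu * G) < v * - lg by rewrite ltr_pM2l.
by nra.
Qed.

End Supersolution.

Lemma arrangement_lambda1 r (a : 'I_r -> V) (L : set (set V)) : (1 < d)%N ->
  cell a !=set0 -> coxeter_arrangement (cell a) L ->
  is_lambda1 (cell a) (boundary a) (root_eigenvalue R d #|` fset_set L|).
Proof.
move=> d1 [x xc] arr; have [b [bP cE]] := arrangement_normals d1 arr.
have bdP y : boundary a y <-> closure (cell b) y /\ ~ cell b y.
  rewrite -cE; split=> [[i _ [yi yc]]|[yc ny]].
    split=> // -[_ ya]; have := ya i I.
    by rewrite /half_space /= (yi : dotp (a i) y = 0) ltxx.
  by have [] := closure_cell_boundary yc.
rewrite cE in xc *.
have bS := @cell_sphere _ _ _ b; have oC := @open_cone_cell _ _ _ b.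
have CP : sphere_Ck 2 (cell b) (root_prod b) := Ck_sub (cone_sub bS) (Ck_root_prod b 2).
split.
  exists (root_prod b); split=> //.
  - apply: continuous_subspaceT => y.
    suff /Ck_cont : Ck 0 setT (root_prod b) by apply.
    by apply: (Ck_prod _ openT) => i _; exact: Ck_dotp.
  - by exists x => //; rewrite gt_eqF// root_prod_gt0.
  - by move=> y yc; apply: (laplace_beltrami_root_prod bP); exact: cell_sphere yc.
  - by move=> y /bdP[yc ny]; exact: root_prod_boundary.
move=> mu [m [Cm cm [z zc mz] Lm m0]]; rewrite leNgt; apply/negP => lt.
have [g [Cg g0 Lg]] := supersolution bP d1 lt.
have Lm' y : cell b y -> - lap (ext m) y = mu * m y.
  by move=> yc; rewrite -Lm// (laplace_beltramiE bS oC Cm yc).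
have m0' y : closure (cell b) y -> ~ cell b y -> m y = 0 by move=> yc ny; apply/m0/bdP.
have mz1 : m z <= 0 := comparison (Cg 2) g0 Lg Cm cm m0' Lm' zc.
(* The comparison applies to [- m] as well, which leaves only [m z = 0]. *)
have EN : ext (fun y => - 1 * m y) = (fun y => - 1 * ext m y) by [].
have : - 1 * m z <= 0.
  apply: (comparison (m := fun y => - 1 * m y) (Cg 2) g0 Lg _ _ _ _ zc) => [||y yc ny|y yc].
  - by rewrite /sphere_Ck EN; exact: (CkZ (-1) oC Cm).
  - by move=> y; exact: (cvgM (cvg_cst (-1 : R)) (cm y)).
  - by rewrite m0' ?mulr0.
  - by rewrite EN (lapZ (-1) oC Cm (cone_sphere_mem bS yc)) -mulrN Lm'// mulrCA.
by rewrite mulN1r oppr_le0 => mz2; move: mz; rewrite eq_le mz1 mz2.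
Qed.

End Barrier.

Theorem theorem14 (R : realType) (d : nat) (hd : (2 <= d)%N)
    (r : nat) (a : 'I_r -> 'rV[R]_d) (ha : polyhedral a) :
  (nodal a <-> exists L : set (set 'rV[R]_d), coxeter_arrangement (cell a) L) /\
  (forall L : set (set 'rV[R]_d), coxeter_arrangement (cell a) L ->
     let k := #|` fset_set L| in
     is_lambda1 (cell a) (boundary a) (k%:R * (d%:R - 2 + k%:R))).
Proof.
split; first by split=> [/(nodal_arrangement hd ha)|[L /(arrangement_nodal hd ha)]].
by move=> L /=; apply: arrangement_lambda1 => //; case: ha.
Qed.
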